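(* Let $C\subset\mathbb{R}^{n+1}$ be an unbounded convex body. The following assertions are equivalent: (i) for all $r>0$, $\inf_{x\in C}|\overline{B}_C(x,r)|>0$; (ii) $C$ is a convex body of uniform geometry; (iii) all asymptotic cylinders of $C$ are convex bodies (i.e. have non-empty interior); (iv) for all $v>0$, $I_C(v)>0$; (v) there exists $v_0>0$ such that $I_C(v_0)>0$. Moreover, any of these conditions implies $\inf_{x\in\partial C}\alpha(C_x)>0$, where $C_x$ is the tangent cone of $C$ at $x$ and $\alpha(C_x)$ its solid angle.
   Context: Here $n\ge 1$. A convex body is a closed convex subset of $\mathbb{R}^{n+1}$ with non-empty interior. $|E|$ is Lebesgue measure, $\overline{B}_C(x,r)=C\cap\overline{B}(x,r)$ with $\overline{B}(x,r)$ the closed Euclidean ball. For measurable $E\subset C$ the relative perimeter is $P_C(E)=\sup\{\int_E \mathrm{div}\,\xi\,dx:\ \xi$ a smooth vector field with compact support in $\mathrm{int}(C)$, $|\xi|\le 1\}$, and the isoperimetric profile is $I_C(v)=\inf\{P_C(E): E\subset C \text{ measurable}, |E|=v\}$. $C$ is a convex body of uniform geometry if it is unbounded and there is some $r_0>0$ with $\inf_{x\in C}|\overline{B}_C(x,r_0)|>0$. A sequence $C_i$ of closed convex sets converges locally in Hausdorff distance to a closed convex set $K$ if, for every open ball $B$ with $K\cap B\ne\emptyset$, $C_i\cap\overline{B}$ converges to $K\cap\overline{B}$ in Hausdorff distance. An asymptotic cylinder of $C$ is any local Hausdorff limit $K$ of a sequence $-x_i+C$, where $x_i\in C$ and $|x_i|\to\infty$.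 (Such limits are always convex cylinders, i.e. direct sums of a non-trivial linear subspace and a closed convex set in its orthogonal complement, possibly with empty interior.) The tangent cone $C_p$ of $C$ at $p$ is the closure of $\bigcup_{\lambda>0}\{p+\lambda(x-p):x\in C\}$. The solid angle of a closed cone $L$ with vertex $p$ is $\alpha(L)=\mathcal{H}^n(\partial B(p,1)\cap\mathrm{int}(L))$. *)

(* Defs.v *)
From HB Require Import structures.
From mathcomp Require Import all_boot all_order all_algebra.
From mathcomp Require Import all_classical all_reals all_analysis.

Set Implicit Arguments.
Unset Strict Implicit.
Unset Printing Implicit Defensive.

Import Order.TTheory GRing.Theory Num.Theory.
Import numFieldNormedType.Exports.

Local Open Scope classical_set_scope.
Local Open Scope ring_scope.

(* The norm `|x| of the library on 'rV[R]_m is the maximum norm. It induces the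
   usual topology and bounded sets, but metric notions (balls, distances,
   spheres) are stated below with the Euclidean norm. *)
Section euclidean.
Context {R : realType} {m : nat}.
Implicit Types (x y p : 'rV[R]_m) (r : R) (A B : set 'rV[R]_m).

Definition enorm x : R := Num.sqrt (\sum_i x ord0 i ^+ 2).

Definition eball p r : set 'rV[R]_m := [set x | enorm (x - p) < r].

Definition ecball p r : set 'rV[R]_m := [set x | enorm (x - p) <= r].

Definition esphere p r : set 'rV[R]_m := [set x | enorm (x - p) = r].

(* The point 0 is added so that the empty set has diameter 0 and not -oo. *)
Definition ediam A : \bar R :=
  ereal_sup (0%E |` [set (enorm (x - y))%:E | x in A & y in A]).

(* +oo if A is empty *)
Definition dist_to A p : \bar R :=
  ereal_inf [set (enorm (p - y))%:E | y in A].

Definition thickening A r : set 'rV[R]_m := [set p | (dist_to A p <= r%:E)%E].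

Definition hausdorff_dist A B : \bar R :=
  ereal_inf [set r%:E | r in
    [set r | 0 < r /\ A `<=` thickening B r /\ B `<=` thickening A r]].

End euclidean.

Section cover_outer_measure.
Local Open Scope ereal_scope.
Context {R : realType} {T I : Type}.
Variables (A : I -> set T) (g : I -> \bar R).

Definition cover_outer (X : set T) : \bar R :=
  ereal_inf [set \sum_(k <oo) g (s k) | s in
    [set s : I^nat | X `<=` \bigcup_k A (s k)]].

Hypothesis g_ge0 : forall i, 0 <= g i.

Lemma cover_outer_ge0 X : 0 <= cover_outer X.
Proof.
by apply: le_ereal_inf_tmp => _ [s _ <-]; apply: nneseries_ge0 => k _ _.
Qed.

Lemma le_cover_outer : {homo cover_outer : X Y / X `<=` Y >-> X <= Y}.
Proof.
move=> X Y XY; apply: ereal_inf_le_tmp => _ [s Ys <-].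
by exists s => //; exact: subset_trans Ys.
Qed.

Lemma cover_outer0 : (exists i, g i = 0) -> cover_outer set0 = 0.
Proof.
move=> [i gi0]; apply/eqP; rewrite eq_le cover_outer_ge0 andbT.
by apply: ereal_inf_lbound; exists (fun=> i) => //; exact: eseries0.
Qed.

Lemma cover_outer_sigma_subadditive : sigma_subadditive cover_outer.
Proof.
move=> X; have [[i ioo]|] := pselect (exists i, cover_outer (X i) = +oo).
  rewrite (eseries_pinfty _ _ ioo) ?leey// => n _.
  by rewrite -ltNye (lt_le_trans _ (cover_outer_ge0 _)).
rewrite -forallNE => Xoo.
suff add2e (e : {posnum R}) : cover_outer (\bigcup_n X n) <=
    \sum_(i <oo) cover_outer (X i) + e%:num%:E.
  by apply/lee_addgt0Pr => _/posnumP[].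
rewrite (le_trans _ (epsilon_trick _ _ _))//; last first.
  by move=> n; exact: cover_outer_ge0.
pose P n (s : I^nat) := X n `<=` \bigcup_k A (s k) /\
  \sum_(k <oo) g (s k) <= cover_outer (X n) + (e%:num / (2 ^ n.+1)%:R)%:E.
have [G PG] : {G : (I^nat)^nat & forall n, P n (G n)}.
  apply: (@choice _ _ P) => n; rewrite /P /cover_outer.
  set S := (X in ereal_inf X); move infS : (ereal_inf S) => iS.
  case: iS infS => [r Sr|Soo|Soo].
  - have en1 : (0 < e%:num / (2 ^ n.+1)%:R)%R by [].
    have /(lb_ereal_inf_adherent en1) : ereal_inf S \is a fin_num by rewrite Sr.
    by move=> [x [s Xs sx] xS]; exists s; split => //; rewrite sx -Sr; exact/ltW.
  - by have := Xoo n; rewrite /cover_outer Soo.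
  - suff : lbound S 0 by move/le_ereal_inf_tmp; rewrite Soo.
    by move=> /= _ [s _ <-]; exact: nneseries_ge0.
have gG_ge0 x : 0 <= (g \o uncurry G) x by exact: g_ge0.
apply: (@le_trans _ _ (\esum_(i in setT) (g \o uncurry G) i)).
  apply: ereal_inf_lbound => /=.
  have /card_esym/ppcard_eqP[f] := card_nat2.
  exists (uncurry G \o f).
    move=> t [i _] /(PG i).1[j _ Gijt]; exists (f^-1%FUN (i, j)) => //=.
    by rewrite invK ?inE.
  rewrite -(esum_pred_image (g \o uncurry G) _ xpredT) ?[fun=> _]set_true//.
  by rewrite image_eq.
rewrite (_ : esum _ _ = \sum_(i <oo) \sum_(j <oo) g (G i j)); last first.
  pose J : nat -> set (nat * nat) := fun i => [set (i, j) | j in setT].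
  rewrite (_ : setT = \bigcup_k J k); last first.
    by rewrite predeqE => -[a b]; split => // _; exists a => //; exists b.
  rewrite esum_bigcupT /=; last 2 first.
    - apply/trivIsetP => i j _ _ ij.
      rewrite predeqE => -[n k] /=; split => //= -[] [_] _ [<-{n} _].
      by move=> [k' _] [] /esym/eqP; rewrite (negbTE ij).
    - by move=> /= [? ?]; exact: g_ge0.
  rewrite -(image_id [set: nat]) -fun_true esum_pred_image//; last first.
    by move=> n _; exact: esum_ge0.
  apply: eq_eseriesr => /= j _.
  rewrite -(esum_pred_image (g \o uncurry G) (pair j) predT)//=; last first.
    by move=> ? ? _ _; exact: (@can_inj _ _ _ snd).
  by congr esum; rewrite predeqE => -[a b]; split; move=> [i _ <-]; exists i.
by apply: lee_nneseries => [n _ _|n _]; [exact: nneseries_ge0|exact: (PG n).2].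
Qed.

End cover_outer_measure.

Section lebesgue.
Context {R : realType}.
Implicit Types m : nat.

Definition box m (ab : 'rV[R]_m * 'rV[R]_m) : set 'rV[R]_m :=
  [set x | forall i, ab.1 ord0 i < x ord0 i <= ab.2 ord0 i].

Definition box_volume m (ab : 'rV[R]_m * 'rV[R]_m) : \bar R :=
  (\prod_i Num.max 0 (ab.2 ord0 i - ab.1 ord0 i))%:E.

(* The index None stands for the empty set, so that finite covers are allowed;
   this only matters for m = 0, where no box is empty. *)
Definition lebesgue_outer m : set 'rV[R]_m -> \bar R :=
  cover_outer (oapp (@box m) set0) (oapp (@box_volume m) 0%E).

Lemma box_volume_ge0 m (ab : 'rV[R]_m * 'rV[R]_m) : (0 <= box_volume ab)%E.
Proof. by rewrite lee_fin; apply: prodr_ge0 => i _; rewrite le_max lexx. Qed.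

Lemma lebesgue_gauge_ge0 m (o : option ('rV[R]_m * 'rV[R]_m)) :
  (0 <= oapp (@box_volume m) 0 o)%E.
Proof. by case: o => //= ab; exact: box_volume_ge0. Qed.

HB.instance Definition _ m := isOuterMeasure.Build R 'rV[R]_m
  (@lebesgue_outer m)
  (cover_outer0 _ (@lebesgue_gauge_ge0 m) (ex_intro _ None erefl))
  (cover_outer_ge0 _ (@lebesgue_gauge_ge0 m))
  (@le_cover_outer _ _ _ _ _)
  (cover_outer_sigma_subadditive _ (@lebesgue_gauge_ge0 m)).

(* Lebesgue measurable sets are the Caratheodory measurable ones, and Lebesgue
   measure is the (complete) measure that the outer measure induces on them. *)
Definition lebesgue_space m : measurableType _ :=
  caratheodory_type (@lebesgue_outer m).

Definition lebesgue m : set (lebesgue_space m) -> \bar R := @lebesgue_outer m.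

HB.instance Definition _ m := Measure.copy (@lebesgue m)
  ((@lebesgue_outer m : {outer_measure set 'rV[R]_m -> \bar R})
     : set (lebesgue_space m) -> \bar R).

End lebesgue.
Arguments lebesgue {R m}.

Section hausdorff_measure.
Local Open Scope ereal_scope.
Context {R : realType} {m : nat}.
Implicit Types (d : nat) (A E : set 'rV[R]_m).

Definition ball_volume d : \bar R := lebesgue [set x : 'rV[R]_d | (enorm x <= 1)%R].

(* Normalised so that the d-dimensional Hausdorff measure of R^d is Lebesgue
   measure. The test on set0 only matters for d = 0. *)
Definition hausdorff_gauge d A : \bar R :=
  if A == set0 then 0 else ball_volume d * (2^-1%:E * ediam A) ^+ d.

Definition hausdorff_premeasure d (delta : R) E : \bar R :=
  ereal_inf [set \sum_(k <oo) hausdorff_gauge d (A k) | A in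
    [set A : (set 'rV[R]_m)^nat |
      E `<=` \bigcup_k A k /\ forall k, ediam (A k) <= delta%:E]].

Definition hausdorff_measure d E : \bar R :=
  ereal_sup [set hausdorff_premeasure d delta E | delta in
    [set delta | (0 < delta)%R]].

End hausdorff_measure.

Section vector_fields.
Context {R : realType} {m : nat}.
Implicit Types xi : 'rV[R]_m -> 'rV[R]_m.

Definition partial (i : 'I_m) xi : 'rV[R]_m -> 'rV[R]_m :=
  'D_(delta_mx ord0 i) xi.

(* C^oo: every iterated partial derivative is differentiable, hence continuous *)
Definition smooth xi : Prop :=
  forall (s : seq 'I_m) x, differentiable (foldr partial xi s) x.

Definition divergence xi x : R := \tr ('J xi x).

Definition field_support xi : set 'rV[R]_m := closure [set x | xi x != 0].

End vector_fields.

Section convex_bodies.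
Context {R : realType} {m : nat}.
Implicit Types (C E K L : set 'rV[R]_m) (p x : 'rV[R]_m) (r v : R).

Definition convex_body C : Prop :=
  [/\ closed C, convex_set C & C° !=set0].

Definition rel_ball C x r : set 'rV[R]_m := C `&` ecball x r.

Definition inf_ball_volume C r : \bar R :=
  ereal_inf [set lebesgue (rel_ball C x r) | x in C].

Definition uniform_geometry C : Prop :=
  [/\ convex_body C, ~ bounded_set C &
      exists2 r, 0 < r & (0 < inf_ball_volume C r)%E].

Definition perimeter C E : \bar R :=
  ereal_sup [set (\int[lebesgue]_(x in E) (divergence xi x)%:E)%E | xi in
    [set xi | [/\ smooth xi, compact (field_support xi),
                  field_support xi `<=` C° & forall x, enorm (xi x) <= 1]]].

Definition isoperimetric_profile C v : \bar R :=
  ereal_inf [set perimeter C E | E in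
    [set E : set (lebesgue_space m) |
      [/\ measurable E, E `<=` C & lebesgue E = v%:E]]].

Definition locally_hausdorff_cvg (C_ : nat -> set 'rV[R]_m) K : Prop :=
  forall p r, 0 < r -> K `&` eball p r !=set0 ->
    hausdorff_dist (C_ i `&` ecball p r) (K `&` ecball p r) @[i --> \oo]
      --> 0%E.

(* K is required to be nonempty: the empty set would vacuously be a local limit
   of every sequence. *)
Definition asymptotic_cylinder C K : Prop :=
  [/\ closed K, convex_set K, K !=set0 &
    exists x : nat -> 'rV[R]_m,
      [/\ forall i, C (x i), enorm (x i) @[i --> \oo] --> +oo &
          locally_hausdorff_cvg (fun i => [set - x i + y | y in C]) K]].

Definition tangent_cone C p : set 'rV[R]_m :=
  closure (\bigcup_(lambda in [set t : R | 0 < t])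
    [set p + lambda *: (x - p) | x in C]).

Definition boundary C : set 'rV[R]_m := closure C `\` C°.

End convex_bodies.

Definition solid_angle {R : realType} {n : nat} (L : set 'rV[R]_n.+1)
    (p : 'rV[R]_n.+1) : \bar R :=
  hausdorff_measure n (esphere p 1 `&` L°).

(* Main.v *)
(* All conditions are compared with a uniform lower bound for the volumes of
   [C `&` cube x s], cubes being the balls of the maximum norm. Dilations towards
   a point of the convex set [C] show that the scale [s] is irrelevant.

   (ii) => (iii): an asymptotic cylinder with empty interior lies in a
   hyperplane, so that some [C `&` ball] lies in a thin slab.
   (iii) => (i): if the volumes degenerate along [x_i], a subsequence of
   [C - x_i] converges by the Blaschke selection theorem; a ball in the limit
   would give, by cancellation of convex sets, balls in the [C - x_i].
   (i) => (iv): testing the perimeter with fields [f h / H] bounds the volume of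
   the points of [E] that a translation by [h] moves into [C \ E] by |h| P_C(E).
   The average of this volume over bounded [h] is at least c |E|^2, since every
   cube of a fixed size centred in [C] carries the volume 2|E|.
   (v) => (i): cube truncations of [C] of volume [v] centred in thin regions have
   a large radius [r] and a perimeter O(v / r).

   The solid angle bounds from below the volume of the part of [C] in a unit ball,
   because [C] lies in its tangent cone. *)
Require Import Defs.
From HB Require Import structures.
From mathcomp Require Import all_boot all_order all_algebra.
From mathcomp Require Import all_classical all_reals all_analysis.
From mathcomp Require Import measurable_realfun.
From mathcomp Require Import ring lra.

Set Implicit Arguments.
Unset Strict Implicit.
Unset Printing Implicit Defensive.

Import Order.TTheory GRing.Theory Num.Theory.
Import numFieldNormedType.Exports.

Local Open Scope classical_set_scope.
Local Open Scope ring_scope.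

(** * Lebesgue measure of boxes and its topology *)

(** The perimeter is only accessible through smooth fields supported in [C°], so both isoperimetric
    estimates replace derivatives by finite differences. For (v) => (i), the integral of a partial
    derivative is a limit of differences of integrals over a truncation and over its translate;
    inside the support of the field these two sets differ only near the faces of the cube. For (i)
    => (iv), the difference between a test function and its translate by [h] is split into small
    steps along the segment from 0 to [h]; convexity keeps all intermediate supports in [C°] as soon
    as both ends lie there. Unboundedness turns uniform geometry into a scale at which every cube
    centred in [C] carries 2|E|. Then [E] fills at most half of each such cube, and on average a
    bounded translation moves a definite part of [E] into the rest of [C]. Lebesgue measure is an
    outer measure given by covers, so even the volume of a box requires proof. General measurable
    sets are handled through finite unions of boxes, whose indicators are limits of smooth
    functions. *)

Section box_volume_lower_bound.
Context {R : realType}.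

Let len (ab : R * R) : R := Num.max 0 (ab.2 - ab.1).
Let ind (ab : R * R) : R -> R := \1_(`]ab.1, ab.2]%classic).

Let integral_ind (k : R) ab : 0 <= k ->
  (\int[lebesgue_measure]_t (k * ind ab t)%:E = (k * len ab)%:E)%E.
Proof.
move=> k0; under eq_integral do rewrite EFinM.
rewrite ge0_integralZl_EFin//; last 2 first.
  - by move=> x _; rewrite lee_fin.
  - by apply/measurable_EFinP; apply: measurable_indic; exact: measurable_itv.
rewrite integral_indic// setIT.
rewrite (_ : _ `]_, _]%classic = (len ab)%:E); first by rewrite EFinM.
rewrite -[LHS]/(lebesgue_measure _) lebesgue_measure_itv/= lte_fin /len -EFinB.
case: ltP => [h|h]; first by rewrite max_r// subr_ge0 ltW.
by rewrite max_l// subr_le0.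
Qed.

(* Weighted covers are what makes the induction on the dimension work: fixing
   the last coordinate turns a cover by boxes into a weighted one. *)
Lemma weighted_cover_volume m (X : nat -> R * R) (c : R) (w : nat -> R)
    (B : nat -> nat -> R * R) :
  0 <= c -> (forall k, 0 <= w k) ->
  (forall x : nat -> R, (c * \prod_(i < m) ind (X i) (x i))%:E <=
     \sum_(k <oo) (w k * \prod_(i < m) ind (B k i) (x i))%:E)%E ->
  ((c * \prod_(i < m) len (X i))%:E <=
     \sum_(k <oo) (w k * \prod_(i < m) len (B k i))%:E)%E.
Proof.
have len_ge0 ab : 0 <= len ab by rewrite /len le_max lexx.
have ind_ge0 ab t : 0 <= ind ab t by [].
(* Points and sides are indexed by [nat], so that dropping a coordinate changes no type. *)
elim: m c w => [|m IH] c w c0 w0 H.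
  rewrite big_ord0; have := H (fun=> 0); rewrite big_ord0.
  by under eq_eseriesr do rewrite big_ord0;
     under [X in _ -> (_ <= X)%E]eq_eseriesr do rewrite big_ord0.
have plen0 (Y : nat -> R * R) : 0 <= \prod_(i < m) len (Y i).
  exact: prodr_ge0.
rewrite big_ord_recr/=.
have -> : (c * (\prod_(i < m) len (X i) * len (X m)))%:E =
  (\int[lebesgue_measure]_t
     (c * \prod_(i < m) len (X i) * ind (X m) t)%:E)%E.
  by rewrite integral_ind ?mulr_ge0// mulrA.
under eq_eseriesr => k _.
  rewrite big_ord_recr/= mulrA -integral_ind ?mulr_ge0//.
  over.
rewrite -integral_nneseries//; last 2 first.
  - move=> k; apply/measurable_EFinP; apply: measurable_funM => //.
    by apply: measurable_indic; exact: measurable_itv.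
  - by move=> k t _; rewrite lee_fin !mulr_ge0.
apply: ge0_le_integral => //.
- by move=> t _; rewrite lee_fin !mulr_ge0.
- apply/measurable_EFinP; apply: measurable_funM => //.
  by apply: measurable_indic; exact: measurable_itv.
- apply: ge0_emeasurable_sum => [k t _ _|k _].
    by rewrite lee_fin !mulr_ge0.
  apply/measurable_EFinP; apply: measurable_funM => //.
  by apply: measurable_indic; exact: measurable_itv.
move=> t _.
(* For a fixed last coordinate [t], the last indicators are numbers and join the constant and the
   weights. *)
have := IH (c * ind (X m) t) (fun k => w k * ind (B k m) t).
rewrite mulrAC => h; under eq_eseriesr do rewrite mulrAC; apply: h.
- by rewrite mulr_ge0.
- by move=> k; rewrite mulr_ge0.
move=> x; have := H (fun i => if i == m then t else x i).
under eq_eseriesr do rewrite big_ord_recr/= eqxx.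
rewrite big_ord_recr/= eqxx.
have E (Y : nat -> R * R) :
    \prod_(i < m) ind (Y i) (if i == m :> nat then t else x i) =
    \prod_(i < m) ind (Y i) (x i).
  by apply: eq_bigr => i _; rewrite ltn_eqF.
rewrite E; under eq_eseriesr do rewrite E.
move=> h.
apply: le_trans (le_trans h _).
  by rewrite le_eqVlt; apply/orP; left; apply/eqP; congr EFin; ring.
apply: lee_nneseries => [k _|k _]; rewrite lee_fin; first by rewrite !mulr_ge0// prodr_ge0.
by rewrite le_eqVlt; apply/orP; left; apply/eqP; ring.
Qed.

End box_volume_lower_bound.

Section lebesgue_boxes.
Context {R : realType}.
Local Open Scope ereal_scope.

Let ext m (x : 'rV[R]_m) (i : nat) : R :=
  if insub i is Some j then x ord0 j else 0%R.

Let extE m (x : 'rV[R]_m) (i : 'I_m) : ext x i = x ord0 i.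
Proof. by rewrite /ext valK. Qed.

Lemma boxP m (ab : 'rV[R]_m * 'rV[R]_m) (x : nat -> R) :
  (\prod_(i < m) \1_(`]ext ab.1 i, ext ab.2 i]%classic) (x i))%R =
  (`[< box ab (\row_i x i) >])%:R :> R.
Proof.
have [h|] := asboolP (box ab _).
  rewrite big1// => i _; rewrite indicE mem_set//= !extE in_itv/=.
  by have := h i; rewrite mxE.
move=> /existsNP[i hi]; rewrite (bigD1 i)//= indicE memNset ?mul0r//=.
by rewrite !extE in_itv/=; move: hi; rewrite mxE.
Qed.

Lemma lebesgue_outer_le_box m (ab : 'rV[R]_m * 'rV[R]_m) :
  lebesgue_outer (box ab) <= box_volume ab.
Proof.
apply: ereal_inf_lbound; exists (fun k => if k == 0%N then Some ab else None).
  by move=> x bx; exists 0%N.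
rewrite (@nneseriesD1 _ _ 0%N)//=; last by move=> k _; exact: lebesgue_gauge_ge0.
by rewrite eseries0 ?adde0// => i _; case: ifP.
Qed.

(** For any cover, the indicators of the covering boxes sum to at least 1 at each point of the box;
    [weighted_cover_volume] integrates this one coordinate at a time. An index [None] gets weight 0,
    so the box attached to it is arbitrary. *)
Lemma lebesgue_outer_box m (ab : 'rV[R]_m * 'rV[R]_m) :
  lebesgue_outer (box ab) = box_volume ab.
Proof.
apply/eqP; rewrite eq_le lebesgue_outer_le_box/=.
apply: le_ereal_inf_tmp => _ [s Xs <-].
pose pr (p : 'rV[R]_m * 'rV[R]_m) (i : nat) := (ext p.1 i, ext p.2 i).
pose w k : R := if s k is Some _ then 1%R else 0%R.
pose B k := if s k is Some p then pr p else pr ab.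
have volE p : box_volume p =
    (\prod_(i < m) Num.max 0 ((pr p i).2 - (pr p i).1)%R)%:E.
  by congr EFin; apply: eq_bigr => i _; rewrite /pr !extE.
have w0 k : (0 <= w k)%R by rewrite /w; case: (s k).
have := @weighted_cover_volume R m (pr ab) 1 w B ler01 w0.
rewrite mul1r -volE => h; apply: (le_trans (h _)) => [x|].
  rewrite mul1r boxP.
  have t0 k : 0 <= (w k * \prod_(i < m)
      \1_(`](B k i).1, (B k i).2]%classic) (x i))%:E :> \bar R.
    by rewrite lee_fin mulr_ge0// prodr_ge0.
  have [bx|_] := asboolP (box ab (\row_i x i)); last first.
    by apply: nneseries_ge0 => k _ _; exact: t0.
  have [k _ kx] := Xs _ bx.
  rewrite (@nneseriesD1 _ _ k)//= -[1%:E]adde0 leeD//; last first.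
    by apply: nneseries_ge0 => i _ _; exact: t0.
  move: kx; rewrite /w /B; case: (s k) => //= p px.
  by rewrite /pr/= boxP mul1r asboolT.
apply: lee_nneseries => [k _|k _].
  by rewrite lee_fin mulr_ge0// prodr_ge0// => i _; rewrite le_max lexx.
by rewrite /w /B; case: (s k) => [p|]/=; rewrite ?mul0r// mul1r volE.
Qed.

Lemma lebesgue_outer_affine_le m (p : 'rV[R]_m) (c : R) (A : set 'rV[R]_m) :
  (0 < c)%R ->
  lebesgue_outer [set (p + c *: x)%R | x in A] <= (c ^+ m)%:E * lebesgue_outer A.
Proof.
move=> c0; have cm : (0 < c ^+ m)%R by rewrite exprn_gt0.
rewrite -lee_pdivrMl//; apply: le_ereal_inf_tmp => _ [s As <-].
rewrite lee_pdivrMl// -nneseriesZl; last by move=> *; exact: lebesgue_gauge_ge0.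
pose f (ab : 'rV[R]_m * 'rV[R]_m) := (p + c *: ab.1, p + c *: ab.2)%R.
apply: ereal_inf_lbound; exists (fun k => omap f (s k)).
  move=> _ [x Ax <-]; have [k _ h] := As _ Ax; exists k => //.
  move: h; case: (s k) => //= ab abx i; rewrite !mxE ltrD2l lerD2l.
  by rewrite ltr_pM2l// ler_pM2l//; exact: abx.
apply: eq_eseriesr => k _; case: (s k) => [ab|]/=; last by rewrite mule0.
rewrite -EFinM; congr EFin; rewrite -[X in (c ^+ X)%R]card_ord -prodr_const.
rewrite -big_split/=; apply: eq_bigr => i _.
by rewrite !mxE opprD addrACA subrr add0r -mulrBr maxr_pMr ?mulr0 ?ltW.
Qed.

(** The reverse inequality is the previous one for the inverse map. *)
Lemma lebesgue_outer_affine m (p : 'rV[R]_m) (c : R) (A : set 'rV[R]_m) :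
  (0 < c)%R ->
  lebesgue_outer [set (p + c *: x)%R | x in A] = (c ^+ m)%:E * lebesgue_outer A.
Proof.
move=> c0; apply/eqP; rewrite eq_le lebesgue_outer_affine_le//=.
have cm : (0 < c ^+ m)%R by rewrite exprn_gt0.
rewrite -lee_pdivlMl//.
have := @lebesgue_outer_affine_le m (- (c^-1 *: p))%R c^-1
  [set (p + c *: x)%R | x in A] _.
rewrite invr_gt0 exprVn => /(_ c0); apply: le_trans.
apply: le_cover_outer => x Ax; exists (p + c *: x)%R; first by exists x.
by rewrite scalerDr scalerA mulVf ?gt_eqF// scale1r addrA addNr add0r.
Qed.

(** The Caratheodory criterion is transported by a bijection that multiplies all outer measures by
    the same constant. *)
Lemma measurable_affine m (p : 'rV[R]_m) (c : R) (A : set (lebesgue_space m)) :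
  (0 < c)%R -> measurable A ->
  measurable ([set (p + c *: x)%R | x in A] : set (lebesgue_space m)).
Proof.
move=> c0 mA.
rewrite -[measurable _]/(caratheodory_measurable (@lebesgue_outer R m) _) => X.
pose g (x : 'rV[R]_m) := (p + c *: x)%R; pose Y := g @^-1` X.
have gK x : (p + c *: (c^-1 *: (x - p)))%R = x.
  by rewrite scalerA divff ?gt_eqF// scale1r addrC subrK.
have gi : injective g.
  by move=> x y /addrI /(scalerI _); apply; rewrite gt_eqF.
have gI B : g @` (Y `&` B) = X `&` g @` B.
  rewrite predeqE => y; split => [[x [Yx Bx] <-]|[Xy [x Bx xy]]].
    by split => //; exists x.
  by exists x => //; split => //; rewrite /Y/= xy.
have gX : g @` Y = X.
  by rewrite -[Y]setIT gI (_ : g @` setT = setT) ?setIT// predeqE => x;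
    split => // _; exists (c^-1 *: (x - p))%R => //; rewrite /g gK.
have gC : ~` (g @` A) = g @` (~` A).
  rewrite predeqE => y; split => [nAy|[x nAx <-] [z Az /gi zx]].
    exists (c^-1 *: (y - p))%R; last by rewrite /g gK.
    by move=> Ay; apply: nAy; exists (c^-1 *: (y - p))%R => //; rewrite /g gK.
  by apply: nAx; rewrite -zx.
rewrite -/g gC -!gI -[in LHS]gX !lebesgue_outer_affine// (mA Y) ge0_muleDr//.
Qed.

(** The hyperplane cuts every box of a cover into two boxes, one of them possibly empty, whose
    volumes add up to that of the box. A cover of [X] thus splits into covers of its two parts at no
    extra cost. *)
Lemma measurable_halfspace m (i : 'I_m) (a : R) :
  measurable ([set x | x ord0 i <= a]%R : set (lebesgue_space m)).
Proof.
apply: le_caratheodory_measurable => X; apply: le_ereal_inf_tmp => _ [s Xs <-].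
pose upd (x : 'rV[R]_m) (t : R) := (\row_j if j == i then t else x ord0 j)%R.
pose f1 (ab : 'rV[R]_m * 'rV[R]_m) :=
  (ab.1, upd ab.2 (Num.min (ab.2 ord0 i) a)).
pose f2 (ab : 'rV[R]_m * 'rV[R]_m) :=
  (upd ab.1 (Num.max (ab.1 ord0 i) a), ab.2).
rewrite (_ : \sum_(k <oo) _ =
  \sum_(k <oo) oapp (@box_volume R m) 0 (omap f1 (s k)) +
  \sum_(k <oo) oapp (@box_volume R m) 0 (omap f2 (s k))).
  apply: leeD; apply: ereal_inf_lbound.
    exists (fun k => omap f1 (s k)) => //.
    move=> x [/Xs[k _ h] xa]; exists k => //; move: h; case: (s k) => //= ab h j.
    rewrite /= mxE; have := h j; case: eqP => // -> /andP[-> h2].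
    by rewrite le_min h2.
  exists (fun k => omap f2 (s k)) => //.
  move=> x [/Xs[k _ h] /negP]; rewrite -ltNge => xa.
  exists k => //; move: h; case: (s k) => //= ab h j.
  rewrite /= mxE; have := h j; case: eqP => // -> /andP[h1 ->].
  by rewrite gt_max h1 xa.
rewrite -nneseriesD; do ?by move=> *; exact: lebesgue_gauge_ge0.
apply: eq_eseriesr => k _; case: (s k) => [ab|]/=; last by rewrite adde0.
have D (F : 'I_m -> R) : (\prod_j F j = F i * \prod_(j < m | j != i) F j)%R.
  by rewrite (bigD1 i).
rewrite -EFinD; congr EFin; rewrite !D.
have E1 : (\prod_(j < m | j != i) Num.max 0
    (upd ab.2 (Num.min (ab.2 ord0 i) a) ord0 j - ab.1 ord0 j) =
  \prod_(j < m | j != i) Num.max 0 (ab.2 ord0 j - ab.1 ord0 j))%R.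
  by apply: eq_bigr => j ji; rewrite mxE (negbTE ji).
have E2 : (\prod_(j < m | j != i) Num.max 0
    (ab.2 ord0 j - upd ab.1 (Num.max (ab.1 ord0 i) a) ord0 j) =
  \prod_(j < m | j != i) Num.max 0 (ab.2 ord0 j - ab.1 ord0 j))%R.
  by apply: eq_bigr => j ji; rewrite mxE (negbTE ji).
rewrite E1 E2 -mulrDl; congr (_ * _)%R; rewrite !mxE eqxx.
set l := ab.1 ord0 i; set r := ab.2 ord0 i.
by rewrite /Num.max /Num.min; do ![case: ifPn]; rewrite -?leNgt; lra.
Qed.

Lemma measurable_box m (ab : 'rV[R]_m * 'rV[R]_m) :
  measurable (box ab : set (lebesgue_space m)).
Proof.
rewrite (_ : box ab = \bigcap_(i in [set: 'I_m])
    ([set x | x ord0 i <= ab.2 ord0 i]%R `\` [set x | x ord0 i <= ab.1 ord0 i]%R)).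
  apply: fin_bigcap_measurable => // i _.
  by apply: measurableD; exact: measurable_halfspace.
rewrite predeqE => x; split => [h i _|h i].
  by have /andP[h1 h2] := h i; split => //=; apply/negP; rewrite -ltNge.
by have [h1 /negP] := h i I; rewrite -ltNge => ->.
Qed.

End lebesgue_boxes.

Section max_norm.
Context {R : realType} {m : nat}.
Implicit Types (x y : 'rV[R]_m) (r : R).

Lemma row_norm_coord x i : `|x ord0 i| <= `|x|.
Proof.
rewrite -[leRHS]/(mx_norm x) mx_normrE.
exact: (le_bigmax 0 (fun ij : 'I_1 * 'I_m => `|x ij.1 ij.2|) (ord0, i)).
Qed.

Lemma row_norm_leP x r : 0 <= r ->
  (`|x| <= r) <-> (forall i, `|x ord0 i| <= r).
Proof.
move=> r0; split => [xr i|h]; first exact: le_trans (row_norm_coord x i) xr.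
rewrite -[leLHS]/(mx_norm x) mx_normrE; apply/bigmax_leP; split => // -[i j] _ /=.
by rewrite ord1.
Qed.

Lemma row_norm_ltP x r : 0 < r ->
  (`|x| < r) <-> (forall i, `|x ord0 i| < r).
Proof.
move=> r0; split => [xr i|h]; first exact: le_lt_trans (row_norm_coord x i) xr.
rewrite -[ltLHS]/(mx_norm x) mx_normrE; apply/bigmax_ltP; split => // -[i j] _ /=.
by rewrite ord1.
Qed.

Definition cube x r : set 'rV[R]_m := [set y | `|y - x| <= r].

Lemma closed_box_sub_cube (ab : 'rV[R]_m * 'rV[R]_m) x r : 0 <= r ->
  (forall i, x ord0 i - r <= ab.1 ord0 i /\ ab.2 ord0 i <= x ord0 i + r) ->
  [set y : 'rV[R]_m | forall i, ab.1 ord0 i <= y ord0 i <= ab.2 ord0 i] `<=` cube x r.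
Proof.
move=> r0 h y ys; apply/row_norm_leP => // i; rewrite !mxE ler_distl.
have [h1 h2] := h i; have /andP[h3 h4] := ys i.
by rewrite (le_trans h1)//= (le_trans h4).
Qed.

Lemma cube_affine x r (p : 'rV[R]_m) c : 0 < c ->
  [set p + c *: y | y in cube x r] = cube (p + c *: x) (c * r).
Proof.
move=> c0; rewrite predeqE => z; split => [[y yx <-]|zx].
  rewrite /cube/= opprD addrACA subrr add0r -scalerBr normrZ gtr0_norm//.
  by rewrite ler_pM2l.
exists (c^-1 *: (z - p)); last first.
  by rewrite scalerA divff ?gt_eqF// scale1r addrC subrK.
rewrite /cube/= -(ler_pM2l c0) -[X in X * `|_|]gtr0_norm// -normrZ scalerBr scalerA.
by rewrite divff ?gt_eqF// scale1r -addrA -opprD.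
Qed.

(** The boxes have rational centres and half-sides 1/(k+1), hence are countably many; those whose
    closed version leaves [U] are replaced by [None]. Control of the closed boxes is what later
    yields compact supports inside [U]. *)
Lemma closed_box_subset_open (U : set 'rV[R]_m) : open U ->
  exists B : nat -> option ('rV[R]_m * 'rV[R]_m),
    U = \bigcup_k oapp (@box R m) set0 (B k) /\
    forall k ab, B k = Some ab ->
      [set y : 'rV[R]_m | forall i, ab.1 ord0 i <= y ord0 i <= ab.2 ord0 i] `<=` U.
Proof.
move=> oU.
pose bx (qk : 'rV[rat]_m * nat) : 'rV[R]_m * 'rV[R]_m :=
  (\row_i (ratr (qk.1 ord0 i) - qk.2.+1%:R^-1),
   \row_i (ratr (qk.1 ord0 i) + qk.2.+1%:R^-1)).
pose cbx (ab : 'rV[R]_m * 'rV[R]_m) :=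
  [set y : 'rV[R]_m | forall i, ab.1 ord0 i <= y ord0 i <= ab.2 ord0 i].
pose B n := if unpickle n is Some qk then
  if `[< cbx (bx qk) `<=` U >] then Some (bx qk) else None else None.
exists B; split; last first.
  move=> k ab; rewrite /B; case: unpickle => // qk; case: ifP => // /asboolP h.
  by case=> <-.
rewrite predeqE => x; split => [Ux|[k _]]; last first.
  rewrite /B; case: unpickle => //= qk; case: ifP => //= /asboolP h bxx.
  by apply: h => i; have /andP[/ltW -> ->] := bxx i.
have /nbhs_ballP[e /= e0 eU] := open_nbhs_nbhs (conj oU Ux).
have [k ke] : exists k, k.+1%:R^-1 < e / 2.
  have /ltr_add_invr[k] : (0 < e / 2) by rewrite divr_gt0.
  by rewrite add0r; exists k.
have ki0 : (0 : R) < k.+1%:R^-1 by [].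
pose d : R := k.+1%:R^-1; rewrite -/d in ke ki0.
have /choice[q qP] (i : 'I_m) : exists q : rat,
    x ord0 i - d < ratr q < x ord0 i + d.
  have : x ord0 i - d < x ord0 i + d by lra.
  by move=> /rat_in_itvoo[q]; exists q.
exists (pickle (\row_i q i : 'rV[rat]_m, k)) => //.
rewrite /B pickleK /bx -/d asboolT/= => [i|y yb].
  by rewrite !mxE; have := qP i; lra.
apply: eU; rewrite -ball_normE/=; apply/row_norm_ltP => // i.
rewrite !mxE distrC ltr_distl; have := yb i; have := qP i.
by rewrite !mxE; lra.
Qed.

End max_norm.

Section lebesgue_topology.
Context {R : realType} {m : nat}.
Notation mu := (@lebesgue R m).
Implicit Types (U A : set 'rV[R]_m).
Local Open Scope ereal_scope.

Lemma open_lebesgue_measurable U : open U ->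
  measurable (U : set (lebesgue_space m)).
Proof.
move=> /closed_box_subset_open[B [-> _]]; apply: bigcupT_measurable => k.
by case: (B k) => //= ab; exact: measurable_box.
Qed.

Lemma closed_lebesgue_measurable A : closed A ->
  measurable (A : set (lebesgue_space m)).
Proof.
move=> cA; rewrite -(setCK A); apply: measurableC.
by apply: open_lebesgue_measurable; exact: closed_openC.
Qed.

Lemma continuous_lebesgue_measurable (f : 'rV[R]_m -> R) : continuous f ->
  measurable_fun [set: lebesgue_space m] f.
Proof.
move=> /continuousP cf mD.
apply: (measurability _ (RGenOpens.measurableE R)) => //.
move=> _ [_ [a [b ->]] <-]; rewrite setTI.
apply: open_lebesgue_measurable.
by have /cf := @interval_open R (BRight a) (BLeft b) isT isT.
Qed.

Lemma closed_cube x r : closed (@cube R m x r).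
Proof.
have -> : cube x r = (fun y : 'rV[R]_m => `|y - x|%R) @^-1` [set t | t <= r]%R.
  by [].
apply: preimage_closed; last exact: closed_le.
move=> y _; apply: continuous_comp; last exact: norm_continuous.
apply: (@cvgB R _ _ (nbhs y) _ id (fun=> x)); [exact: cvg_id|exact: cvg_cst].
Qed.

Lemma measurable_cube (x : 'rV[R]_m) r : measurable (cube x r : set (lebesgue_space m)).
Proof. by apply: closed_lebesgue_measurable; exact: closed_cube. Qed.

Lemma lebesgue_affine (p : 'rV[R]_m) (c : R) (A : set (lebesgue_space m)) :
  (0 < c)%R -> mu [set (p + c *: x)%R | x in A] = (c ^+ m)%:E * mu A.
Proof. exact: lebesgue_outer_affine. Qed.

Lemma lebesgue_translate (p : 'rV[R]_m) (A : set (lebesgue_space m)) :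
  mu [set (p + x)%R | x in A] = mu A.
Proof.
have := @lebesgue_affine p 1 A ltr01; rewrite expr1n mul1e => <-.
by congr mu; under [in RHS]eq_imagel do rewrite scale1r.
Qed.

Lemma measurable_translate (p : 'rV[R]_m) (A : set (lebesgue_space m)) :
  measurable A -> measurable ([set (p + x)%R | x in A] : set (lebesgue_space m)).
Proof.
move=> mA; have := measurable_affine p ltr01 mA.
by under eq_imagel do rewrite scale1r.
Qed.

Lemma le_lebesgue (A B : set (lebesgue_space m)) : A `<=` B -> mu A <= mu B.
Proof. exact: le_cover_outer. Qed.

Definition unit_cube_volume : R := fine (mu (cube 0%R 1%R)).

Lemma cube0_volume : mu (cube 0%R 1%R) = unit_cube_volume%:E /\
  (0 < unit_cube_volume)%R.
Proof.
have lb : 1 <= mu (cube 0%R 1%R).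
  pose ab : 'rV[R]_m * 'rV[R]_m := (const_mx 0, const_mx 1)%R.
  have <- : mu (box ab) = 1.
    rewrite -[mu _]/(lebesgue_outer _) lebesgue_outer_box; congr EFin.
    by rewrite big1// => i _; rewrite !mxE subr0 max_r.
  apply: le_lebesgue => x xb; apply: (@closed_box_sub_cube _ _ ab) => //.
    by move=> i; rewrite !mxE; split; lra.
  by move=> i; have /andP[/ltW -> ->] := xb i.
have ub : mu (cube 0%R 1%R) < +oo.
  (* The lower corner is below -1 because half-open boxes miss their lower faces. *)
  pose ab : 'rV[R]_m * 'rV[R]_m := (const_mx (-2), const_mx 1)%R.
  apply: (@le_lt_trans _ _ (mu (box ab))).
    apply: le_lebesgue => x /row_norm_leP => /(_ ler01) h i.
    by have := h i; rewrite !mxE ler_distl; lra.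
  by rewrite -[mu _]/(lebesgue_outer _) lebesgue_outer_box ltry.
have fn : mu (cube 0%R 1%R) \is a fin_num.
  by rewrite ge0_fin_numE// (le_trans _ lb).
split; first by rewrite fineK.
by rewrite -lte_fin /unit_cube_volume fineK// (lt_le_trans _ lb)// lte01.
Qed.

Lemma lebesgue_cube x r : (0 < r)%R ->
  mu (cube x r) = (r ^+ m * unit_cube_volume)%:E.
Proof.
move=> r0; rewrite EFinM -cube0_volume.1 -(lebesgue_affine x _ r0).
by rewrite cube_affine// scaler0 addr0 mulr1.
Qed.

End lebesgue_topology.
Arguments unit_cube_volume : clear implicits.

(** * Approximation of measurable sets by finite unions of boxes *)

Section lebesgue_approximation.
Context {R : realType} {m : nat}.
Notation mu := (@lebesgue R m).
Local Open Scope ereal_scope.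

Definition obox (o : option ('rV[R]_m * 'rV[R]_m)) : set 'rV[R]_m :=
  oapp (@box R m) set0 o.

Lemma measurable_obox o : measurable (obox o : set (lebesgue_space m)).
Proof. by case: o => //= ab; exact: measurable_box. Qed.

Lemma box_approximation (U : set 'rV[R]_m) (A : set (lebesgue_space m)) (e : R) :
  open U -> measurable A -> A `<=` U -> mu A < +oo -> (0 < e)%R ->
  exists (D : nat -> option ('rV[R]_m * 'rV[R]_m)) (N : nat),
    [/\ forall k ab, D k = Some ab ->
          [set y : 'rV[R]_m | forall i, ab.1 ord0 i <= y ord0 i <= ab.2 ord0 i]%R
            `<=` U,
        mu (A `\` \bigcup_(k in `I_N) obox (D k)) <= e%:E &
        mu (\bigcup_(k in `I_N) obox (D k) `\` A) <= e%:E].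
Proof.
move=> oU mA AU Afin e0.
have Afn : mu A \is a fin_num by rewrite ge0_fin_numE.
have [B [UB BU]] := closed_box_subset_open oU.
have [_ [C AC <-] Ce] := lb_ereal_inf_adherent e0 Afn.
pose V := \bigcup_l obox (C l).
have mV : measurable (V : set (lebesgue_space m)).
  by apply: bigcupT_measurable => k; exact: measurable_obox.
have Vle : mu V <= mu A + e%:E.
  apply: (le_trans _ (ltW Ce)); apply: ereal_inf_lbound; by exists C.
(* [D] enumerates the intersections of a box filling [U] with a box of a nearly optimal cover of
   [A]. The unions thus stay in [U] and in a set [V] that exceeds [A] by at most [e]. *)
pose D n := if unpickle n is Some (k, l) then
  if (B k, C l) is (Some b, Some c) then
    Some ((\row_i Num.max (b.1 ord0 i) (c.1 ord0 i))%R,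
          (\row_i Num.min (b.2 ord0 i) (c.2 ord0 i))%R)
  else None else None.
pose F N := \bigcup_(k in `I_N) obox (D k).
have mF N : measurable (F N : set (lebesgue_space m)).
  by apply: bigcup_measurable => k _; exact: measurable_obox.
have FV N : F N `<=` V.
  move=> x [n _]; rewrite /D; case: unpickle => // -[k l].
  case: (B k) => // b; case Cl : (C l) => [c|]// h; exists l => //.
  rewrite Cl => i; have := h i; rewrite !mxE gt_max le_min.
  by move=> /andP[/andP[_ ->] /andP[_ ->]].
have UVF x : U x -> V x -> exists n, obox (D n) x.
  rewrite UB => -[k _ Bx] [l _ Cx]; exists (pickle (k, l)); rewrite /D pickleK.
  move: Bx Cx; case: (B k) => // b; case: (C l) => // c hb hc i.
  rewrite !mxE gt_max le_min.
  by have /andP[-> ->] := hb i; have /andP[-> ->] := hc i.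
have mAF N : measurable (A `\` F N) by exact: measurableD.
(* Continuity from above along this decreasing sequence allows stopping at a finite [N]. *)
have AF0 : \bigcap_N (A `\` F N) = set0.
  rewrite predeqE => x; split => // h.
  have [Ax _] := h 0%N I; have [n Dx] := UVF _ (AU _ Ax) (AC _ Ax).
  by have [_] := h n.+1 I; apply; exists n => //=.
have : mu (A `\` F N) @[N --> \oo] --> 0.
  rewrite -[X in _ --> X](measure0 mu) -AF0.
  apply: (@nonincreasing_cvg_mu _ _ _ mu) => //.
  - by rewrite (le_lt_trans _ Afin)// le_lebesgue//; exact: subDsetl.
  - exact: bigcap_measurable.
  - move=> p q pq; apply/subsetPset; apply: setDS => x [k /= kp Dx].
    by exists k => //=; exact: leq_trans pq.
move=> /fine_cvgP[fin0 /cvgrPdist_le /(_ _ e0)[N _ /(_ N)]] => /(_ (leqnn N)) h.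
exists D, N; split => //.
- move=> n ab; rewrite /D; case: unpickle => // -[k l].
  case Bk : (B k) => [b|]//; case: (C l) => // c [<-] y yb.
  apply: (BU k b Bk) => i; have := yb i; rewrite /= !mxE ge_max le_min.
  by move=> /andP[/andP[-> _] /andP[-> _]].
- have fnAF : mu (A `\` F N) \is a fin_num.
    rewrite ge0_fin_numE//; apply: le_lt_trans Afin.
    by apply: le_lebesgue; exact: subDsetl.
  rewrite -(fineK fnAF) lee_fin; move: h; rewrite sub0r normrN.
  exact: le_trans (ler_norm _).
- apply: (@le_trans _ _ (mu (V `\` A))).
    by apply: le_lebesgue; apply: setSD; exact: FV.
  have VA : V `&` A = A by rewrite setIidr//; exact: AC.
  rewrite measureD//; last by rewrite (le_lt_trans Vle)// lte_add_pinfty// ltry.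
  by rewrite -/V VA leeBlDl.
Qed.

Let sigma_finite_lebesgue : sigma_finite setT mu.
Proof.
exists (fun k => cube 0%R k.+1%:R); last first.
  by move=> k; split; [exact: measurable_cube|rewrite lebesgue_cube ?ltry].
apply/esym; rewrite predeqE => x; split => // _.
have [k xk] : exists k, (`|x| < k.+1%:R)%R.
  by exists (Num.truncn `|x|); rewrite truncnS_gt.
by exists k => //; rewrite /cube/= subr0 ltW.
Qed.

HB.instance Definition _ := @Measure_isSigmaFinite.Build _ _ _ mu sigma_finite_lebesgue.

End lebesgue_approximation.

(** * Volumes of convex sets *)

Section euclidean_norm.
Context {R : realType} {m : nat}.
Implicit Types x y : 'rV[R]_m.

Lemma norm_le_enorm x : `|x| <= enorm x.
Proof.
apply/row_norm_leP => [|i]; first exact: sqrtr_ge0.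
rewrite -sqrtr_sqr ler_wsqrtr// (bigD1 i)//= lerDl.
by apply: sumr_ge0 => j _; exact: sqr_ge0.
Qed.

Lemma enorm_le_norm x : enorm x <= m%:R * `|x|.
Proof.
have h0 : 0 <= m%:R * `|x| by rewrite mulr_ge0.
rewrite -(ger0_norm h0) -sqrtr_sqr ler_wsqrtr// exprMn.
apply: (@le_trans _ _ (\sum_(i < m) `|x| ^+ 2)).
  apply: ler_sum => i _; rewrite -real_normK ?num_real//.
  by rewrite lerXn2r ?nnegrE//; exact: row_norm_coord.
rewrite sumr_const card_ord -[leLHS]mulr_natl ler_wpM2r ?sqr_ge0//.
by rewrite -natrX ler_nat; case: (m) => // k; rewrite expnS leq_pmulr.
Qed.

Lemma ecball_sub_cube x r : ecball x r `<=` cube x r.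
Proof. by move=> y; exact: le_trans (norm_le_enorm _). Qed.

Lemma cube_sub_ecball x r : cube x r `<=` ecball x (m%:R * r).
Proof.
by move=> y yx; apply: le_trans (enorm_le_norm _) _; rewrite ler_wpM2l.
Qed.

End euclidean_norm.

Section convex_volume.
Context {R : realType} {m : nat}.
Notation mu := (@lebesgue R m).
Implicit Types (x y z p q : 'rV[R]_m) (C A B : set 'rV[R]_m) (r s c t : R).
Local Open Scope ereal_scope.

Lemma convex_segment C x y t : convex_set C -> C x -> C y ->
  (0 <= t <= 1)%R -> C (x + t *: (y - x))%R.
Proof.
move=> cC Cx Cy /andP[t0 t1].
have := cC y x (Itv01 t0 t1); rewrite !inE => /(_ Cy Cx).
congr C; rewrite /conv/= /unstable.onem.
by apply/rowP => i; rewrite !mxE; ring.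
Qed.

Lemma convex_combination (I : eqType) (s : seq I) (w : I -> R) (f : I -> 'rV[R]_m) C :
  convex_set C -> (forall i, C (f i)) -> (forall i, 0 <= w i)%R ->
  (\sum_(i <- s) w i = 1)%R -> C (\sum_(i <- s) w i *: f i)%R.
Proof.
move=> cC Cf w0.
(* Normalising by the total weight gives a statement that passes to shorter lists. *)
suff H : (0 < \sum_(i <- s) w i)%R ->
    C ((\sum_(i <- s) w i)^-1 *: \sum_(i <- s) w i *: f i)%R.
  by move=> w1; rewrite w1 invr1 scale1r in H; exact: H.
elim: s => [|i s IH]; first by rewrite big_nil ltxx.
rewrite !big_cons; set W := (\sum_(j <- s) w j)%R => W0.
have [W00|Wn0] := eqVneq W 0%R.
  have wi0 : (0 < w i)%R by move: W0; rewrite W00 addr0.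
  have -> : (\sum_(j <- s) w j *: f j = 0)%R.
    apply: big1_seq => j /= js.
    move/eqP: W00; rewrite psumr_eq0// => /allP/(_ _ js)/= /eqP->.
    by rewrite scale0r.
  by rewrite W00 !addr0 scalerA mulVf ?scale1r// gt_eqF.
have Wp : (0 < W)%R by rewrite lt_neqAle eq_sym Wn0 sumr_ge0.
have := @convex_segment C (f i) (W^-1 *: \sum_(j <- s) w j *: f j)%R
  (W / (w i + W))%R cC (Cf i) (IH Wp) _.
have -> : (0 <= W / (w i + W) <= 1)%R.
  by rewrite divr_ge0 ?(ltW Wp) ?(ltW W0)//= ler_pdivrMr// mul1r lerDr.
move=> /(_ isT); congr C.
apply/rowP => j; rewrite !mxE.
by field; rewrite !gt_eqF.
Qed.

Lemma cube_interior C q r : (0 < r)%R -> cube q r `<=` C -> C° q.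
Proof.
move=> r0 qC; apply/nbhs_ballP; exists r => // y; rewrite -ball_normE/= => qy.
by apply: qC; rewrite /cube/= distrC ltW.
Qed.

Lemma interior_cube C q : C° q -> exists2 r, (0 < r)%R & cube q r `<=` C.
Proof.
move=> /nbhs_ballP[e /= e0 eC]; exists (e / 2)%R; first by rewrite divr_gt0.
move=> y qy; apply: eC; rewrite -ball_normE/= distrC (le_lt_trans qy)//.
by rewrite ltr_pdivrMr// mulr_natr mulr2n ltrDl.
Qed.

(** The homothety of centre [x] and ratio [t] maps [C] into itself and [cube p r] onto this cube. *)
Lemma convex_cube_shrink C p r x t : convex_set C -> cube p r `<=` C -> C x ->
  (0 < t <= 1)%R -> cube (x + t *: (p - x)) (t * r) `<=` C.
Proof.
move=> cC pC Cx /andP[t0 t1] y hy.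
have -> : y = (x + t *: ((x + t^-1 *: (y - x)) - x))%R.
  by rewrite addrAC subrr add0r scalerA divff ?gt_eqF// scale1r addrC subrK.
apply: convex_segment => //; last by rewrite (ltW t0).
apply: pC; rewrite /cube/=.
have -> : (x + t^-1 *: (y - x) - p = t^-1 *: (y - (x + t *: (p - x))))%R.
  by apply/rowP => i; rewrite !mxE; field; rewrite gt_eqF.
by rewrite normrZ gtr0_norm ?invr_gt0// ler_pdivrMl.
Qed.

Lemma convex_interior_segment C p x t : convex_set C -> C° p -> C x ->
  (0 < t <= 1)%R -> C° (x + t *: (p - x))%R.
Proof.
move=> cC /interior_cube[r r0 pC] Cx t01.
apply: (@cube_interior _ _ (t * r)%R); last exact: convex_cube_shrink.
by case/andP: t01 => t0 _; rewrite mulr_gt0.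
Qed.

Lemma lebesgue_shrink (A B : set (lebesgue_space m)) x t : (0 < t)%R ->
  (forall y, A y -> B (x + t *: (y - x))%R) -> (t ^+ m)%:E * mu A <= mu B.
Proof.
move=> t0 AB; rewrite -(lebesgue_affine (x - t *: x)%R _ t0).
apply: le_lebesgue => _ [y Ay <-].
by rewrite -addrA [(- _ + _)%R]addrC -scalerBr; exact: AB.
Qed.

Lemma convex_cube_ratio C x r r' : convex_set C -> C x -> (0 < r <= r')%R ->
  mu (C `&` cube x r') <= ((r' / r) ^+ m)%:E * mu (C `&` cube x r).
Proof.
move=> cC Cx /andP[r0 rr']; have r'0 := lt_le_trans r0 rr'.
have t0 : (0 < r / r')%R by rewrite divr_gt0.
rewrite -(invf_div r r') exprVn -lee_pdivrMl ?invr_gt0 ?exprn_gt0// invrK.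
apply: (@lebesgue_shrink _ _ x) => // y [Cy yx]; split.
  apply: convex_segment => //.
  by rewrite (ltW t0)//= ler_pdivrMr// mul1r.
rewrite /cube/= addrAC subrr add0r normrZ gtr0_norm// mulrAC ler_pdivrMr//.
by rewrite ler_pM2l.
Qed.

(** A convex body can be thin only at infinity: a fixed cube of [C], shrunk towards [x] by a ratio
    depending on [M] and [s] alone, fits into the part of [C] in [cube x s]. *)
Lemma convex_body_near_cube C p r : convex_set C -> (0 < r)%R -> cube p r `<=` C ->
  forall M s, (0 < M)%R -> (0 < s)%R -> exists2 c, (0 < c)%R &
  forall x, C x -> (`|x - p| <= M)%R -> c%:E <= mu (C `&` cube x s).
Proof.
move=> cC r0 pC M s M0 s0.
pose t := Num.min 1%R (s / (M + r))%R.
have Mr : (0 < M + r)%R by rewrite addr_gt0.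
have t0 : (0 < t)%R by rewrite lt_min ltr01 divr_gt0.
exists (t ^+ m * (r ^+ m * unit_cube_volume R m))%R.
  by rewrite !mulr_gt0 ?exprn_gt0//; exact: cube0_volume.2.
move=> x Cx xp; rewrite EFinM -(lebesgue_cube p r0).
apply: (@lebesgue_shrink _ _ x) => // y yp; split.
  apply: convex_segment => //; first exact: pC.
  by rewrite (ltW t0)/= ge_min lexx.
rewrite /cube/= addrAC subrr add0r normrZ gtr0_norm//.
have yx : (`|y - x| <= M + r)%R.
  have -> : (y - x = (y - p) + (p - x))%R by rewrite addrA subrK.
  by rewrite (le_trans (ler_normD _ _))// addrC lerD// distrC.
apply: (@le_trans _ _ (t * (M + r))%R); first by rewrite ler_pM2l.
by rewrite -ler_pdivlMr// ge_min lexx orbT.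
Qed.

Lemma lebesgue_packing (N : nat) (Y : nat -> 'rV[R]_m) (A B : set (lebesgue_space m))
    s c : measurable A -> (0 <= s)%R ->
  (forall i j, (i < j < N)%N -> (2 * s < `|Y i - Y j|)%R) ->
  (forall i, (i < N)%N -> A `&` cube (Y i) s `<=` B) ->
  (forall i, (i < N)%N -> c%:E <= mu (A `&` cube (Y i) s)) ->
  (N%:R * c)%:E <= mu B.
Proof.
move=> mA s0 Ysep YB Yc.
pose F (i : 'I_N) : set (lebesgue_space m) := A `&` cube (Y i) s.
have mF i : measurable (F i) by apply: measurableI => //; exact: measurable_cube.
have tF : trivIset setT F.
  apply/trivIsetP => i j _ _ ij; rewrite predeqE => x; split => // -[[_ xi] [_ xj]].
  suff : (`|Y i - Y j| <= 2 * s)%R.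
    move=> h; move: ij; rewrite neq_ltn => /orP[] ij.
      by have := Ysep i j; rewrite ij ltn_ord => /(_ isT); rewrite ltNge h.
    by have := Ysep j i; rewrite ij ltn_ord => /(_ isT); rewrite ltNge distrC h.
  rewrite -(subrK x (Y i)) -addrA (le_trans (ler_normD _ _))//.
  by rewrite mulr_natl mulr2n lerD// distrC.
apply: (@le_trans _ _ (mu (\big[setU/set0]_(i < N) F i))); last first.
  apply: le_lebesgue => x; rewrite -bigcup_seq => -[i _ Fx].
  exact: (YB i (ltn_ord i)).
rewrite measure_bigsetU_ord// (@le_trans _ _ (\sum_(i < N) c%:E))//.
  by rewrite sumEFin lee_fin sumr_const card_ord -[leRHS]mulr_natl.
by apply: lee_sum => i _; exact: Yc.
Qed.

(** The centres lie on the ray from [x] through [z] at distances 3sk. A spacing of 3s exceeds the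
    diameter 2s, which makes the cubes disjoint, and the last one ends before distance 3sN. *)
Lemma ray_packing (A : set (lebesgue_space m)) x z s c (N : nat) :
  measurable A -> (0 < s)%R -> x != z ->
  (forall k, (k < N)%N ->
     c%:E <= mu (A `&` cube (x + (3 * s * k%:R / `|z - x|) *: (z - x)) s)%R) ->
  (N%:R * c)%:E <= mu (A `&` cube x (3 * s * N%:R)%R).
Proof.
move=> mA s0 xz H.
have d0 : (0 < `|z - x|)%R by rewrite normr_gt0 subr_eq0 eq_sym.
have nE a b : (`|x + (3 * s * a / `|z - x|) *: (z - x) -
    (x + (3 * s * b / `|z - x|) *: (z - x))| = 3 * s * `|a - b|)%R.
  rewrite opprD addrACA subrr add0r -scalerBl normrZ -mulrBl -mulrBr !normrM.
  rewrite (gtr0_norm s0) normr_nat (gtr0_norm (_ : 0 < `|z - x|^-1)%R) ?invr_gt0//.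
  by rewrite divfK// gt_eqF.
apply: (@lebesgue_packing _
  (fun k => x + (3 * s * k%:R / `|z - x|) *: (z - x))%R A _ s) => //.
- exact: ltW.
- move=> i j /andP[ij jN]; rewrite nE distrC -natrB ?(ltnW ij)// normr_nat.
  have : (1 <= (j - i)%:R :> R)%R by rewrite ler1n subn_gt0.
  by nra.
- move=> i iN y [Ay yi]; split => //; rewrite /cube/=.
  have := nE i%:R 0%R; rewrite mulr0 mul0r scale0r addr0 subr0 normr_nat => h.
  rewrite -(subrK (x + (3 * s * i%:R / `|z - x|) *: (z - x))%R y) -addrA.
  rewrite (le_trans (ler_normD _ _))// h.
  have : (i.+1%:R <= N%:R :> R)%R by rewrite ler_nat.
  rewrite -natr1; move: yi; rewrite /cube/=; nra.
Qed.

(* Uniform geometry, with cubes instead of Euclidean balls. *)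
Definition unif C := exists2 s, (0 < s)%R & exists2 c, (0 < c)%R &
  forall x, C x -> c%:E <= mu (C `&` cube x s).

Lemma unif_all C : convex_set C -> unif C -> forall s, (0 < s)%R ->
  exists2 c, (0 < c)%R & forall x, C x -> c%:E <= mu (C `&` cube x s).
Proof.
move=> cC [r r0 [c c0 rc]] s s0; have [rs|/ltW sr] := leP r s.
  exists c => // x Cx; apply: (le_trans (rc x Cx)); apply: le_lebesgue.
  by apply: setIS => y; rewrite /cube/= => /le_trans; apply.
exists (c / (r / s) ^+ m)%R; first by rewrite divr_gt0// exprn_gt0// divr_gt0.
move=> x Cx; rewrite mulrC EFinM lee_pdivrMl ?exprn_gt0 ?divr_gt0//.
by apply: le_trans (rc x Cx) _; apply: convex_cube_ratio; rewrite ?s0.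
Qed.

Lemma unif_inf_ball_volume C r : convex_set C -> unif C -> (0 < r)%R ->
  0 < inf_ball_volume C r.
Proof.
move=> cC uC r0.
have r0' : (0 < r / m.+1%:R)%R by rewrite divr_gt0.
have [c c0 h] := unif_all cC uC r0'.
apply: (@lt_le_trans _ _ c%:E); first by rewrite lte_fin.
apply: le_ereal_inf_tmp => _ [x Cx <-]; apply: (le_trans (h x Cx)).
apply: le_lebesgue; apply: setIS => y yx; apply: le_trans (enorm_le_norm _) _.
apply: (@le_trans _ _ (m.+1%:R * (r / m.+1%:R))%R); last by rewrite mulrC divfK.
by apply: ler_pM => //; rewrite ler_nat.
Qed.

Lemma inf_ball_volume_unif C r : (0 < r)%R -> 0 < inf_ball_volume C r -> unif C.
Proof.
move=> r0 h; exists r => //.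
have [c c0 hc] : exists2 c : R, (0 < c)%R & c%:E <= inf_ball_volume C r.
  case: (inf_ball_volume C r) h => [t|_|]//; last by exists 1%R => //; rewrite leey.
  by rewrite lte_fin => t0; exists t.
exists c => // x Cx; apply: (le_trans hc); apply: (@le_trans _ _ (mu (rel_ball C x r))).
  by apply: ereal_inf_lbound; exists x.
by apply: le_lebesgue; apply: setIS; exact: ecball_sub_cube.
Qed.

Lemma not_unifP C : ~ unif C -> forall s c, (0 < s)%R -> (0 < c)%R ->
  exists2 x, C x & mu (C `&` cube x s) < c%:E.
Proof.
move=> nu s c s0 c0; apply: contrapT => h; apply: nu; exists s => //.
by exists c => // x Cx; rewrite leNgt; apply/negP => hx; apply: h; exists x.
Qed.

Lemma unbounded_far C p M : ~ bounded_set C -> exists2 z, C z & (M < `|z - p|)%R.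
Proof.
move=> nb; apply: contrapT => h; apply: nb.
exists (M + `|p|)%R; split; first exact: num_real.
move=> t Mt z Cz /=; apply/ltW/(le_lt_trans _ Mt).
rewrite -[z](subrK p) (le_trans (ler_normD _ _))// lerD2r leNgt.
by apply/negP => zM; apply: h; exists z.
Qed.

(** The segment from [x] to a far point of [C] carries as many disjoint unit-radius cubes as wanted,
    each with volume at least [c] in [C]; the number depends only on [v] and [c]. *)
Lemma unif_large C : convex_set C -> closed C -> ~ bounded_set C -> unif C ->
  forall v, exists2 r, (0 < r)%R & forall x, C x -> v%:E <= mu (C `&` cube x r).
Proof.
move=> cC clC ub uC v; have [c c0 h] := unif_all cC uC ltr01.
pose N := (Num.truncn (v / c)).+1.
have vN : (v <= N%:R * c)%R by rewrite -ler_pdivrMr// ltW// truncnS_gt.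
exists (3 * 1 * N%:R)%R; first by rewrite !mulr_gt0.
move=> x Cx; apply: le_trans (_ : (N%:R * c)%:E <= _); first by rewrite lee_fin.
have [z Cz zx] := @unbounded_far C x (3 * N%:R)%R ub.
have d0 : (0 < `|z - x|)%R by rewrite (le_lt_trans _ zx)// mulr_ge0.
apply: (@ray_packing _ _ z) => //; first exact: closed_lebesgue_measurable.
  by rewrite eq_sym -subr_eq0 -normr_gt0.
move=> k kN; apply: h; apply: convex_segment => //.
rewrite divr_ge0 ?mulr_ge0//= ler_pdivrMr// mul1r mulr1.
by apply: le_trans (ltW zx); rewrite ler_pM2l// ler_nat ltnW.
Qed.

(** Here the volume along the segment comes from a single cube of [C], shrunk towards a far point
    [z]. The radius obtained may depend on [x]. *)
Lemma convex_body_large C x : convex_body C -> ~ bounded_set C ->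
  forall v, exists2 r, (0 < r)%R & v%:E <= mu (C `&` cube x r).
Proof.
move=> [clC cC [p /interior_cube[rho rho0 pC]]] ub v.
pose s : R := (rho / 2)%R; have s0 : (0 < s)%R by rewrite divr_gt0.
pose c := (s ^+ m * unit_cube_volume R m)%R.
have c0 : (0 < c)%R by rewrite mulr_gt0 ?exprn_gt0//; exact: cube0_volume.2.
pose N := (Num.truncn (v / c)).+1.
have vN : (v <= N%:R * c)%R by rewrite -ler_pdivrMr// ltW// truncnS_gt.
exists (3 * s * N%:R + `|p - x|)%R.
  by rewrite ltr_wpDr// !mulr_gt0.
apply: le_trans (_ : (N%:R * c)%:E <= _); first by rewrite lee_fin.
(* The factor 2 keeps all centres in the first half of the segment from [p] to [z], where the shrunk
   cubes still have radius at least rho/2 = [s]. *)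
have [z Cz zx] := @unbounded_far C p (2 * (3 * s * N%:R))%R ub.
have d0 : (0 < `|z - p|)%R by rewrite (le_lt_trans _ zx)// !mulr_ge0// ltW.
apply: (@le_trans _ _ (mu (C `&` cube p (3 * s * N%:R)%R))); last first.
  apply: le_lebesgue; apply: setIS => y; rewrite /cube/= => yp.
  by rewrite -(subrK p y) -addrA (le_trans (ler_normD _ _))// lerD2r.
have Cp : C p by apply: pC; rewrite /cube/= subrr normr0 ltW.
apply: (@ray_packing _ _ z) => //; first exact: closed_lebesgue_measurable.
  by rewrite eq_sym -subr_eq0 -normr_gt0.
move=> k kN; rewrite /c -(@lebesgue_cube _ _ (p + (3 * s * k%:R / `|z - p|) *: (z - p))%R)//.
apply: le_lebesgue => y yk; split=> //.
set t := (3 * s * k%:R / `|z - p|)%R in yk.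
have t1 : (0 <= t <= 1 / 2)%R.
  have kN' : (k%:R <= N%:R :> R)%R by rewrite ler_nat ltnW.
  apply/andP; split; first by apply: divr_ge0 => //; rewrite !mulr_ge0// ltW.
  rewrite /t ler_pdivrMr//; move: zx; set d := `|_|%R; nra.
apply: (@convex_cube_shrink C p rho z (1 - t)%R) => //; first by lra.
rewrite /cube/= (_ : z + _ = p + t *: (z - p))%R; last first.
  by apply/rowP => i; rewrite !mxE; ring.
by apply: (le_trans yk); rewrite /s; nra.
Qed.

(** Shrinking by a ratio t < 1 towards an interior point maps [C] into [C°]. In each cube centred at
    this point, [C°] therefore has at least t^m times the volume of [C], and t tends to 1. *)
Lemma convex_boundary_null C : closed C -> convex_set C -> C° !=set0 ->
  mu (C `\` C°) = 0.
Proof.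
move=> clC cC [p Cp].
have mC : measurable (C : set (lebesgue_space m)) by exact: closed_lebesgue_measurable.
have mCi : measurable (C° : set (lebesgue_space m)).
  by apply: open_lebesgue_measurable; exact: open_interior.
pose Q (k : nat) := cube p k.+1%:R.
have Q0 k : mu ((C `\` C°) `&` Q k) = 0.
  have mQ : measurable (Q k : set (lebesgue_space m)) by exact: measurable_cube.
  have fQ A : mu (A `&` Q k) \is a fin_num.
    rewrite ge0_fin_numE//; apply: (@le_lt_trans _ _ (mu (Q k))).
      by apply: le_lebesgue; exact: subIsetr.
    by rewrite lebesgue_cube ?ltry.
  have CiC : C° `<=` C by exact: interior_subset.
  have : mu (C `&` Q k) <= mu (C° `&` Q k).
    rewrite -(fineK (fQ C)) -(fineK (fQ C°)) lee_fin.
    set a := fine _; set b := fine _.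
    have a0 : (0 <= a)%R by exact: fine_ge0.
    have h t : (0 < t < 1)%R -> (t ^+ m * a <= b)%R.
      move=> /andP[t0 t1]; rewrite -lee_fin EFinM !fineK//.
      apply: (@lebesgue_shrink _ _ p) => // y [Cy yp]; split.
        have := @convex_interior_segment C p y (1 - t)%R cC Cp Cy.
        rewrite subr_gt0 t1/= gerBl ltW// => /(_ isT); congr (C° _).
        by apply/rowP => i; rewrite !mxE; ring.
      rewrite /Q /cube/= addrAC subrr add0r normrZ gtr0_norm//.
      by rewrite (le_trans _ yp)// ler_piMl// ltW.
    apply/ler_addgt0Pl => e e0.
    (* With t = 1 - u, Bernoulli's inequality bounds the loss by m u a, which this choice makes at
       most [e]. *)
    pose u : R := Num.min (1 / 2)%R (e / (m%:R * a + 1))%R.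
    have d0 : (0 < m%:R * a + 1)%R by rewrite ltr_pwDr// mulr_ge0.
    have u0 : (0 < u)%R by rewrite lt_min !divr_gt0.
    have u1 : (u <= 1 / 2)%R by rewrite /u ge_min lexx.
    have ue : (u * (m%:R * a + 1) <= e)%R.
      by rewrite -ler_pdivlMr// /u ge_min lexx orbT.
    have := h (1 - u)%R; rewrite subr_gt0 gtrBl u0 andbT.
    move=> /(_ (le_lt_trans u1 _)) hu.
    have bern : (1 - m%:R * u <= (1 - u) ^+ m)%R.
      elim: (m) => [|j IH]; first by rewrite mul0r subr0 expr0.
      have j0 : (0 <= j%:R :> R)%R by [].
      have u2 : (0 <= u ^+ 2)%R by exact: sqr_ge0.
      rewrite exprS -natr1; apply: le_trans (ler_wpM2l _ IH); last by lra.
      by nra.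
    have := ler_wpM2r a0 bern.
    have /hu : (1 / 2 < 1 :> R)%R by lra.
    by nra.
  rewrite (_ : (C `\` C°) `&` Q k = (C `&` Q k) `\` (C° `&` Q k)); last first.
    rewrite predeqE => x; split => [[[Cx nCx] Qx]|[[Cx Qx] nCQ]].
      by split => // -[].
    by split => //; split => // Cix; apply: nCQ.
  move=> le; rewrite measureD//; last 3 first.
  - exact: measurableI.
  - exact: measurableI.
  - by have := fQ C; rewrite ge0_fin_numE.
  have -> : C `&` Q k `&` (C° `&` Q k) = C° `&` Q k.
    by apply: setIidr; exact: setSI.
  transitivity (mu (C° `&` Q k) - mu (C° `&` Q k)); last by rewrite subee.
  congr (_ - _); apply/eqP; rewrite eq_le le/=; apply: le_lebesgue.
  exact: setSI.
apply/eqP; rewrite eq_le measure_ge0 andbT.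
have mD : measurable (C `\` C° : set (lebesgue_space m)) by exact: measurableD.
apply: (@le_trans _ _ (\sum_(k <oo) mu ((C `\` C°) `&` Q k))).
  apply: measure_sigma_subadditive => //.
    by move=> k; apply: measurableI => //; exact: measurable_cube.
  move=> x CCx; exists (Num.truncn `|(x : 'rV[R]_m) - p|%R) => //; split => //.
  by rewrite /Q /cube/= ltW// truncnS_gt.
by rewrite eseries0.
Qed.

End convex_volume.

(** * Asymptotic cylinders *)

Section euclidean_triangle.
Context {R : realType} {m : nat}.
Implicit Types x y : 'rV[R]_m.

Lemma enorm_ge0 x : 0 <= enorm x. Proof. exact: sqrtr_ge0. Qed.

Lemma enorm_sqr x : enorm x ^+ 2 = \sum_i x ord0 i ^+ 2.
Proof. by rewrite sqr_sqrtr// sumr_ge0// => i _; exact: sqr_ge0. Qed.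

Lemma enormZ t x : enorm (t *: x) = `|t| * enorm x.
Proof.
rewrite /enorm -sqrtr_sqr -sqrtrM ?sqr_ge0//; congr Num.sqrt.
by rewrite mulr_sumr; apply: eq_bigr => i _; rewrite mxE exprMn.
Qed.

Lemma enormN x : enorm (- x) = enorm x.
Proof. by rewrite -scaleN1r enormZ normrN1 mul1r. Qed.

Lemma enorm0 : enorm (0 : 'rV[R]_m) = 0.
Proof. by rewrite -(scale0r (0 : 'rV[R]_m)) enormZ normr0 mul0r. Qed.

Lemma enorm_eq0 x : enorm x = 0 -> x = 0.
Proof.
move=> x0; apply/eqP; rewrite -normr_eq0 eq_le normr_ge0 andbT -x0.
exact: norm_le_enorm.
Qed.

Lemma enormD x y : enorm (x + y) <= enorm x + enorm y.
Proof.
have [/enorm_eq0 ->|x0] := eqVneq (enorm x) 0; first by rewrite add0r enorm0 add0r.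
have [/enorm_eq0 ->|y0] := eqVneq (enorm y) 0; first by rewrite addr0 enorm0 addr0.
have xp : 0 < enorm x by rewrite lt_neqAle eq_sym x0 enorm_ge0.
have yp : 0 < enorm y by rewrite lt_neqAle eq_sym y0 enorm_ge0.
rewrite -(ler_pXn2r (_ : (0 < 2)%N)) ?nnegrE ?addr_ge0 ?enorm_ge0//.
rewrite sqrrD !enorm_sqr.
set a := enorm x in xp *; set b := enorm y in yp *.
(* AM-GM: [2 x_i y_i <= x_i^2 b / a + y_i^2 a / b] *)
have h i : (x + y) ord0 i ^+ 2 <=
    x ord0 i ^+ 2 + (x ord0 i ^+ 2 * (b / a) + y ord0 i ^+ 2 * (a / b)) + y ord0 i ^+ 2.
  rewrite mxE sqrrD lerD2r lerD2l -subr_ge0.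
  rewrite (_ : _ - _ = (x ord0 i * b - y ord0 i * a) ^+ 2 / (a * b)); last first.
    by field; rewrite !gt_eqF.
  by rewrite divr_ge0 ?sqr_ge0// mulr_ge0// ltW.
apply: le_trans (ler_sum _ (fun i _ => h i)) _.
rewrite !big_split/= -!mulr_suml -!enorm_sqr -/a -/b lerD2r lerD2l.
rewrite le_eqVlt; apply/orP; left; apply/eqP; field.
by rewrite !gt_eqF.
Qed.

Lemma enormB x y : enorm (x - y) = enorm (y - x).
Proof. by rewrite -enormN opprB. Qed.

Lemma ler_enormB y x z : enorm (x - z) <= enorm (x - y) + enorm (y - z).
Proof. by rewrite -(subrK y x) -addrA (subrK y x) enormD. Qed.

End euclidean_triangle.

Section hausdorff.
Context {R : realType} {m : nat}.
Implicit Types (A B : set 'rV[R]_m) (e : R).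
Local Open Scope ereal_scope.

Lemma hausdorff_dist_lt A B e : hausdorff_dist A B < e%:E ->
  forall y, A y -> exists2 z, B z & (enorm (y - z) < e)%R.
Proof.
move=> /ereal_inf_lt[_ [r [r0 [AB _]] <-]]; rewrite lte_fin => re y Ay.
have /ereal_inf_lt[_ [z Bz <-]] : dist_to B y < e%:E.
  by apply: le_lt_trans (AB _ Ay) _; rewrite lte_fin.
by rewrite lte_fin => yz; exists z.
Qed.

Lemma hausdorff_dist_le A B e : (0 < e)%R ->
  (forall y, A y -> exists2 z, B z & (enorm (y - z) <= e)%R) ->
  (forall y, B y -> exists2 z, A z & (enorm (y - z) <= e)%R) ->
  hausdorff_dist A B <= e%:E.
Proof.
move=> e0 AB BA; apply: ereal_inf_lbound; exists e => //; split => //.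
have H A' B' : (forall y, A' y -> exists2 z, B' z & (enorm (y - z) <= e)%R) ->
    A' `<=` thickening B' e.
  move=> h y /h[z Bz yz]; rewrite /thickening/=.
  apply: (@le_trans _ _ (enorm (y - z))%:E); last by rewrite lee_fin.
  by apply: ereal_inf_lbound; exists z.
by split; exact: H.
Qed.

Lemma hausdorff_dist_ge0 A B : 0 <= hausdorff_dist A B.
Proof.
by apply: le_ereal_inf_tmp => _ [r [r0 _] <-]; rewrite lee_fin ltW.
Qed.

End hausdorff.

(** * Convex sets with empty interior and thin slabs *)

Section hyperplane.
Context {R : realType} {m : nat}.
Implicit Types (K : set 'rV[R]_m) (p x : 'rV[R]_m).

Definition lform (l : 'cV[R]_m) x : R := \sum_i x ord0 i * l i ord0.

Lemma lformE l x : lform l x = (x *m l) ord0 ord0.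
Proof. by rewrite mxE. Qed.

Lemma lformD l x y : lform l (x + y) = lform l x + lform l y.
Proof. by rewrite !lformE mulmxDl mxE. Qed.

Lemma lformN l x : lform l (- x) = - lform l x.
Proof. by rewrite !lformE mulNmx mxE. Qed.

Lemma lformZ l t x : lform l (t *: x) = t * lform l x.
Proof. by rewrite !lformE -scalemxAl mxE. Qed.

Lemma lform_norm l x : `|lform l x| <= `|x| * \sum_i `|l i ord0|.
Proof.
rewrite mulr_sumr (le_trans (ler_norm_sum _ _ _))//; apply: ler_sum => i _.
by rewrite normrM ler_wpM2r// row_norm_coord.
Qed.

(** [p] and the points [p + row i A] span a nondegenerate simplex; the interior point is its
    barycentre, whose barycentric coordinates all equal 1/(m+1). *)
Lemma simplex_interior K p (A : 'M[R]_m) : convex_set K -> K p ->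
  A \in unitmx -> (forall i, K (p + row i A)) -> K° !=set0.
Proof.
move=> cK Kp Au KA.
pose w0 : R := m.+1%:R^-1.
have w00 : 0 < w0 by rewrite invr_gt0.
have in_simplex (w : 'rV[R]_m) : (forall i, 0 <= w ord0 i) ->
    \sum_i w ord0 i <= 1 -> K (p + w *m A).
  move=> wp ws.
  pose f (i : option 'I_m) := if i is Some i then p + row i A else p.
  pose v (i : option 'I_m) := if i is Some i then w ord0 i else 1 - \sum_j w ord0 j.
  have := @convex_combination R m _ (None :: [seq Some i | i <- index_enum 'I_m]) v f K cK.
  rewrite !big_cons !big_map/= subrK => h.
  have -> : p + w *m A = (1 - \sum_j w ord0 j) *: p +
      \sum_i w ord0 i *: (p + row i A).
    have -> : \sum_i w ord0 i *: (p + row i A) = (\sum_i w ord0 i) *: p + w *m A.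
      rewrite mulmx_sum_row scaler_suml -big_split/=.
      by apply: eq_bigr => i _; rewrite scalerDr.
    by rewrite addrA -scalerDl subrK scale1r.
  apply: h => //; first by case.
  by case => [i|]//=; rewrite subr_ge0.
pose B : R := \sum_i \sum_j `|invmx A j i| + 1.
have B0 : 0 < B by rewrite ltr_wpDl// !sumr_ge0// => i _; rewrite sumr_ge0.
exists (p + const_mx w0 *m A).
(* In a cube of this radius each of the [m] coordinates moves by at most w0^2. They stay
   nonnegative, and their sum is at most m (w0 + w0^2) = 1 - w0^2. *)
have e0 : 0 < w0 ^+ 2 / B by rewrite divr_gt0// exprn_gt0.
apply: (cube_interior e0) => y yq.
set q := p + const_mx w0 *m A in yq.
pose w := (y - p) *m invmx A.
have -> : y = p + w *m A by rewrite mulmxKV// addrC subrK.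
have wE i : `|w ord0 i - w0| <= w0 ^+ 2.
  have -> : w ord0 i - w0 = ((y - q) *m invmx A) ord0 i.
    rewrite /q opprD addrA mulmxBl mulmxK// [in RHS]mxE [in X in _ = _ + X]mxE.
    by rewrite [const_mx _ _ _]mxE.
  rewrite mxE (le_trans (ler_norm_sum _ _ _))//.
  apply: (@le_trans _ _ (w0 ^+ 2 / B * B)); last by rewrite divfK// gt_eqF.
  apply: (@le_trans _ _ (w0 ^+ 2 / B * \sum_j `|invmx A j i|)).
    rewrite mulr_sumr; apply: ler_sum => j _; rewrite normrM ler_wpM2r//.
    exact: le_trans (row_norm_coord _ _) yq.
  rewrite ler_wpM2l ?(ltW e0)// /B [X in _ <= X + _](bigD1 i)//= -addrA lerDl addr_ge0//.
  by rewrite sumr_ge0// => k _; rewrite sumr_ge0.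
have w0m : w0 * m.+1%:R = 1 by rewrite mulVf.
have w02 : w0 ^+ 2 <= w0.
  by rewrite expr2 -[leRHS]mulr1 ler_pM2l// invf_le1// ler1n.
apply: in_simplex => [i|].
  have := wE i; rewrite ler_distl; lra.
apply: (@le_trans _ _ (\sum_(i < m) (w0 + w0 ^+ 2))).
  by apply: ler_sum => i _; have := wE i; rewrite ler_distl; lra.
rewrite sumr_const card_ord -mulr_natr.
have m0 : (0 <= m%:R :> R) by [].
by move: w0m; rewrite -natr1 => h; nra.
Qed.

(** A maximal linearly independent family of vectors from [p] to points of [K] spans all these
    vectors. It has fewer than [m] members by [simplex_interior], so some column of its cokernel is
    a nonzero form vanishing on them. *)
Lemma empty_interior_hyperplane K p : convex_set K -> K p -> K° = set0 ->
  exists2 l : 'cV[R]_m, l != 0 & forall x, K x -> lform l (x - p) = 0.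
Proof.
move=> cK Kp K0.
pose P k := `[< exists A : 'M[R]_(k, m), row_free A /\ forall i, K (p + row i A) >].
have P0 : exists k, P k.
  exists 0%N; apply/asboolP; exists (0 : 'M[R]_(0, m)); split; last by case.
  by rewrite /row_free mxrank0.
have Pm k : P k -> (k <= m)%N.
  by move=> /asboolP[A [/eqP rA _]]; rewrite -rA; exact: rank_leq_col.
have [k /asboolP[A [Af KA]] kmax] := ex_maxnP P0 Pm.
have AK x : K x -> (x - p <= A)%MS.
  move=> Kx; apply: contrapT => /negP nA.
  have : P k.+1; last by move=> /kmax; rewrite ltnn.
  apply/asboolP; rewrite -addn1; exists (col_mx A (x - p)); split; last first.
    move=> i; case: (splitP i) => j ij.
      have -> : i = lshift 1 j by apply: val_inj.
      by rewrite rowKu; exact: KA.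
    have -> : i = rshift k j by apply: val_inj.
    by rewrite rowKd ord1 row_id addrC subrK.
  rewrite /row_free -addsmxE mxrank_disjoint_sum; last first.
    apply/eqP; rewrite -mxrank_eq0; apply: contraNT nA => r0.
    have r1 : \rank (A :&: (x - p))%MS = \rank (x - p).
      apply/eqP; rewrite eqn_leq mxrankS ?capmxSr//=.
      by rewrite (leq_trans (rank_leq_row _))// lt0n.
    have := mxrank_leqif_sup (capmxSr A (x - p)).
    by move=> [_ /esym]; rewrite r1 eqxx sub_capmx => /andP[].
  rewrite (eqP Af) rank_rV; apply/eqP; congr (_ + _)%N.
  by rewrite (_ : _ != 0)//; apply: contraNneq nA => ->; exact: sub0mx.
have [km|km] := eqVneq k m.
  subst k; have : K° !=set0.
    by apply: (simplex_interior cK Kp _ KA); rewrite -row_free_unit.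
  by rewrite K0 => -[].
have [i li] : exists i, col i (cokermx A) != 0.
  apply: contrapT => /forallNP h.
  have : cokermx A = 0.
    apply/matrixP => a b; have /negP := h b; rewrite negbK => /eqP/colP/(_ a).
    by rewrite !mxE.
  move/eqP; rewrite -mxrank_eq0 mxrank_coker (eqP Af) subn_eq0 => mk.
  by move: km; rewrite eqn_leq mk Pm//; apply/asboolP; exists A.
exists (col i (cokermx A)) => // x Kx; rewrite lformE colE mulmxA.
by have := AK _ Kx; rewrite submxE => /eqP ->; rewrite mul0mx mxE.
Qed.

Lemma lipschitz_row_continuous (f : 'rV[R]_m -> R) (k : R) :
  (forall y z, `|f z - f y| <= k * `|z - y|) -> continuous f.
Proof.
move=> fk y; apply/(@cvgrPdist_le _ _ _ (nbhs y)) => e e0.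
have k0 : 0 < `|k| + 1 by rewrite ltr_wpDl.
apply/nbhs_ballP; exists (e / (`|k| + 1)); first by rewrite /= divr_gt0.
move=> z; rewrite -ball_normE/= => yz; rewrite (le_trans (fk _ _))//.
apply: (@le_trans _ _ ((`|k| + 1) * (e / (`|k| + 1)))).
  apply: (@le_trans _ _ ((`|k| + 1) * `|y - z|)).
    by rewrite ler_wpM2r// (le_trans (ler_norm _))// lerDl.
  by rewrite ler_pM2l// ltW.
by rewrite mulrC divfK// gt_eqF.
Qed.

(** Along a coordinate [j] with nonzero coefficient, [N] translates of the slab piece by multiples
    of 1/N are disjoint and fit into [cube p (L + 1)], so each has at most 1/N of its volume. *)
Lemma slab_volume (l : 'cV[R]_m) p (L e : R) : l != 0 -> 0 < L -> 0 < e ->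
  exists2 d, 0 < d &
  (lebesgue (cube p L `&` [set x | `|lform l (x - p)| <= d]%R) <= e%:E)%E.
Proof.
move=> l0 L0 e0.
have [j lj] : exists j, l j ord0 != 0.
  apply: contrapT => /forallNP h; move/eqP: l0; apply; apply/colP => j.
  by have /negP := h j; rewrite negbK mxE => /eqP.
pose Q := (L + 1) ^+ m * unit_cube_volume R m.
have Q0 : 0 <= Q.
  by rewrite mulr_ge0 ?exprn_ge0 ?addr_ge0 ?(ltW L0)// ltW//; exact: cube0_volume.2.
pose N := (Num.truncn (Q / e)).+1.
have QN : Q <= N%:R * e by rewrite -ler_pdivrMr// ltW// truncnS_gt.
have N0 : 0 < N%:R :> R by rewrite ltr0n.
(* A quarter of the increment of the form between consecutive translates: two points of the slab
   differ by at most 2d, less than this increment. *)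
pose d := `|l j ord0| / (4 * N%:R).
have d0 : 0 < d by rewrite divr_gt0 ?normr_gt0 ?mulr_gt0.
exists d => //; set S := (X in lebesgue X).
have mS : measurable (S : set (lebesgue_space m)).
  apply: measurableI; first exact: measurable_cube.
  apply: closed_lebesgue_measurable.
  rewrite (_ : [set x | _] = (fun x => `|lform l (x - p)|) @^-1` [set t | t <= d])//.
  apply: preimage_closed; last exact: closed_le.
  move=> y _; apply: (@continuous_comp _ _ _ (fun x => lform l (x - p)) Num.norm);
    last exact: norm_continuous.
  move: y; apply: (@lipschitz_row_continuous _ (\sum_i `|l i ord0|)) => y z.
  have -> : lform l (z - p) - lform l (y - p) = lform l (z - y).
    by rewrite !lformD !lformN; ring.
  by rewrite mulrC lform_norm.
pose v (k : nat) : 'rV[R]_m := (k%:R / N%:R) *: delta_mx ord0 j.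
have vl k : lform l (v k) = k%:R / N%:R * l j ord0.
  rewrite lformZ /lform (bigD1 j)//= mxE !eqxx mul1r big1 ?addr0// => i ij.
  by rewrite mxE eqxx (negbTE ij) mul0r.
pose F (k : 'I_N) : set (lebesgue_space m) := [set v k + x | x in S].
have mF k : measurable (F k) by exact: measurable_translate.
have tF : trivIset setT F.
  apply/trivIsetP => a b _ _ ab; rewrite predeqE => z; split => // -[].
  move=> [x [_ /= xd] <-] [y [_ /= yd] xy].
  have : `|lform l (v a) - lform l (v b)| <= 2 * d.
    have -> : lform l (v a) - lform l (v b) = lform l (y - p) - lform l (x - p).
      have : lform l (v b + y) = lform l (v a + x) by rewrite xy.
      by rewrite !lformD !lformN; lra.
    by rewrite (le_trans (ler_normB _ _))//; lra.
  rewrite !vl -mulrBl -mulrBl !normrM [`|N%:R^-1|]ger0_norm ?invr_ge0//.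
  have : 1 <= `|(a : nat)%:R - (b : nat)%:R| :> R.
    move: ab; rewrite neq_ltn => /orP[] h.
      by rewrite distrC -natrB ?(ltnW h)// normr_nat ler1n subn_gt0.
    by rewrite -natrB ?(ltnW h)// normr_nat ler1n subn_gt0.
  rewrite /d; set u := `|_ - _|; set w := `|l j ord0| => u1.
  have w0 : 0 < w by rewrite normr_gt0.
  rewrite invfM mulrA [2 * _]mulrC -!mulrA [leRHS]mulrCA => h.
  have : u * (N%:R^-1 * w) <= (N%:R^-1 * w) / 2.
    by apply: le_trans h _; rewrite le_eqVlt; apply/orP; left; apply/eqP; field; rewrite gt_eqF.
  have : 0 < N%:R^-1 * w by rewrite mulr_gt0// invr_gt0.
  by move: u1; set t := _ * w; nra.
have : (N%:R%:E * lebesgue S <= (N%:R * e)%:E)%E.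
  apply: (@le_trans _ _ (lebesgue (\big[setU/set0]_(k < N) F k))).
    rewrite measure_bigsetU_ord//=.
    under eq_bigr do rewrite lebesgue_translate.
    by rewrite sumr_const card_ord mule_natl.
  apply: (@le_trans _ _ (lebesgue (cube p (L + 1)))); last first.
    by rewrite lebesgue_cube ?addr_gt0// lee_fin.
  apply: le_lebesgue => z; rewrite -bigcup_seq => -[k _ [x [xL _] <-]].
  rewrite /cube/= -addrA addrC (le_trans (ler_normD _ _))// lerD//.
  rewrite normrZ ger0_norm ?divr_ge0// -[leRHS]mulr1.
  apply: ler_pM => //; first by rewrite ler_pdivrMr// mul1r ler_nat ltnW.
  apply/row_norm_leP; first exact: ler01.
  by move=> i; rewrite mxE; case: (_ && _); rewrite ?normr1// normr0 ler01.
by move=> h; rewrite -(@lee_pmul2l _ N%:R%:E)// -EFinM.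
Qed.

End hyperplane.

Section uniform_geometry_cylinders.
Context {R : realType} {m : nat}.
Implicit Types (C K : set 'rV[R]_m).

Lemma unif_cylinder_interior C K : convex_set C -> unif C ->
  asymptotic_cylinder C K -> K° !=set0.
Proof.
move=> cC uC [clK cK [p Kp] [x [Cx _ xK]]].
apply: contrapT => /set0P/negP; rewrite negbK => /eqP K0.
have [l l0 lK] := empty_interior_hyperplane cK Kp K0.
have [c c0 hc] := unif_all cC uC ltr01.
have m0 : 0 <= m%:R :> R by [].
(* Large enough for the Euclidean ball about 0 to contain the unit cube and, in its interior, the
   point [p] of [K]. *)
pose r : R := m%:R + enorm p + 1.
have r0 : 0 < r by rewrite ltr_wpDl// addr_ge0// enorm_ge0.
have [d d0 hd] : exists2 d, 0 < d & (lebesgue (cube p (1 + `|p|) `&`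
    [set x | `|lform l (x - p)| <= d]%R) <= (c / 2)%:E)%E.
  by apply: slab_volume; rewrite ?ltr_pwDl ?divr_gt0.
pose B : R := \sum_i `|l i ord0| + 1.
have B0 : 0 < B by rewrite ltr_wpDl// sumr_ge0.
have Kne : K `&` eball 0 r !=set0.
  exists p; split => //; rewrite /eball/= subr0 /r.
  by rewrite -addrA addrCA ltrDl ltr_wpDl.
(* [B] bounds the norm of the form, so points this close to [K] lie in the slab of half-width [d],
   where less than the volume [c] is available. *)
have e0 : 0 < d / B by rewrite divr_gt0.
have := xK 0 r r0 Kne.
move=> /fine_cvgP[] H1 /cvgrPdist_lt /(_ _ e0) H2.
near \oo => i.
set X := [set - x i + y | y in C].
have : (hausdorff_dist (X `&` ecball 0%R r) (K `&` ecball 0%R r) < (d / B)%:E)%E.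
  have f1 : hausdorff_dist (X `&` ecball 0 r) (K `&` ecball 0 r) \is a fin_num.
    by rewrite /X; near: i.
  rewrite -(fineK f1) lte_fin.
  have : `|0 - fine (hausdorff_dist (X `&` ecball 0 r) (K `&` ecball 0 r))| < d / B.
    by rewrite /X; near: i.
  by rewrite sub0r normrN; exact: le_lt_trans (ler_norm _).
move=> /hausdorff_dist_lt h.
have : (lebesgue (C `&` cube (x i) 1) <= (c / 2)%:E)%E.
  apply: le_trans hd.
  rewrite -(lebesgue_translate (- x i)); apply: le_lebesgue.
  move=> _ [y [Cy yx] <-].
  have yx1 : `|- x i + y| <= 1 by rewrite addrC.
  have [z [Kz _] yz] : exists2 z, (K `&` ecball 0 r) z & enorm (- x i + y - z) < d / B.
    apply: h; split; first by exists y.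
    rewrite /ecball/= subr0 (le_trans (enorm_le_norm _))//.
    rewrite (@le_trans _ _ m%:R)//; first by rewrite -[leRHS]mulr1 ler_wpM2l.
    by rewrite /r -addrA lerDl addr_ge0// enorm_ge0.
  split; first by rewrite /cube/= (le_trans (ler_normB _ _))// lerD2r.
  rewrite /= -(subrK z (- x i + y)) -addrA lformD lK// addr0.
  rewrite (le_trans (lform_norm _ _))//.
  apply: (@le_trans _ _ (d / B * B)); last by rewrite divfK// gt_eqF.
  apply: ler_pM => //; first by rewrite sumr_ge0.
    exact: le_trans (norm_le_enorm _) (ltW yz).
  by rewrite /B lerDl.
move=> /(le_trans (hc _ (Cx i))); rewrite lee_fin; lra.
Unshelve. all: by end_near. Qed.

End uniform_geometry_cylinders.

(** * Selection theorem and local Hausdorff limits of convex sets *)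

Section blaschke.
Context {R : realType} {m : nat}.
Implicit Types (A K : set 'rV[R]_m) (p q x y w : 'rV[R]_m) (e M : R).

Lemma segment_convex A : (forall x y t, A x -> A y -> 0 <= t <= 1 ->
  A (x + t *: (y - x))) -> convex_set A.
Proof.
move=> h x y l /set_mem Ax /set_mem Ay; apply/mem_set.
have := h y x l%:inum Ay Ax; rewrite ge0 le1 => /(_ isT); congr A.
by rewrite /conv/= /unstable.onem; apply/rowP => i; rewrite !mxE; ring.
Qed.

(** For nonempty sets these functions are 1-Lipschitz, so that convergence of sets becomes pointwise
    convergence of functions. *)
Definition ndist A q : R := inf [set `|q - y| | y in A].

Lemma ndist_has_lbound A q : has_lbound [set `|q - y| | y in A].
Proof. by exists 0 => _ [y _ <-]. Qed.

Lemma ndist_le A q y : A y -> ndist A q <= `|q - y|.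
Proof. by move=> Ay; apply: ge_inf; [exact: ndist_has_lbound|exists y]. Qed.

Lemma ndist_ge0 A q : A !=set0 -> 0 <= ndist A q.
Proof.
by move=> [y Ay]; apply: lb_le_inf; [exists `|q - y|, y|move=> _ [z _ <-]].
Qed.

Lemma ndist_lt A q e : A !=set0 -> ndist A q < e ->
  exists2 y, A y & `|q - y| < e.
Proof.
move=> [y0 Ay0] /inf_lt[|_ [y Ay <-] ye]; last by exists y.
by exists `|q - y0|, y0.
Qed.

Lemma ndist_lip A q q' : A !=set0 -> ndist A q <= ndist A q' + `|q - q'|.
Proof.
move=> A0; apply/ler_addgt0Pr => e e0.
have [y Ay yq] : exists2 y, A y & `|q' - y| < ndist A q' + e.
  by apply: ndist_lt => //; rewrite ltrDl.
apply: (le_trans (ndist_le q Ay)).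
by have := ler_normD (q - q') (q' - y); rewrite addrA subrK; lra.
Qed.

Lemma ndist_liph A q q' : A !=set0 -> `|ndist A q - ndist A q'| <= `|q - q'|.
Proof.
move=> A0; have h1 := ndist_lip q q' A0; have h2 := ndist_lip q' q A0.
by rewrite ler_distl; rewrite distrC in h2; lra.
Qed.

(** One ultrafilter gives limits of all bounded sequences simultaneously, in place of diagonal
    extractions over a dense set of points. *)
Lemma ultrafilter_limit (U : set_system nat) (f : nat -> R) (b : R) :
  UltraFilter U -> (forall i, 0 <= f i <= b) ->
  exists l, forall e, 0 < e -> U [set i | `|f i - l| < e].
Proof.
move=> ultraU fb.
have ultrafU : UltraFilter (f @ U).
  split; first exact: fmap_proper_filter.
  move=> G PG fUG; rewrite predeqE => A; split => [GA|/fUG//].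
  have [//|nA] := in_ultra_setVsetC (f @^-1` A) ultraU.
  have GnA : G (~` A) by apply: fUG.
  by have [x [Ax]] := filter_ex (filterI GA GnA).
have := @segment_compact R 0 b; rewrite compact_ultra => /(_ _ ultrafU)[].
  have Ufb : U (f @^-1` `[0, b]).
    by apply: filterE => i; rewrite /= in_itv/=; exact: fb.
  exact: Ufb.
move=> l [_ fl]; exists l => e e0.
have /cvgrPdist_lt/(_ _ e0) := fl.
by apply: filterS => i; rewrite distrC.
Qed.

Lemma compact_cube x r : compact (cube x r).
Proof.
apply: bounded_closed_compact; last exact: closed_cube.
exists (`|x| + r); split; first exact: num_real.
move=> t rt y yx /=; rewrite -(subrK x y) addrC.
by rewrite (le_trans (ler_normD _ _))// (le_trans _ (ltW rt))// lerD2l.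
Qed.

(** Distance functions converge along an ultrafilter to a 1-Lipschitz function [d], and [K] is its
    zero set. The sets contain 0, which bounds the distance from each point. Indices realising the
    convergence on growing cubes are chosen at the end. *)
Lemma blaschke_selection (X : nat -> set 'rV[R]_m) :
  (forall i, X i 0) -> (forall i, convex_set (X i)) ->
  exists (j : nat -> nat) K,
  [/\ forall k, (k <= j k)%N, closed K, convex_set K, K 0 &
    forall M e, 0 < e -> \forall k \near \oo,
      (forall q, X (j k) q -> `|q| <= M -> exists2 w, K w & `|q - w| <= e) /\
      (forall w, K w -> `|w| <= M -> exists2 q, X (j k) q & `|w - q| <= e)].
Proof.
move=> X0 cX.
have Xn i : X i !=set0 by exists 0; exact: X0.
have [U [ultraU ooU]] := @ultraFilterLemma nat \oo _.
have [d dP] : {d : 'rV[R]_m -> R & forall q e, 0 < e ->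
    U [set i | `|ndist (X i) q - d q| < e]}.
  apply: (@choice _ _ (fun q l => forall e, 0 < e ->
    U [set i | `|ndist (X i) q - l| < e])) => q.
  apply: (@ultrafilter_limit _ _ `|q|) => // i.
  by rewrite ndist_ge0//= -[q in leRHS]subr0 ndist_le.
have dlip q q' : `|d q - d q'| <= `|q - q'|.
  apply/ler_addgt0Pr => e e0.
  have e2 : 0 < e / 2 by rewrite divr_gt0.
  have [i [h1 h2]] := filter_ex (filterI (dP q _ e2) (dP q' _ e2)).
  have := ndist_liph q q' (Xn i).
  by move: h1 h2; rewrite /= !ltr_distl !ler_distl; lra.
(* Equal Lipschitz constants and compactness of the cube upgrade pointwise to uniform
   convergence. *)
have unifU M e : 0 < e ->
    U [set i | forall q, `|q| <= M -> `|ndist (X i) q - d q| <= e].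
  move=> e0.
  have /compact_near_coveringP nc := @compact_cube 0 M.
  have e3 : 0 < e / 3 by rewrite divr_gt0.
  have := nc nat U (fun i q => `|ndist (X i) q - d q| <= e) _.
  move=> H; have {H} : \near U, cube 0 M `<=` (fun q => `|ndist (X U) q - d q| <= e).
    apply: H => q _.
    exists ([set q' | `|q - q'| < e / 3], [set i | `|ndist (X i) q - d q| < e / 3]).
      split; last exact: dP.
      by apply/nbhs_ballP; exists (e / 3) => // z; rewrite -ball_normE.
    move=> [q' i] /= [qq' h].
    have := dlip q q'; have := ndist_liph q q' (Xn i).
    by move: h qq'; rewrite !ltr_distl !ler_distl; lra.
  by apply: filterS => i /= h q qM; apply: h; rewrite /cube/= subr0.
(* Since the ultrafilter is finer than [\oo], each index can be taken beyond [k], with error 1/(k+1)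
   on the cube of radius [k]. *)
have [j jP] : {j : nat -> nat & forall k, (k <= j k)%N /\
    forall q, `|q| <= k%:R -> `|ndist (X (j k)) q - d q| <= k.+1%:R^-1}.
  apply: (@choice _ _ (fun k i => (k <= i)%N /\
    forall q, `|q| <= k%:R -> `|ndist (X i) q - d q| <= k.+1%:R^-1)) => k.
  have Uk : U [set i | (k <= i)%N] by apply: ooU; exists k.
  have k0 : 0 < k.+1%:R^-1 :> R by rewrite invr_gt0.
  by have [i [ki h]] := filter_ex (filterI Uk (unifU k%:R _ k0)); exists i.
have d0 q : 0 <= d q.
  apply/ler_addgt0Pr => e e0; have [i] := filter_ex (dP q _ e0).
  by have := ndist_ge0 q (Xn i); rewrite /= ltr_distl; lra.
pose K : set 'rV[R]_m := [set q | d q <= 0].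
(* Points [y i] of [X i] within [e] of [q] have a cluster point along [U] in the compact cube, and
   [d] vanishes there. *)
have near_K q e : d q < e -> exists2 w, K w & `|q - w| <= e.
  move=> dqe; have e0 : 0 < e by exact: le_lt_trans dqe.
  have Ue : U [set i | exists2 y, X i y & `|q - y| < e].
    have ed : 0 < e - d q by rewrite subr_gt0.
    apply: filterS (dP q _ ed) => i; rewrite /= ltr_distl => h.
    by apply: ndist_lt => //; lra.
  pose y i : 'rV[R]_m := get [set y | X i y /\ `|q - y| < e].
  have yP : U [set i | X i (y i) /\ `|q - y i| < e].
    apply: filterS Ue => i [z Xz zq].
    by have := @getPex _ [set y | X i y /\ `|q - y| < e]; apply; exists z.
  have yU : (y @ U) (cube q e).
    have H : U (y @^-1` cube q e).
      by apply: filterS yP => i [_ h]; rewrite /cube/= distrC ltW.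
    exact: H.
  have [w [wq wcl]] := @compact_cube q e (y @ U) _ yU.
  exists w; last by rewrite distrC.
  apply/ler_addgt0Pr => t t0; rewrite add0r.
  have t2 : 0 < t / 2 by rewrite divr_gt0.
  have Bw : nbhs w [set z | `|w - z| < t / 2].
    by apply/nbhs_ballP; exists (t / 2) => // z; rewrite -ball_normE.
  have yD : (y @ U) [set z | exists i, X i z /\ `|ndist (X i) w - d w| < t / 2].
    have H : U (y @^-1` [set z | exists i, X i z /\ `|ndist (X i) w - d w| < t / 2]).
      by apply: filterS (filterI yP (dP w _ t2)) => i [[h1 h2] h3]; exists i.
    exact: H.
  have [z [[i [Xz h]] zw]] := wcl _ _ yD Bw.
  have := ndist_le w Xz; move: h zw; rewrite /= ltr_distl; lra.
exists j, K; split.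
- by move=> k; have [] := jP k.
- rewrite (_ : K = d @^-1` [set t | t <= 0])//.
  apply: preimage_closed; last exact: closed_le.
  move=> q _; move: q; apply: (@lipschitz_row_continuous _ _ _ 1) => y z.
  by rewrite mul1r.
- apply: segment_convex => q q' t Kq Kq' /andP[t0 t1].
  apply/ler_addgt0Pr => e e0; rewrite add0r.
  have e2 : 0 < e / 2 by rewrite divr_gt0.
  set z := q + t *: (q' - q).
  have [i [[h1 h2] h3]] := filter_ex (filterI (filterI (dP q _ e2) (dP q' _ e2)) (dP z _ e2)).
  have [y Xy yq] : exists2 y, X i y & `|q - y| < e / 2.
    by apply: ndist_lt => //; move: h1 Kq; rewrite /K/= ltr_distl; lra.
  have [y' Xy' yq'] : exists2 y, X i y & `|q' - y| < e / 2.
    by apply: ndist_lt => //; move: h2 Kq'; rewrite /K/= ltr_distl; lra.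
  have Xc : X i (y + t *: (y' - y)) by apply: convex_segment => //; rewrite t0.
  have := ndist_le z Xc.
  have : `|z - (y + t *: (y' - y))| <= e / 2.
    have -> : z - (y + t *: (y' - y)) = (1 - t) *: (q - y) + t *: (q' - y').
      by apply/rowP => l; rewrite !mxE; ring.
    rewrite (le_trans (ler_normD _ _))// !normrZ !ger0_norm ?subr_ge0//.
    by move: yq yq'; set b := `|_|; set b' := `|_|; nra.
  by move: h3; rewrite /= ltr_distl; lra.
- rewrite /K/=; apply/ler_addgt0Pr => e e0; rewrite add0r.
  have [i] := filter_ex (dP 0 _ e0); have := ndist_le 0 (X0 i).
  by rewrite subr0 normr0 /= ltr_distl; lra.
- move=> M e e0.
  have e2 : 0 < e / 2 by rewrite divr_gt0.
  near=> k.
  have kM : M <= k%:R by near: k; exact: nbhs_infty_ger.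
  have ke : k.+1%:R^-1 < e / 2.
    near: k; have := @near_infty_natSinv_lt R (PosNum e2).
    by apply: filterS => k.
  have [_] := jP k; move: ke; set u := _^-1 => ke h; split => [q Xq qM|w Kw wM].
    have := h q (le_trans qM kM); have := ndist_le q Xq.
    rewrite subrr normr0 ler_distl => h1 h2.
    by apply: near_K; have := ndist_ge0 q (Xn (j k)); lra.
  have := h w (le_trans wM kM); rewrite ler_distl => h1.
  have [y Xy yw] : exists2 y, X (j k) y & `|w - y| < e.
    by apply: ndist_lt => //; move: Kw; rewrite /K/=; lra.
  by exists y => //; rewrite ltW.
Unshelve. all: by end_near. Qed.

(** A point sticking out of the ball by at most [d] is moved towards [b], which lies at depth [eta].
    The ratio t = d/(eta + d) solves (1 - t)(r + d) + t(r - eta) = r. *)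
Lemma pull_into_ball A b p r eta d w : convex_set A -> A b ->
  enorm (b - p) <= r - eta -> 0 < eta -> 0 <= d ->
  A w -> enorm (w - p) <= r + d ->
  exists w', [/\ A w', enorm (w' - p) <= r & enorm (w - w') <= d * (2 * r + d) / eta].
Proof.
move=> cA Ab bp eta0 d0 Aw wp.
have r0 : 0 <= r by have := enorm_ge0 (b - p); lra.
have ed : 0 < eta + d by rewrite ltr_wpDr.
pose t := d / (eta + d).
have t0 : 0 <= t by rewrite divr_ge0// ltW.
have t1 : t <= 1 by rewrite ler_pdivrMr// mul1r lerDr ltW.
have tE : t * (eta + d) = d by rewrite divfK// gt_eqF.
exists (w + t *: (b - w)); split; first by apply: convex_segment => //; rewrite t0.
  have -> : w + t *: (b - w) - p = (1 - t) *: (w - p) + t *: (b - p).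
    by apply/rowP => i; rewrite !mxE; ring.
  rewrite (le_trans (enormD _ _))// !enormZ !ger0_norm ?subr_ge0//.
  by move: (enorm_ge0 (w - p)) (enorm_ge0 (b - p)); nra.
have -> : w - (w + t *: (b - w)) = t *: (w - b).
  by apply/rowP => i; rewrite !mxE; ring.
rewrite enormZ ger0_norm// [leRHS]mulrAC; apply: ler_pM; rewrite ?enorm_ge0//.
  by rewrite /t ler_pdivrMr// mulrAC ler_pdivlMr// ler_wpM2l// lerDl.
have := ler_enormB p w b; rewrite (enormB p b); lra.
Qed.

(** The difficulty is the sphere: the approximant of a point of the closed ball may fall outside it.
    It is pulled back towards a point deep in the ball, which exists because the open ball meets
    [K]. *)
Lemma locally_hausdorff_cvg_uniform (X : nat -> set 'rV[R]_m) K :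
  (forall i, convex_set (X i)) -> convex_set K ->
  (forall M e, 0 < e -> \forall k \near \oo,
      (forall q, X k q -> `|q| <= M -> exists2 w, K w & `|q - w| <= e) /\
      (forall w, K w -> `|w| <= M -> exists2 q, X k q & `|w - q| <= e)) ->
  locally_hausdorff_cvg X K.
Proof.
move=> cX cK XK p r r0 [a [Ka ap]].
pose eta := r - enorm (a - p).
have eta0 : 0 < eta by rewrite subr_gt0.
have main e : 0 < e -> \forall k \near \oo,
    (hausdorff_dist (X k `&` ecball p r) (K `&` ecball p r) <= e%:E)%E.
  move=> e0.
  (* The approximation error [d] and the displacement by [pull_into_ball], at depth eta/2 and with d
     <= 1, together are at most d Q. *)
  pose Q := 1 + 2 * (2 * r + 1) / eta.
  have Q0 : 1 <= Q by rewrite lerDl divr_ge0 ?(ltW eta0)// mulr_ge0// addr_ge0// mulr_ge0// ltW.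
  have Qp : 0 < Q by exact: lt_le_trans Q0.
  pose d := Num.min 1 (Num.min (eta / 2) (e / Q)).
  have d0 : 0 < d by rewrite !lt_min ltr01 !divr_gt0.
  have [d1 deta dQ] : [/\ d <= 1, d <= eta / 2 & d * Q <= e].
    by rewrite -ler_pdivlMr// /d !ge_min !lexx !orbT.
  have bnd eta' : eta / 2 <= eta' -> d + d * (2 * r + d) / eta' <= e.
    move=> h; have eta'0 : 0 < eta' by apply: lt_le_trans h; rewrite divr_gt0.
    apply: le_trans dQ.
    have -> : d * Q = d + d * (2 * (2 * r + 1) / eta) by rewrite /Q; ring.
    rewrite lerD2l ler_pdivrMr// -[leRHS]mulrA ler_pM2l//.
    set c := 2 * r + 1; have c0 : 0 < c by rewrite ltr_wpDl// mulr_ge0// ltW.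
    apply: (@le_trans _ _ (2 * c / eta * (eta / 2))).
      rewrite (_ : _ * (eta / 2) = c); first by rewrite /c; lra.
      by field; rewrite gt_eqF.
    by rewrite ler_wpM2l// divr_ge0 ?(ltW eta0)// mulr_ge0// ltW.
  have d'0 : 0 < d / m.+1%:R by rewrite divr_gt0.
  have enorm_d q : `|q| <= d / m.+1%:R -> enorm q <= d.
    move=> h; rewrite (le_trans (enorm_le_norm _))//.
    apply: (@le_trans _ _ (m.+1%:R * (d / m.+1%:R))); last by rewrite mulrC divfK.
    by apply: ler_pM => //; rewrite ler_nat.
  have ballM q : ecball p r q -> `|q| <= r + enorm p.
    move=> qp; rewrite (le_trans (norm_le_enorm _))// -[q in leLHS](subrK p).
    by rewrite (le_trans (enormD _ _))// lerD2r.
  apply: filterS (XK (r + enorm p) _ d'0) => k [XtoK KtoX].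
  apply: hausdorff_dist_le => // [y [Xy yp]|w [Kw wp]].
    have [w Kw yw] := XtoK y Xy (ballM _ yp).
    have {}yw := enorm_d _ yw.
    have wp : enorm (w - p) <= r + d.
      by have := ler_enormB y w p; rewrite (enormB w y); move: yp; rewrite /ecball/=; lra.
    have ap' : enorm (a - p) <= r - eta by rewrite /eta; lra.
    have [w' [Kw' w'p ww']] := pull_into_ball cK Ka ap' eta0 (ltW d0) Kw wp.
    exists w' => //; rewrite (le_trans (ler_enormB w _ _))//.
    apply: le_trans (bnd eta _); last by lra.
    exact: lerD.
  have [y Xy yw] := KtoX w Kw (ballM _ wp).
  have {}yw := enorm_d _ yw.
  have yp : enorm (y - p) <= r + d.
    by have := ler_enormB w y p; rewrite (enormB y w); move: wp; rewrite /ecball/=; lra.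
  (* To pull back inside [X k], the point [a] of [K] is replaced by a nearby point of [X k], at the
     cost of half of its depth. *)
  have [b Xb ab] := KtoX a Ka (ballM _ (ltW ap)).
  have {}ab := enorm_d _ ab.
  have bp : enorm (b - p) <= r - eta / 2.
    have := ler_enormB a b p; rewrite (enormB b a).
    have : enorm (a - p) = r - eta by rewrite /eta; lra.
    by move: deta ab; lra.
  have eta20 : 0 < eta / 2 by rewrite divr_gt0.
  have [y' [Xy' y'p yy']] := pull_into_ball (cX k) Xb bp eta20 (ltW d0) Xy yp.
  exists y' => //; rewrite (le_trans (ler_enormB y _ _))//.
  by apply: le_trans (bnd _ (lexx _)); exact: lerD.
apply/fine_cvgP; split.
  apply: filterS (main 1 ltr01) => k h.
  by rewrite ge0_fin_numE ?hausdorff_dist_ge0// (le_lt_trans h)// ltry.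
apply/cvgrPdist_le => e e0; apply: filterS (main e e0) => k h.
have h0 := hausdorff_dist_ge0 (X k `&` ecball p r) (K `&` ecball p r).
rewrite sub0r normrN /= ger0_norm ?fine_ge0//.
have fn : hausdorff_dist (X k `&` ecball p r) (K `&` ecball p r) \is a fin_num.
  by rewrite ge0_fin_numE// (le_lt_trans h)// ltry.
by rewrite -lee_fin fineK.
Qed.

(* Cancellation of a ball: iterating [q + b_k = y_k + b_(k+1)] and averaging
   gives [q] as a limit of convex combinations of the [y_k]. *)
Lemma convex_cube_cancel A q s : closed A -> convex_set A -> 0 <= s ->
  (forall b, `|b| <= s -> exists2 y, A y & `|q + b - y| <= s) -> A q.
Proof.
move=> clA cA s0 H.
have /choice[y yP] (b : 'rV[R]_m) : exists y, `|b| <= s -> A y /\ `|q + b - y| <= s.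
  have [bs|bs] := pselect (`|b| <= s); last by exists 0.
  by have [y Ay h] := H b bs; exists y.
pose b (k : nat) : 'rV[R]_m := iter k (fun b => q + b - y b) 0.
have bs k : `|b k| <= s.
  by elim: k => [|k IH]; rewrite /b/= ?normr0//; exact: (yP _ IH).2.
have sumE N : \sum_(k < N) y (b k) = N%:R *: q - b N.
  elim: N => [|N IH]; first by rewrite big_ord0 scale0r subr0.
  rewrite big_ord_recr/= IH; apply/rowP => i; rewrite !mxE -natr1.
  by rewrite mulrDl mul1r; ring.
apply: clA => B /nbhs_ballP[e /= e0 eB].
pose N := (Num.truncn (s / e)).+1.
have N0 : 0 < N%:R :> R by rewrite ltr0n.
have sN : s / N%:R < e.
  by rewrite ltr_pdivrMr// mulrC -ltr_pdivrMr// truncnS_gt.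
clearbody N b; exists (q - N%:R^-1 *: b N); split; last first.
  apply: eB; rewrite -ball_normE/= opprB addrCA subrr addr0 normrZ.
  by rewrite ger0_norm ?invr_ge0// mulrC (le_lt_trans _ sN)// ler_wpM2r// invr_ge0.
have := @convex_combination R m _ (index_enum 'I_N) (fun=> N%:R^-1) (fun k => y (b k)) A cA.
rewrite -scaler_sumr sumE scalerBr scalerA mulVf ?gt_eqF// scale1r; apply.
- by move=> k; exact: (yP _ (bs k)).1.
- by move=> k; rewrite invr_ge0.
- by rewrite big_const_ord iter_addr_0 -[LHS]mulr_natr mulVf// gt_eqF.
Qed.

Lemma cylinder_interior_unif C : convex_body C ->
  (forall K, asymptotic_cylinder C K -> K° !=set0) -> unif C.
Proof.
move=> [clC cC [p0 /interior_cube[rho0 rho00 p0C]]] HK; apply: contrapT => nu.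
(* Both the volume and the scale degenerate: the cubes grow, so that a ball of the limit will lie in
   them wherever it is. *)
have /choice[x xP] (i : nat) : exists x, C x /\
    (lebesgue (C `&` cube x i.+1%:R) < (i.+1%:R^-1)%:E)%E.
  have i0 : 0 < i.+1%:R^-1 :> R by rewrite invr_gt0.
  by have [x Cx h] := not_unifP nu (ltr0Sn R i) i0; exists x.
pose X i := [set - x i + y | y in C].
have X0 i : X i 0 by exists (x i); [exact: (xP i).1|rewrite addNr].
have cX i : convex_set (X i).
  apply: segment_convex => _ _ t [y Cy <-] [z Cz <-] t01.
  exists (y + t *: (z - y)); first exact: convex_segment.
  by apply/rowP => l; rewrite !mxE; ring.
have [j [K [jk clK cK K0 XK]]] := blaschke_selection X0 cX.
have small (c : R) : 0 < c -> \forall k \near \oo, (j k).+1%:R^-1 < c.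
  move=> c0; have := @near_infty_natSinv_lt R (PosNum c0).
  apply: filterS => i /=; apply: le_lt_trans.
  by rewrite lef_pV2 ?posrE// ler_nat ltnS.
have KC : asymptotic_cylinder C K.
  split => //; first by exists 0.
  exists (x \o j); split; first by move=> i; exact: (xP _).1.
    apply/cvgryPge => A.
    (* If [x (j k)] stayed within distance [A] of the origin, [convex_body_near_cube] would bound
       the small volumes from below. *)
    have M0 : 0 < `|A| + `|p0| + 1 by rewrite ltr_wpDl// addr_ge0.
    have [c c0 hc] := convex_body_near_cube cC rho00 p0C M0 ltr01.
    apply: filterS (small c c0) => k kc; rewrite leNgt; apply/negP => xA.
    have [Cx xv] := xP (j k).
    have : (c%:E <= lebesgue (C `&` cube (x (j k)) 1))%E.
      apply: hc => //; rewrite (le_trans (ler_normB _ _))// -addrA [_ + 1]addrC addrA lerD2r.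
      have := norm_le_enorm (x (j k)); have := ler_norm A; move: xA; rewrite /=; lra.
    apply/negP; rewrite -ltNge; apply: (@le_lt_trans _ _ (lebesgue (C `&` cube (x (j k)) (j k).+1%:R))).
      apply: le_lebesgue; apply: setIS => y; rewrite /cube/= => /le_trans; apply.
      by rewrite ler1n.
    by apply: (lt_trans xv); rewrite lte_fin.
  by apply: locally_hausdorff_cvg_uniform => // i; exact: cX.
have [p /interior_cube[rho rhop pK]] := HK K KC.
have rho2 : 0 < rho / 2 by rewrite divr_gt0.
pose v := (rho / 2) ^+ m * unit_cube_volume R m.
have v0 : 0 < v by rewrite mulr_gt0 ?exprn_gt0//; exact: cube0_volume.2.
pose M := `|p| + rho.
near \oo => k.
have [_ hk] : (forall q, X (j k) q -> `|q| <= M -> exists2 w, K w & `|q - w| <= rho / 2) /\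
      (forall w, K w -> `|w| <= M -> exists2 q, X (j k) q & `|w - q| <= rho / 2).
  by near: k; exact: XK.
have kv : (j k).+1%:R^-1 < v by near: k; exact: (small v).
have kM : M <= (j k).+1%:R.
  apply: (@le_trans _ _ k%:R); first by near: k; exact: nbhs_infty_ger.
  by rewrite ler_nat (leq_trans (jk k)).
have := (xP (j k)).2; apply/negP; rewrite -leNgt.
apply: (@le_trans _ _ v%:E); first by rewrite lee_fin ltW.
rewrite /v -(lebesgue_cube (x (j k) + p) rho2); apply: le_lebesgue => y yp; split.
  (* Half of the radius [rho] pays for the cancellation: shifting [y - x (j k)] by up to rho/2 stays
     in the cube of [K], whose points are approximated within rho/2. *)
  apply: (@convex_cube_cancel _ _ (rho / 2) clC cC (ltW rho2)) => b bs.
  have yb : cube p rho (y - x (j k) + b).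
    rewrite /cube/= (_ : y - x (j k) + b - p = (y - (x (j k) + p)) + b).
      by rewrite (le_trans (ler_normD _ _))//; move: yp; rewrite /cube/=; lra.
    by apply/rowP => l; rewrite !mxE; ring.
  have [|_ [z Cz <-] h] := hk _ (pK _ yb).
    have := ler_normD (y - x (j k) + b - p) p; rewrite subrK.
    by move: yb; rewrite /cube/= /M; lra.
  exists z => //; apply: le_trans h; rewrite le_eqVlt; apply/orP; left; apply/eqP.
  by congr (`|_|); apply/rowP => l; rewrite !mxE; ring.
rewrite /cube/= (le_trans _ kM)//.
have := ler_normD (y - (x (j k) + p)) p.
rewrite (_ : y - (x (j k) + p) + p = y - x (j k)); last by apply/rowP => l; rewrite !mxE; ring.
by move: yp; rewrite /cube/= /M; lra.
Unshelve. all: by end_near. Qed.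

End blaschke.

(** * Solid angles *)

Section solid_angle_lower_bound.
Context {R : realType} {n : nat}.
Notation mu := (@lebesgue R n.+1).
Implicit Types (x y a : 'rV[R]_n.+1) (A C L : set 'rV[R]_n.+1) (d : R).

Lemma ball_volume_gt0 : exists2 b : R, 0 < b & ball_volume n = b%:E.
Proof.
have lb : ((n.+1%:R^-1 ^+ n * unit_cube_volume R n)%:E <= @ball_volume R n)%E.
  rewrite -(@lebesgue_cube _ _ 0) ?invr_gt0//; apply: le_lebesgue => x.
  rewrite /cube/= subr0 => h; rewrite (le_trans (enorm_le_norm _))//.
  apply: (@le_trans _ _ (n.+1%:R * n.+1%:R^-1)); last by rewrite divff.
  by apply: ler_pM => //; rewrite ler_nat.
have ub : (@ball_volume R n <= (unit_cube_volume R n)%:E)%E.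
  rewrite -cube0_volume.1; apply: le_lebesgue => x /=.
  by rewrite /cube/= subr0; apply: le_trans; exact: norm_le_enorm.
have fn : @ball_volume R n \is a fin_num.
  by rewrite ge0_fin_numE ?measure_ge0// (le_lt_trans ub)// ltry.
exists (fine (@ball_volume R n)); last by rewrite fineK.
rewrite -lte_fin fineK//; apply: lt_le_trans lb; rewrite lte_fin mulr_gt0 ?exprn_gt0//.
exact: cube0_volume.2.
Qed.

Definition unit_cone x A : set 'rV[R]_n.+1 :=
  [set y | exists a t, [/\ A a, 0 <= t <= 1 & y = x + t *: (a - x)]].

(** The cone is covered by N + 1 cubes of radius 2d, with N about 1/d. The 3 bounds d (N + 1) <= 1 +
    2 d, and the other factors are the volume of a cube divided by d^(n+1). *)
Let K : R := 3 * 2 ^+ n.+1 * unit_cube_volume R n.+1.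

(* A set of diameter [d] on the sphere spans a cone of volume [O(d ^+ n)], which
   compares volumes of cones over covers with Hausdorff sums. *)
Lemma unit_cone_volume x A d : A `<=` esphere x 1 -> 0 < d <= 1 ->
  (forall a b, A a -> A b -> enorm (a - b) <= d) ->
  (mu (unit_cone x A) <= (K * d ^+ n)%:E)%E.
Proof.
move=> Ax /andP[d0 d1] Ad.
have k0 : 0 < unit_cube_volume R n.+1 by exact: cube0_volume.2.
have K0 : 0 <= K by rewrite !mulr_ge0 ?exprn_ge0// ltW.
have [[a0 Aa0]|nA] := pselect (A !=set0); last first.
  rewrite (_ : unit_cone x A = set0).
    by rewrite measure0 lee_fin mulr_ge0// exprn_ge0// ltW.
  by rewrite predeqE => y; split => // -[a [t [Aa _ _]]]; apply: nA; exists a.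
pose N := (Num.truncn d^-1).+1.
have N0 : 0 < N%:R :> R by rewrite ltr0n.
have dN : N%:R^-1 <= d.
  by rewrite -[leRHS]invrK lef_pV2 ?posrE ?invr_gt0// ltW// truncnS_gt.
have Nd : N%:R <= d^-1 + 1 by rewrite -natr1 lerD2r truncn_le// invr_ge0 ltW.
(* A point of the cone with parameter [t] is within [d] of the point with the same parameter on the
   segment towards [a0], which is within 1/N <= d of some [Y k]. *)
pose Y (k : nat) := x + (k%:R / N%:R) *: (a0 - x).
apply: (@le_trans _ _ (mu (\big[setU/set0]_(k < N.+1) cube (Y k) (2 * d)))).
  apply: le_lebesgue => _ [a [t [Aa /andP[t0 t1] ->]]].
  pose k := Num.truncn (t * N%:R).
  have tN0 : 0 <= t * N%:R by rewrite mulr_ge0.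
  have ktN : k%:R <= t * N%:R by rewrite /k truncn_le.
  have tNk : t * N%:R < k%:R + 1 by rewrite natr1 truncnS_gt.
  have kN : (k < N.+1)%N.
    by rewrite ltnS -(ler_nat R) (le_trans ktN)// ler_piMl.
  rewrite -bigcup_seq; exists (Ordinal kN) => //=; first by rewrite mem_index_enum.
  rewrite /cube/= /Y.
  rewrite (_ : _ - _ = t *: (a - a0) + (t - k%:R / N%:R) *: (a0 - x)); last first.
    by apply/rowP => i; rewrite !mxE; ring.
  rewrite (le_trans (ler_normD _ _))// (_ : 2 * d = d + d) ?lerD ?normrZ//; last by ring.
    rewrite (ger0_norm t0) -[leRHS]mul1r ler_pM//.
    by rewrite (le_trans (norm_le_enorm _))// Ad.
  rewrite -[leRHS]mulr1 ler_pM//.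
    rewrite ler_distl; apply/andP; split.
      have : k%:R / N%:R <= t by rewrite ler_pdivrMr.
      by move: d0; lra.
    rewrite (@le_trans _ _ (k%:R / N%:R + N%:R^-1))//; last by rewrite lerD2l.
    by rewrite -[X in _ + X]mul1r -mulrDl ler_pdivlMr// ltW.
  by rewrite (le_trans (norm_le_enorm _))// (Ax _ Aa0).
apply: le_trans (outer_measure_subadditive
  (@lebesgue_outer R n.+1 : {outer_measure set 'rV[R]_n.+1 -> \bar R})
  (fun k => cube (Y k) (2 * d)) N.+1) _.
have d20 : 0 < 2 * d by rewrite mulr_gt0.
rewrite (eq_bigr (fun=> ((2 * d) ^+ n.+1 * unit_cube_volume R n.+1)%:E)); last first.
  by move=> k _; exact: (lebesgue_cube (Y k) d20).
rewrite sumEFin lee_fin big_const_ord iter_addr_0 -[leLHS]mulr_natr.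
have -> : (2 * d) ^+ n.+1 * unit_cube_volume R n.+1 * N.+1%:R =
    2 ^+ n.+1 * unit_cube_volume R n.+1 * d ^+ n * (d * (N%:R + 1)).
  by rewrite -(natr1 N) exprMn (exprSr d); ring.
have -> : K * d ^+ n = 2 ^+ n.+1 * unit_cube_volume R n.+1 * d ^+ n * 3.
  by rewrite /K; ring.
apply: ler_wpM2l; first by rewrite !mulr_ge0 ?exprn_ge0// ltW.
have : d * N%:R <= 1 + d.
  by apply: (le_trans (ler_wpM2l (ltW d0) Nd)); rewrite mulrDr mulfV ?gt_eqF// mulr1.
by rewrite mulrDr mulr1; lra.
Qed.

Lemma ediam_le1 A : (ediam A <= 1)%E ->
  exists d, [/\ ediam A = d%:E, 0 <= d <= 1 &
    forall a b, A a -> A b -> enorm (a - b) <= d].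
Proof.
move=> A1; have A0 : (0 <= ediam A)%E by apply: ereal_sup_ubound; left.
have fn : ediam A \is a fin_num by rewrite ge0_fin_numE// (le_lt_trans A1)// ltry.
exists (fine (ediam A)); split; first by rewrite fineK.
  by rewrite fine_ge0//= -lee_fin fineK.
move=> a b Aa Ab; rewrite -lee_fin fineK//; apply: ereal_sup_ubound; right.
by exists a => //; exists b.
Qed.

Lemma unit_cone_gauge : (1 <= n)%N -> exists2 k : R, 0 < k & forall x A,
  (ediam A <= 1)%E ->
  (mu (unit_cone x (A `&` esphere x 1)) <= k%:E * hausdorff_gauge n A)%E.
Proof.
move=> n1; have [b b0 bE] := ball_volume_gt0.
have K0 : 0 < K by rewrite !mulr_gt0 ?exprn_gt0//; exact: cube0_volume.2.
exists (K * 2 ^+ n / b); first by rewrite divr_gt0// mulr_gt0// exprn_gt0.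
move=> x A /ediam_le1[d [dE /andP[d0 d1] Ad]]; rewrite /hausdorff_gauge.
case: ifPn => [/eqP ->|_].
  rewrite set0I mule0 (_ : unit_cone x set0 = set0) ?measure0//.
  by rewrite predeqE => y; split => // -[a [t []]].
have -> : ((K * 2 ^+ n / b)%:E * (ball_volume n * (2^-1%:E * ediam A) ^+ n) =
    (K * d ^+ n)%:E)%E.
  rewrite bE dE -EFinM -EFin_expe -!EFinM; congr EFin.
  have n2 : (2 : R) ^+ n != 0 by rewrite expf_neq0// pnatr_eq0.
  by rewrite exprMn exprVn; field; rewrite n2 gt_eqF.
have AS : A `&` esphere x 1 `<=` esphere x 1 by exact: subIsetr.
have Ad' e : d <= e -> forall a c, (A `&` esphere x 1) a ->
    (A `&` esphere x 1) c -> enorm (a - c) <= e.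
  by move=> de a c [Aa _] [Ac _]; rewrite (le_trans _ de)// Ad.
(* A set of diameter 0 has gauge 0 since n >= 1. Its cone is at most a segment, bounded through
   [unit_cone_volume] with arbitrarily small positive diameters. *)
have [d00|dn0] := eqVneq d 0; last first.
  by apply: unit_cone_volume => //; [rewrite lt_neqAle eq_sym dn0 d0|exact: Ad'].
rewrite d00 expr0n (gtn_eqF n1) mulr0; apply/lee_addgt0Pr => e e0; rewrite add0e.
pose t := Num.min 1 (e / K).
have t0 : 0 < t by rewrite lt_min ltr01 divr_gt0.
have t1 : t <= 1 by rewrite ge_min lexx.
apply: (@le_trans _ _ (K * t ^+ n)%:E).
  by apply: unit_cone_volume => //; [rewrite t0|apply: Ad'; rewrite d00 ltW].
rewrite lee_fin -ler_pdivlMl// mulrC; apply: (@le_trans _ _ t); last first.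
  by rewrite ge_min lexx orbT.
by rewrite -[leRHS]expr1 ler_wiXn2l// ltW.
Qed.

(** Covers by sets of diameter at most 1 suffice, because Hausdorff measure is the supremum over all
    scales. *)
Lemma hausdorff_measure_unit_cone : (1 <= n)%N -> exists2 k : R, 0 < k &
  forall x T, T `<=` esphere x 1 ->
  (mu (unit_cone x T) <= k%:E * hausdorff_measure n T)%E.
Proof.
move=> n1; have [k k0 kP] := unit_cone_gauge n1; exists k => // x T TS.
apply: (@le_trans _ _ (k%:E * hausdorff_premeasure n 1 T)%E); last first.
  apply: lee_wpmul2l; first by rewrite lee_fin ltW.
  by apply: ereal_sup_ubound; exists 1 => //; exact: ltr01.
rewrite -lee_pdivrMl//; apply: le_ereal_inf_tmp => _ [A [TA A1] <-].
rewrite lee_pdivrMl// -nneseriesZl; last first.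
  move=> i _; rewrite /hausdorff_gauge; case: ifP => // _.
  rewrite mule_ge0// ?measure_ge0// expe_ge0// mule_ge0//.
  by apply: ereal_sup_ubound; left.
apply: (@le_trans _ _ (\sum_(i <oo) mu (unit_cone x (A i `&` esphere x 1)))%E); last first.
  by apply: lee_nneseries => // i _; exact: kP.
apply: le_trans (outer_measure_sigma_subadditive
  (@lebesgue_outer R n.+1 : {outer_measure set 'rV[R]_n.+1 -> \bar R}) _).
apply: le_lebesgue => _ [a [t [Ta t01 ->]]].
by have [i _ Aia] := TA _ Ta; exists i => //; exists a, t; split => //; split => //; exact: TS.
Qed.

(** Radial projection from [x] sends interior points of [C] to the sphere inside the interior of the
    tangent cone; the boundary of [C] has no volume. *)
Lemma solid_angle_ge : (1 <= n)%N -> exists2 k : R, 0 < k &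
  forall C x, convex_body C -> boundary C x ->
  (mu (C `&` ecball x 1) <= k%:E * solid_angle (tangent_cone C x) x)%E.
Proof.
move=> n1; have [k k0 kP] := hausdorff_measure_unit_cone n1; exists k => //.
move=> C x [clC cC C0] [_ nCx].
apply: (@le_trans _ _ (mu (C° `&` ecball x 1))).
  apply: (@le_trans _ _ (mu ((C° `&` ecball x 1) `|` (C `\` C°)))).
    apply: le_lebesgue => y [Cy yx].
    by have [Ciy|nCiy] := pselect (C° y); [left|right].
  apply: (le_trans (outer_measureU2
    (@lebesgue_outer R n.+1 : {outer_measure set 'rV[R]_n.+1 -> \bar R}) _ _)).
  by rewrite [X in (_ + X)%E](convex_boundary_null clC cC C0) adde0.
apply: le_trans (kP x _ (@subIsetl _ _ _)); apply: le_lebesgue => y [Ciy yx].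
have xy : 0 < enorm (y - x).
  rewrite lt_neqAle enorm_ge0 andbT; apply/eqP => /esym/enorm_eq0/eqP.
  by rewrite subr_eq0 => /eqP yx'; apply: nCx; rewrite -yx'.
pose t := enorm (y - x); pose a := x + t^-1 *: (y - x).
exists a, t; split.
- split.
    rewrite /esphere/= /a addrAC subrr add0r enormZ ger0_norm ?invr_ge0 ?ltW//.
    by rewrite mulVf// gt_eqF.
  (* The dilation about [x] taking [y] to [a] takes a cube of [C] around [y] to a cube of the
     tangent cone around [a]. *)
  have [r r0 yC] := interior_cube Ciy.
  apply: (@cube_interior _ _ _ _ (t^-1 * r)); first by rewrite mulr_gt0// invr_gt0.
  rewrite -[a]/(x + _) => z za; apply: subset_closure.
  exists t^-1; first by rewrite /= invr_gt0.
  exists (x + t *: (z - x)); last first.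
    by apply/rowP => i; rewrite !mxE; field; rewrite gt_eqF.
  apply: yC; rewrite /cube/=.
  rewrite (_ : _ - y = t *: (z - a)); last first.
    by apply/rowP => i; rewrite !mxE; field; rewrite gt_eqF.
  by rewrite normrZ gtr0_norm// -ler_pdivlMl.
- by rewrite ltW.
- by rewrite /a addrAC subrr add0r scalerA divff ?gt_eqF// scale1r addrC subrK.
Qed.

Lemma unif_solid_angle C : (1 <= n)%N -> convex_body C -> unif C ->
  (0 < ereal_inf [set solid_angle (tangent_cone C x) x | x in boundary C])%E.
Proof.
move=> n1 bC uC; have [clC cC _] := bC.
have [k k0 kP] := solid_angle_ge n1.
have s0 : 0 < n.+1%:R^-1 :> R by rewrite invr_gt0.
have [c c0 hc] := unif_all cC uC s0.
apply: (@lt_le_trans _ _ (c / k)%:E); first by rewrite lte_fin divr_gt0.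
apply: le_ereal_inf_tmp => _ [x Bx <-].
have Cx : C x by case: Bx; rewrite -(closure_id C).1.
rewrite mulrC EFinM lee_pdivrMl//; apply: le_trans (kP C x bC Bx).
apply: le_trans (hc x Cx) _; apply: le_lebesgue; apply: setIS.
apply: subset_trans (@cube_sub_ecball _ _ _ _) _.
by rewrite divff.
Qed.

End solid_angle_lower_bound.

(** * Perimeter of truncated convex sets *)

Section directional_derivatives.
Context {R : realType} {m : nat}.
Implicit Types (x y h v : 'rV[R]_m) (f g : 'rV[R]_m -> R) (S : set 'rV[R]_m).

Lemma is_derive_line f y h s l : is_derive (y + s *: h) h f l ->
  is_derive s 1 (fun s => f (y + s *: h)) l.
Proof.
have E : (fun t : R => t^-1 *: (((fun s => f (y + s *: h)) \o shift s) (t *: 1) -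
      f (y + s *: h))) =
    (fun t : R => t^-1 *: ((f \o shift (y + s *: h)) (t *: h) - f (y + s *: h))).
  apply/funext => t /=; congr (_ *: (f _ - _)).
  by apply/rowP => i; rewrite !mxE/= /GRing.scale/= mulr1; ring.
by move=> [ex <-]; split; rewrite /derivable /derive /= E.
Qed.

Lemma continuous_near_le f x e : continuous f -> 0 < e ->
  exists2 d, 0 < d & forall y, `|x - y| < d -> `|f x - f y| < e.
Proof.
move=> cf e0; have /cvgrPdist_lt/(_ _ e0)/nbhs_ballP[d /= d0 H] := cf x.
by exists d => // y xy; apply: H; rewrite -ball_normE.
Qed.

Lemma compact_support_bounded f S : continuous f -> compact S ->
  (forall y, ~ S y -> f y = 0) -> exists2 M, 0 <= M & forall y, `|f y| <= M.
Proof.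
move=> cf cS f0.
have cfS : compact (f @` S).
  by apply: continuous_compact => //; exact: continuous_subspaceT.
have [M [_ HM]] := compact_bounded cfS.
exists (`|M| + 1); first by rewrite addr_ge0.
move=> y; have [Sy|/f0->] := pselect (S y); last by rewrite normr0 addr_ge0.
by apply: HM; [rewrite ltr_pwDr// ler_norm|exists y].
Qed.

Lemma compact_support_uniform f S h e : continuous f -> compact S ->
  (forall y, ~ S y -> f y = 0) -> 0 < e ->
  exists2 d, 0 < d & forall y s, `|s| < d -> `|f (y + s *: h) - f y| <= e.
Proof.
move=> cf /compact_near_coveringP nc f0 e0.
have H1 : \forall s \near (0 : R), S `<=` (fun y => `|f (y + s *: h) - f y| <= e).
  apply: (nc R (nbhs (0 : R)) (fun s y => `|f (y + s *: h) - f y| <= e)) => x Sx.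
  have e2 : 0 < e / 2 by rewrite divr_gt0.
  have [d d0 hd] := continuous_near_le x cf e2.
  have d2 : 0 < d / 2 by rewrite divr_gt0.
  have h1 : 0 < `|h| + 1 by rewrite ltr_wpDl.
  exists ([set y | `|x - y| < d / 2], [set s : R | `|s| < d / 2 / (`|h| + 1)]).
    split; first by apply/nbhs_ballP; exists (d / 2) => // z; rewrite -ball_normE.
    apply/nbhs_ballP; exists (d / 2 / (`|h| + 1)); first by rewrite /= divr_gt0.
    by move=> z; rewrite -ball_normE/= sub0r normrN.
  move=> [y s] /= [xy sd].
  have sh : `|s *: h| < d / 2.
    rewrite normrZ; apply: le_lt_trans (_ : `|s| * (`|h| + 1) < _).
      by rewrite ler_wpM2l// lerDl.
    by rewrite -ltr_pdivlMr.
  have A1 := hd y (lt_trans xy (_ : d / 2 < d)).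
  have A2 : `|f x - f (y + s *: h)| < e / 2.
    apply: hd; rewrite opprD addrA (le_lt_trans (ler_normB _ _))//.
    by move: xy sh; lra.
  have := ler_normB (f x - f y) (f x - f (y + s *: h)).
  have -> : f x - f y - (f x - f (y + s *: h)) = f (y + s *: h) - f y by ring.
  have : `|f x - f y| < e / 2 by apply: A1; lra.
  by lra.
have /nbhs_ballP[d /= d0 H2] := H1.
have H3 y s : S y -> `|s| < d -> `|f (y + s *: h) - f y| <= e.
  by move=> Sy sd; apply: (H2 s) => //; rewrite -ball_normE/= sub0r normrN.
exists d => // y s sd.
have [Sy|nSy] := pselect (S y); first exact: H3.
have [Sys|nSys] := pselect (S (y + s *: h)); last first.
  by rewrite !f0// subrr normr0 ltW.
have := H3 _ (- s) Sys; rewrite normrN => /(_ sd).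
by rewrite scaleNr addrK distrC.
Qed.

(** The mean value theorem on each line gives f(y + t h) - f(y) = t g(y + c h) with c <= t, and [g]
    is uniformly continuous because of its compact support. *)
Lemma uniform_difference_quotient f g S h e : continuous g -> compact S ->
  (forall y, ~ S y -> g y = 0) -> (forall y, is_derive y h f (g y)) -> 0 < e ->
  exists2 d, 0 < d & forall y t, 0 < t < d ->
    `|f (y + t *: h) - f y - t * g y| <= e * t.
Proof.
move=> cg cS g0 fg e0; have [d d0 hd] := compact_support_uniform h cg cS g0 e0.
exists d => // y t /andP[t0 td].
have D (s : R) : is_derive s (1 : R) (fun s => f (y + s *: h)) (g (y + s *: h)).
  exact: is_derive_line.
have [|c c0t] := @MVT_segment R (fun s => f (y + s *: h))
    (fun s => g (y + s *: h)) 0 t (ltW t0) (fun s _ => D s).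
  by apply: derivable_within_continuous => s _; have [] := D s.
rewrite subr0 scale0r addr0 => ->; rewrite mulrC -mulrBr normrM (gtr0_norm t0) mulrC.
rewrite ler_pM2r//; apply: hd.
by move: c0t; rewrite in_itv/= => /andP[c0 ct]; rewrite ger0_norm// (le_lt_trans ct).
Qed.

End directional_derivatives.

Section lebesgue_integrals.
Context {R : realType} {m : nat}.
Notation mu := (@lebesgue R m).
Implicit Types (f : 'rV[R]_m -> R) (A B D : set (@lebesgue_space R m)).

Lemma bounded_continuous_integrable f A M : continuous f ->
  (forall x, `|f x| <= M) -> measurable A -> (mu A < +oo)%E ->
  mu.-integrable A (EFin \o f).
Proof.
move=> cf fM mA Afin; apply: measurable_bounded_integrable => //.
  by apply: measurable_funTS; exact: continuous_lebesgue_measurable.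
exists M; split; first exact: num_real.
by move=> t Mt x _ /=; rewrite (le_trans (fM x))// ltW.
Qed.

Lemma Rintegral_translate f A M (v : 'rV[R]_m) : continuous f ->
  (forall x, `|f x| <= M) -> measurable A -> (mu A < +oo)%E ->
  \int[mu]_(x in A) f (v + x) = \int[mu]_(x in [set v + x | x in A]) f x.
Proof.
move=> cf fM mA Afin.
pose phi (x : lebesgue_space m) : lebesgue_space m := v + (x : 'rV[R]_m).
have imE B : [set v + x | x in B] = (fun x => - v + x) @^-1` B.
  rewrite predeqE => x; split => [[y By <-]|Bx]; first by rewrite /= addKr.
  by exists (- v + x) => //; rewrite addNKr.
have preE B : phi @^-1` B = [set - v + x | x in B].
  rewrite predeqE => x; split => [Bx|[y By <-]]; last by rewrite /= /phi addNKr.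
  by exists (v + x) => //; rewrite addKr.
have mphi : measurable_fun setT phi.
  by move=> _ B mB; rewrite setTI preE; exact: measurable_translate.
have mf : measurable_fun [set: lebesgue_space m] (EFin \o f).
  by apply/measurable_EFinP; exact: continuous_lebesgue_measurable.
have mvA : measurable ([set v + x | x in A] : set (lebesgue_space m)).
  exact: measurable_translate.
have preA : phi @^-1` [set v + x | x in A] = A.
  by rewrite predeqE => x; split => [[y Ay /addrI <-]|Ax]//; exists x.
have cfv : continuous (fun x => f (v + x)).
  move=> x; apply: continuous_comp (cf (v + x)).
  by apply: (@cvgD R _ _ (nbhs x) _ (fun=> v) id); [exact: cvg_cst|exact: cvg_id].
have intf : mu.-integrable (phi @^-1` [set v + x | x in A]) ((EFin \o f) \o phi).
  rewrite preA.
  exact: (@bounded_continuous_integrable (fun x => f (v + x)) A M).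
have := integral_pushforward mphi mf intf mvA.
rewrite preA /Rintegral => <-; congr fine.
apply: eq_measure_integral => B mB _.
have E : mu (phi @^-1` B) = mu B by rewrite preE lebesgue_translate.
exact: E.
Qed.

Lemma Rintegral_norm_le f A D M : continuous f -> (forall x, `|f x| <= M) ->
  measurable A -> (mu A < +oo)%E -> measurable D -> (mu D < +oo)%E ->
  (forall x, A x -> f x != 0 -> D x) ->
  `|\int[mu]_(x in A) f x| <= M * fine (mu D).
Proof.
move=> cf fM mA Afin mD Dfin AD.
have M0 : 0 <= M by exact: le_trans (fM 0).
have mAD : measurable (A `&` D) by exact: measurableI.
have iA B : measurable B -> B `<=` A -> mu.-integrable B (EFin \o f).
  move=> mB BA; apply: (@bounded_continuous_integrable f B M) => //.
  by apply: le_lt_trans Afin; exact: le_lebesgue.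
have -> : \int[mu]_(x in A) f x = \int[mu]_(x in A `&` D) f x.
  rewrite -[in LHS](setUIDK A D) Rintegral_setU//.
  - rewrite [X in _ + X](_ : _ = 0) ?addr0//.
    rewrite (@eq_Rintegral _ _ _ _ _ (fun=> 0)); first by rewrite Rintegral_cst ?mul0r//; exact: measurableD.
    move=> x /set_mem[Ax nDx]; apply/eqP; apply: contraTT isT => fx.
    by have := nDx (AD x Ax fx).
  - exact: measurableD.
  - by rewrite setUIDK; exact: iA.
  - by apply/disj_setPS => x [[_ Dx] [_]].
have iAD : mu.-integrable (A `&` D) (EFin \o f) by apply: iA => //; exact: subIsetl.
have ADfin : (mu (A `&` D) < +oo)%E.
  by apply: le_lt_trans Dfin; apply: le_lebesgue; exact: subIsetr.
apply: (le_trans (le_normr_Rintegral mAD iAD)).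
apply: (@le_trans _ _ (\int[mu]_(x in A `&` D) M)).
  apply: le_Rintegral => //.
  - exact: (integrable_norm iAD).
  - by apply: (@bounded_continuous_integrable (fun=> M) _ `|M|) => //; exact: cst_continuous.
rewrite Rintegral_cst// ler_wpM2l// fine_le//.
- by rewrite ge0_fin_numE.
- by rewrite ge0_fin_numE.
- by apply: le_lebesgue; exact: subIsetr.
Qed.

Lemma Rintegral_sub_le f A B D M : continuous f -> (forall x, `|f x| <= M) ->
  measurable A -> (mu A < +oo)%E -> measurable B -> (mu B < +oo)%E ->
  measurable D -> (mu D < +oo)%E ->
  (forall x, A x -> ~ B x -> f x != 0 -> D x) ->
  (forall x, B x -> ~ A x -> f x != 0 -> D x) ->
  `|\int[mu]_(x in A) f x - \int[mu]_(x in B) f x| <= 2 * M * fine (mu D).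
Proof.
move=> cf fM mA Afin mB Bfin mD Dfin AD BD.
have int_split E F : measurable E -> (mu E < +oo)%E -> measurable F ->
    \int[mu]_(x in E) f x = \int[mu]_(x in E `&` F) f x + \int[mu]_(x in E `\` F) f x.
  move=> mE Efin mF; rewrite -[in LHS](setUIDK E F) Rintegral_setU//.
  - exact: measurableI.
  - exact: measurableD.
  - by rewrite setUIDK; exact: bounded_continuous_integrable fM mE Efin.
  - by apply/disj_setPS => x [[_ Fx] [_]].
rewrite (int_split A B)// (int_split B A)// [B `&` A]setIC.
rewrite opprD addrACA subrr add0r (le_trans (ler_normB _ _))//.
have dfin E F : (mu E < +oo)%E -> (mu (E `\` F) < +oo)%E.
  by move=> Efin; apply: le_lt_trans Efin; apply: le_lebesgue; exact: subDsetl.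
rewrite -mulrA mulr_natl mulr2n lerD//.
  apply: Rintegral_norm_le => //; [exact: measurableD|exact: dfin|].
  by move=> x [Ax nBx]; exact: AD.
apply: Rintegral_norm_le => //; [exact: measurableD|exact: dfin|].
by move=> x [Bx nAx]; exact: BD.
Qed.

End lebesgue_integrals.

(** * Upper bound for the perimeter of cube truncations *)

Section perimeter_of_truncations.
Context {R : realType} {m : nat}.
Notation mu := (@lebesgue R m).
Implicit Types (xi : 'rV[R]_m -> 'rV[R]_m) (C E : set 'rV[R]_m) (x : 'rV[R]_m).

Lemma divergenceE xi x : differentiable xi x ->
  divergence xi x = \sum_i partial i xi x ord0 i.
Proof.
move=> dxi; rewrite /divergence /mxtrace; apply: eq_bigr => i _.
have -> : partial i xi x = row i ('J xi x) by rewrite rowE /partial deriveEjacobian.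
by rewrite [RHS]mxE.
Qed.

Lemma is_derive_coord xi x h i l : is_derive x h xi l ->
  is_derive x h (fun y => xi y ord0 i) (l ord0 i).
Proof.
move=> [dx <-].
have cv : (fun t => t^-1 *: ((xi \o shift x) (t *: h) - xi x)) t @[t --> 0^']
    --> 'D_h xi x by [].
have cvi : (fun t => t^-1 *: ((xi \o shift x) (t *: h) - xi x)) t ord0 i
    @[t --> 0^'] --> ('D_h xi x) ord0 i.
  apply: (@cvg_comp _ _ _ _ (fun M : 'rV[R]_m => M ord0 i) _ _ _ cv).
  exact: coord_continuous.
have E : (fun t : R => t^-1 *: (((fun y => xi y ord0 i) \o shift x) (t *: h) -
      xi x ord0 i)) =
    (fun t => (t^-1 *: ((xi \o shift x) (t *: h) - xi x)) ord0 i).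
  by apply/funext => t; rewrite !mxE.
split; first by apply/cvg_ex; exists ('D_h xi x ord0 i); rewrite E.
by rewrite /derive E; apply: cvg_lim.
Qed.

Lemma partial_outside_support i xi x : ~ field_support xi x -> partial i xi x = 0.
Proof.
move=> nx; rewrite /partial -(@derive_cst _ _ _ 0 x (delta_mx ord0 i)).
apply: near_eq_derive.
have : nbhs x (~` field_support xi).
  apply: open_nbhs_nbhs; split => //.
  by apply: closed_openC; exact: closed_closure.
apply: filterS => y ny; apply/eqP; apply: contraPT ny => xiy.
by move=> ny'; apply: ny'; exact: (@subset_closure _ [set y | xi y != 0] y xiy).
Qed.

Lemma compact_translate_subset (S U : set 'rV[R]_m) h : compact S -> open U ->
  S `<=` U -> exists2 d, 0 < d & forall y t, S y -> `|t| < d -> U (y + t *: h).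
Proof.
move=> /compact_near_coveringP nc oU SU.
have H1 : \forall s \near (0 : R), S `<=` (fun y => U (y + s *: h)).
  apply: (nc R (nbhs (0 : R)) (fun s y => U (y + s *: h))) => x Sx.
  have /nbhs_ballP[d /= d0 dU] := open_nbhs_nbhs (conj oU (SU _ Sx)).
  have h1 : 0 < `|h| + 1 by rewrite ltr_wpDl.
  have d2 : 0 < d / 2 by rewrite divr_gt0.
  exists ([set y | `|x - y| < d / 2], [set s : R | `|s| < d / 2 / (`|h| + 1)]).
    split; first by apply/nbhs_ballP; exists (d / 2) => // z; rewrite -ball_normE.
    apply/nbhs_ballP; exists (d / 2 / (`|h| + 1)); first by rewrite /= divr_gt0.
    by move=> z; rewrite -ball_normE/= sub0r normrN.
  move=> [y s] /= [xy sd]; apply: dU; rewrite -ball_normE/=.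
  have sh : `|s *: h| < d / 2.
    rewrite normrZ; apply: le_lt_trans (_ : `|s| * (`|h| + 1) < _).
      by rewrite ler_wpM2l// lerDl.
    by rewrite -ltr_pdivlMr.
  rewrite opprD addrA (le_lt_trans (ler_normB _ _))//.
  by move: xy sh; lra.
have /nbhs_ballP[d /= d0 H2] := H1.
exists d => // y t Sy td; apply: (H2 t) => //.
by rewrite -ball_normE/= sub0r normrN.
Qed.

Lemma smooth_partial_data xi i : smooth xi -> compact (field_support xi) ->
  [/\ continuous (fun x => xi x ord0 i),
      continuous (fun x => partial i xi x ord0 i),
      forall x, is_derive x (delta_mx ord0 i) (fun y => xi y ord0 i)
        (partial i xi x ord0 i) &
      forall x, ~ field_support xi x -> partial i xi x ord0 i = 0].
Proof.
move=> sxi cS; split.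
- move=> x; apply: (@continuous_comp _ _ _ xi (fun z => z ord0 i)).
    exact: differentiable_continuous (sxi [::] x).
  exact: coord_continuous.
- move=> x; apply: (@continuous_comp _ _ _ (partial i xi) (fun z => z ord0 i)).
    exact: differentiable_continuous (sxi [:: i] x).
  exact: coord_continuous.
- move=> x; apply: is_derive_coord; apply: DeriveDef => //.
  exact: diff_derivable (sxi [::] x).
- by move=> x nx; rewrite partial_outside_support// mxE.
Qed.

Lemma bernoulli_upper (u : R) k : 0 <= u <= 1 -> (1 + u) ^+ k <= 1 + 3 ^+ k * u.
Proof.
move=> /andP[u0 u1]; elim: k => [|k IH]; first by rewrite !expr0 mul1r lerDl.
rewrite !exprS; apply: (le_trans (ler_wpM2l _ IH)); first by lra.
have : 1 <= 3 ^+ k :> R by rewrite exprn_ege1// ler1n.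
set v := 3 ^+ k => v1.
have : 0 <= v * u * (1 - u) by rewrite !mulr_ge0 ?subr_ge0// (le_trans _ v1).
have : 0 <= (v - 1) * u by rewrite mulr_ge0 ?subr_ge0.
by nra.
Qed.

Lemma bernoulli_lower (u : R) k : 0 <= u <= 1 -> 1 - 3 ^+ k * u <= (1 - u) ^+ k.
Proof.
move=> /andP[u0 u1]; elim: k => [|k IH]; first by rewrite !expr0 mul1r gerBl.
rewrite !exprS; apply: le_trans (ler_wpM2l _ IH); last by lra.
have : 1 <= 3 ^+ k :> R by rewrite exprn_ege1// ler1n.
by set v := 3 ^+ k; nra.
Qed.

Lemma cube_finite A x r : 0 < r -> (mu (A `&` cube x r) < +oo)%E.
Proof.
move=> r0; apply: (@le_lt_trans _ _ (mu (cube x r))).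
  by apply: le_lebesgue; exact: subIsetr.
by rewrite lebesgue_cube ?ltry.
Qed.

Lemma cube_ratio_fine C x r r' : convex_set C -> C x -> 0 < r <= r' ->
  fine (mu (C `&` cube x r')) <= (r' / r) ^+ m * fine (mu (C `&` cube x r)).
Proof.
move=> cC Cx rr'; have /andP[r0 r1] := rr'; have r'0 := lt_le_trans r0 r1.
rewrite -lee_fin EFinM !fineK ?ge0_fin_numE ?cube_finite//.
exact: convex_cube_ratio.
Qed.

(** Dilations about [x] bound the outer truncation by (1 + t/r)^m and the inner one below by (1 -
    t/r)^m times the truncation of radius [r]. Both powers are within 3^m t/r of 1. *)
Lemma annulus_volume C x r t : closed C -> convex_set C -> C x -> 0 < t < r ->
  fine (mu ((C `&` cube x (r + t)) `\` cube x (r - t))) <=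
  2 * 3 ^+ m * (t / r) * fine (mu (C `&` cube x r)).
Proof.
move=> clC cC Cx /andP[t0 tr]; have r0 := lt_trans t0 tr.
have mC : measurable (C : set (lebesgue_space m)) by exact: closed_lebesgue_measurable.
have rt0 : 0 < r + t by rewrite addr_gt0.
have rt1 : 0 < r - t by rewrite subr_gt0.
have mQ s : measurable (C `&` cube x s : set (lebesgue_space m)).
  by apply: measurableI => //; exact: measurable_cube.
have E : (mu (C `&` cube x (r + t)) = mu ((C `&` cube x (r + t)) `\` cube x (r - t)) +
    mu (C `&` cube x (r - t)))%E.
  rewrite (measureDI mu (mQ (r + t)) (measurable_cube x (r - t))); congr (_ + mu _)%E.
  rewrite predeqE => y; split => [[[Cy _] yr]|[Cy yr]]; first by split.
  split => //; split => //; move: yr; rewrite /cube/= => /le_trans; apply.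
  by rewrite lerD2l; lra.
have fin1 : mu ((C `&` cube x (r + t)) `\` cube x (r - t)) \is a fin_num.
  rewrite ge0_fin_numE//; apply: le_lt_trans (cube_finite C x rt0).
  by apply: le_lebesgue; exact: subDsetl.
have -> : fine (mu ((C `&` cube x (r + t)) `\` cube x (r - t))) =
    fine (mu (C `&` cube x (r + t))) - fine (mu (C `&` cube x (r - t))).
  by rewrite E fineD ?addrK// ge0_fin_numE// cube_finite.
set W := fine (mu (C `&` cube x r)).
have W0 : 0 <= W by exact: fine_ge0.
have u01 : 0 <= t / r <= 1.
  by rewrite divr_ge0 ?(ltW t0) ?(ltW r0)//= ler_pdivrMr// mul1r ltW.
have h1 : fine (mu (C `&` cube x (r + t))) <= (1 + t / r) ^+ m * W.
  have -> : 1 + t / r = (r + t) / r by field; rewrite gt_eqF.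
  by apply: cube_ratio_fine => //; rewrite r0 lerDl ltW.
have h2 : (1 - t / r) ^+ m * W <= fine (mu (C `&` cube x (r - t))).
  have -> : 1 - t / r = (r / (r - t))^-1 by rewrite invf_div mulrBl divff ?gt_eqF.
  rewrite exprVn -ler_pdivlMl ?invr_gt0 ?exprn_gt0 ?divr_gt0// invrK.
  by apply: cube_ratio_fine => //; rewrite rt1 gerBl ltW.
have := ler_wpM2r W0 (bernoulli_upper m u01).
have := ler_wpM2r W0 (bernoulli_lower m u01).
by move: h1 h2; set a := _ ^+ m; set b := (1 - _) ^+ m; set c := 3 ^+ m; nra.
Qed.

(** Each of the [m] partial derivatives contributes 4 3^m / r times the volume: a factor 2 from the
    annulus estimate and a factor 2 because the truncation and its translate differ in both
    directions. *)
Lemma perimeter_cube C x r : closed C -> convex_set C -> C x -> 0 < r ->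
  (perimeter C (C `&` cube x r) <=
    (m%:R * (4 * 3 ^+ m) / r * fine (mu (C `&` cube x r)))%:E)%E.
Proof.
move=> clC cC Cx r0.
have mC : measurable (C : set (lebesgue_space m)) by exact: closed_lebesgue_measurable.
pose E : set (lebesgue_space m) := C `&` cube x r.
have mE : measurable E by apply: measurableI => //; exact: measurable_cube.
have Efin : (mu E < +oo)%E by exact: cube_finite.
set W := fine (mu (C `&` cube x r)).
have W0 : 0 <= W by exact: fine_ge0.
apply: ge_ereal_sup => _ [xi [sxi cS SC xi1] <-].
have partial_int i : [/\ mu.-integrable E (EFin \o (fun x => partial i xi x ord0 i)) &
    \int[mu]_(x in E) partial i xi x ord0 i <= 4 * 3 ^+ m / r * W].
  have [cf cg fg g0] := smooth_partial_data i sxi cS.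
  set f := fun y => xi y ord0 i in cf fg *.
  set g := fun y => partial i xi y ord0 i in cg fg g0 *.
  have f1 y : `|f y| <= 1.
    exact: le_trans (row_norm_coord _ _) (le_trans (norm_le_enorm _) (xi1 y)).
  have f0 y : f y != 0 -> field_support xi y.
    move=> fy; apply: subset_closure; apply: contraNneq fy => /= xiy.
    by rewrite /f xiy mxE.
  have [M M0 gM] := compact_support_bounded cg cS g0.
  have ig : mu.-integrable E (EFin \o g) by exact: bounded_continuous_integrable gM mE Efin.
  split => //; apply/ler_addgt0Pr => e e0.
  (* Integrated over a set of volume [W], this error is at most [e]. *)
  have eW : 0 < e / (W + 1) by rewrite divr_gt0// ltr_wpDl.
  have [d d0 hd] := uniform_difference_quotient cg cS g0 fg eW.
  have [d' d'0 hd'] := compact_translate_subset (delta_mx ord0 i) cS (@open_interior _ C) SC.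
  pose t := Num.min (r / 2) (Num.min (d / 2) (d' / 2)).
  have t0 : 0 < t by rewrite !lt_min !divr_gt0.
  have [tr td td'] : [/\ t < r, t < d & t < d'].
    by rewrite /t !gt_min; split; apply/orP; [left|right;apply/orP;left|right;apply/orP;right]; lra.
  pose v : 'rV[R]_m := t *: delta_mx ord0 i.
  have vt : `|v| <= t.
    rewrite /v normrZ gtr0_norm// ler_piMr ?(ltW t0)//.
    apply/row_norm_leP; first exact: ler01.
    by move=> k; rewrite mxE; case: (_ && _); rewrite ?normr1// normr0 ler01.
  pose D : set (lebesgue_space m) := (C `&` cube x (r + t)) `\` cube x (r - t).
  have rt0 : 0 < r + t by rewrite addr_gt0.
  have mD : measurable D.
    by apply: measurableD; [apply: measurableI => //|]; exact: measurable_cube.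
  have Dfin : (mu D < +oo)%E.
    apply: le_lt_trans (cube_finite C x rt0).
    by apply: le_lebesgue; exact: subDsetl.
  have DW : fine (mu D) <= 2 * 3 ^+ m * (t / r) * W.
    by apply: annulus_volume => //; rewrite t0.
  have mvE : measurable ([set v + y | y in E] : set (lebesgue_space m)).
    exact: measurable_translate.
  have vEfin : (mu [set v + y | y in E]%R < +oo)%E by rewrite lebesgue_translate.
  (* Small translations of the support stay in [C°], so the boundary of [C] never separates the set
     from its translate where [f] is nonzero; only the faces of the cube do. *)
  have SCy y : f y != 0 -> C y /\ C (y - v).
    move=> /f0 Sy; split; first by apply: interior_subset; exact: SC.
    apply: interior_subset; have := hd' y (- t) Sy; rewrite scaleNr; apply.
    by rewrite normrN gtr0_norm.
  have shift_le : \int[mu]_(y in E) f (v + y) - \int[mu]_(y in E) f y <=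
      2 * 1 * fine (mu D).
    rewrite (Rintegral_translate _ cf f1 mE Efin).
    apply: le_trans (ler_norm _) _; apply: Rintegral_sub_le => //.
      move=> y [z [Cz zx] <-] nE /SCy[Cy _]; split.
        split => //; rewrite /cube/= -addrA addrC (le_trans (ler_normD _ _))//.
        by rewrite lerD.
      move=> yx; apply: nE; split => //; move: yx; rewrite /cube/=.
      by move=> /le_trans; apply; rewrite gerBl ltW.
    move=> y [Cy yx] nE /SCy[_ Cyv]; split.
      split => //; move: yx; rewrite /cube/= => /le_trans; apply.
      by rewrite lerDl ltW.
    move=> yr; apply: nE; exists (y - v); last by rewrite addrC subrK.
    split => //; rewrite /cube/= addrAC (le_trans (ler_normB _ _))//.
    by move: yr vt; rewrite /cube/=; lra.
  have cfv : continuous (fun y => f (v + y)).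
    move=> y; apply: continuous_comp (cf (v + y)).
    by apply: (@cvgD R _ _ (nbhs y) _ (fun=> v) id); [exact: cvg_cst|exact: cvg_id].
  have if_ : mu.-integrable E (EFin \o f) by exact: bounded_continuous_integrable f1 mE Efin.
  have ifv : mu.-integrable E (EFin \o (fun y => f (v + y))).
    by apply: (@bounded_continuous_integrable _ _ _ _ 1).
  have ic (c : R) : mu.-integrable E (EFin \o (fun=> c)).
    by apply: (@bounded_continuous_integrable _ _ _ _ `|c|) => //; exact: cst_continuous.
  have tg : t * \int[mu]_(y in E) g y <=
      \int[mu]_(y in E) f (v + y) - \int[mu]_(y in E) f y + e / (W + 1) * t * W.
    rewrite -RintegralB// -[X in _ + X](Rintegral_cst mu mE) -RintegralD//; last first.
      exact: (integrableB mE ifv if_).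
    rewrite -RintegralZl//; apply: le_Rintegral => //.
    - exact: (integrableZl mE t ig).
    - exact: (integrableD mE (integrableB mE ifv if_) (ic _)).
    - move=> y Ey; have := hd y t; rewrite t0 => /(_ td); rewrite -/v (addrC y v).
      by rewrite ler_norml => /andP[+ _]; lra.
  have {}tg : t * \int[mu]_(y in E) g y <=
      t * (4 * 3 ^+ m / r * W) + e / (W + 1) * t * W.
    apply: (le_trans tg); rewrite lerD2r (le_trans shift_le)//.
    rewrite mulr1 (_ : t * _ = 2 * (2 * 3 ^+ m * (t / r) * W)); last by ring.
    by rewrite ler_wpM2l.
  have : e / (W + 1) * t * W <= t * e.
    rewrite mulrAC mulrC ler_wpM2l ?(ltW t0)// mulrAC ler_pdivrMr ?ltr_wpDl//.
    by rewrite ler_wpM2l ?(ltW e0)// lerDl.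
  move=> h; have := le_trans tg (_ : _ <= t * (4 * 3 ^+ m / r * W + e)).
  rewrite ler_pM2l//; apply; rewrite mulrDr lerD2l//.
have -> : (\int[mu]_(x in E) (divergence xi x)%:E =
    (\sum_i \int[mu]_(x in E) partial i xi x ord0 i)%:E)%E.
  rewrite (eq_integral (fun y : lebesgue_space m => (\sum_(i < m) (partial i xi y ord0 i)%:E)%E)).
    rewrite integral_sum//; last by move=> i; exact: (partial_int i).1.
    rewrite -sumEFin; apply: eq_bigr => i _.
    by rewrite fineK//; apply: integrable_fin_num => //; exact: (partial_int i).1.
  by move=> y _; rewrite divergenceE ?sumEFin//; exact: (sxi [::]).
rewrite lee_fin (le_trans (ler_sum _ (fun i _ => (partial_int i).2)))//.
rewrite sumr_const card_ord -[leLHS]mulr_natl le_eqVlt; apply/orP; left.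
by apply/eqP; ring.
Qed.

End perimeter_of_truncations.

(** * Smooth test functions and translations *)

Section smooth_bump.
Context {R : realType}.
Implicit Types (P Q : {poly R}) (t u : R).

(* [bump 1] is the flat function exp(-1/t); the polynomial in 1/t makes the
   family closed under differentiation. *)
Definition bump P t : R := if 0 < t then P.[t^-1] * expR (- t^-1) else 0.

Lemma horner_le_power Q : exists2 A, 0 <= A & forall u, 1 <= u ->
  `|Q.[u]| <= A * u ^+ size Q.
Proof.
exists (\sum_(i < size Q) `|Q`_i|); first by rewrite sumr_ge0.
move=> u u1; rewrite horner_coef mulr_suml (le_trans (ler_norm_sum _ _ _))//.
apply: ler_sum => i _; rewrite normrM ler_wpM2l// normrX ger0_norm ?(le_trans _ u1)//.
by rewrite ler_weXn2l// ltnW.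
Qed.

Lemma expR_ge_power k u : 0 <= u -> (u / k.+1%:R) ^+ k.+1 <= expR u.
Proof.
move=> u0; have -> : expR u = expR (u / k.+1%:R) ^+ k.+1.
  by rewrite -expRM_natl mulrC divfK// pnatr_eq0.
rewrite lerXn2r ?nnegrE ?expR_ge0 ?divr_ge0//.
by apply: le_trans (expR_ge1Dx _); rewrite lerDr.
Qed.

(** With u = 1/t, the exponential beats u^(k+1) up to a constant, while the polynomial is at most a
    multiple of u^k with k = [size Q]; the spare power leaves the factor [t]. *)
Lemma bump_bound Q : exists2 A, 0 <= A & forall t, 0 < t <= 1 ->
  `|Q.[t^-1] * expR (- t^-1)| <= A * t.
Proof.
have [A A0 HA] := horner_le_power Q.
pose k := size Q; exists (A * k.+1%:R ^+ k.+1).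
  by rewrite mulr_ge0// exprn_ge0.
move=> t /andP[t0 t1].
have [u tu1] : exists u, t * u = 1 by exists t^-1; rewrite divff// gt_eqF.
have -> : t^-1 = u by apply/(mulfI (lt0r_neq0 t0)); rewrite divff// gt_eqF.
have u0 : 0 < u by rewrite -(pmulr_rgt0 _ t0) tu1.
have u1 : 1 <= u by rewrite -tu1 ler_piMl// ltW.
rewrite normrM (ger0_norm (expR_ge0 _)) expRN ler_pdivrMr ?expR_gt0//.
apply: (le_trans (HA u u1)); rewrite -!mulrA ler_wpM2l//.
have E := ler_wpM2l (ltW t0) (expR_ge_power k (ltW u0)).
have K0 : 0 < k.+1%:R ^+ k.+1 :> R by rewrite exprn_gt0.
have := ler_wpM2l (ltW K0) E; apply: le_trans; rewrite le_eqVlt; apply/orP; left.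
apply/eqP; rewrite exprMn exprVn [u ^+ k.+1]exprS -/k mulrCA mulrA.
rewrite [t * _]mulrC -[_ * t * _]mulrA [t * _]mulrA [t * _]mulrA tu1 mul1r mulrCA.
by rewrite divff ?mulr1// gt_eqF.
Qed.

Lemma bump_ge0 t : 0 <= bump 1 t.
Proof. by rewrite /bump; case: ifP => // _; rewrite hornerC mul1r expR_ge0. Qed.

Lemma bump_le1 t : bump 1 t <= 1.
Proof.
rewrite /bump; case: ifP => // t0; rewrite hornerC mul1r.
by rewrite -expR0 ler_expR oppr_le0 invr_ge0 ltW.
Qed.

Lemma bump_gt0 t : (0 < bump 1 t) = (0 < t).
Proof.
by rewrite /bump; case: ifP => //; rewrite hornerC mul1r expR_gt0.
Qed.

(** For t > 0 this is the chain rule, with d/dt of P(1/t) exp(-1/t) equal to t^-2 (P - P')(1/t)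
    exp(-1/t). At 0 the difference quotient is the same kind of expression with polynomial X P, so
    [bump_bound] makes it tend to 0. *)
Lemma is_derive_bump P t :
  is_derive t (1 : R) (bump P) (bump ('X^2 * (P - P^`())) t).
Proof.
have [t0|t0|->] := ltgtP t 0.
- rewrite {2}/bump ltNge (ltW t0)/=.
  apply: (@near_eq_is_derive _ _ _ (cst 0)).
    near=> s; rewrite /bump ifN// -leNgt ltW//; near: s.
    exact: lt_nbhsl.
- rewrite {2}/bump t0.
  apply: (@near_eq_is_derive _ _ _ (fun s : R => P.[s^-1] * expR (- s^-1))).
    by near=> s; rewrite /bump ifT//; near: s; exact: lt_nbhsr.
  have tn0 : t != 0 by rewrite gt_eqF.
  have D1 : is_derive t (1 : R) (fun s : R => s^-1) (- t ^- 2).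
    have := is_deriveV (f := id) tn0 (is_derive_id t 1).
    by rewrite /GRing.scale/= mulr1.
  have D2 := is_derive1_comp (is_derive_poly P t^-1) D1.
  have D3 := is_derive1_comp (is_derive_expR _) (is_deriveN D1).
  have D := is_deriveM D2 D3; apply: (is_derive_eq D).
  rewrite !hornerE /GRing.scale/= exprVn.
  by change ((- [eta GRing.inv]) t) with (- t^-1); ring.
- have [A A0 HA] := bump_bound ('X * P).
  have Q0 : bump ('X^2 * (P - P^`())) 0 = 0 by rewrite /bump ltxx.
  have cv : (fun h : R => h^-1 *: ((bump P \o shift 0) (h *: 1) - bump P 0)) h
      @[h --> 0^'] --> (0 : R).
    apply/cvgrPdist_lt => e e0; near=> h; rewrite sub0r normrN /= [bump P 0]/bump ltxx.
    rewrite subr0 addr0 /GRing.scale/= mulr1 /bump; case: ifPn => h0; last first.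
      by rewrite mulr0 normr0.
    rewrite mulrA; have -> : h^-1 * P.[h^-1] = ('X * P).[h^-1] by rewrite hornerM hornerX.
    apply: (le_lt_trans (HA h _)).
      rewrite h0/=; apply: (le_trans (ler_norm _)); near: h.
      by apply: dnbhs0_le.
    apply: (@le_lt_trans _ _ ((A + 1) * `|h|)).
      by rewrite (ger0_norm (ltW h0)) ler_wpM2r ?lerDl// ltW.
    rewrite -ltr_pdivlMl ?ltr_wpDl//; near: h; apply: dnbhs0_lt.
    by rewrite mulr_gt0// invr_gt0 ltr_wpDl.
  rewrite Q0; split; first by apply/cvg_ex; exists 0.
  by rewrite /derive; exact: cvg_lim.
Unshelve. all: by end_near. Qed.

End smooth_bump.

Section smooth_functions.
Context {R : realType} {m : nat}.
Implicit Types (x h v : 'rV[R]_m) (f g : 'rV[R]_m -> R).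

(** A syntactic class closed under directional derivatives, so that one induction settles
    differentiability to all orders. *)
Inductive smooth_scalar : ('rV[R]_m -> R) -> Prop :=
| SmoothCst c : smooth_scalar (fun=> c)
| SmoothBump P b a i : smooth_scalar (fun x => bump P (b * x ord0 i + a))
| SmoothAdd f g : smooth_scalar f -> smooth_scalar g ->
    smooth_scalar (fun x => f x + g x)
| SmoothMul f g : smooth_scalar f -> smooth_scalar g ->
    smooth_scalar (fun x => f x * g x).

Lemma is_derive_of_line f x h l :
  is_derive (0 : R) (1 : R) (fun s => f (x + s *: h)) l -> is_derive x h f l.
Proof.
have E : (fun t : R => t^-1 *: (((fun s => f (x + s *: h)) \o shift 0) (t *: 1) -
      f (x + 0 *: h))) =
    (fun t : R => t^-1 *: ((f \o shift x) (t *: h) - f x)).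
  apply/funext => t /=; congr (_ *: (f _ - f _)).
    by apply/rowP => i; rewrite !mxE/= /GRing.scale/= mulr1; ring.
  by rewrite scale0r addr0.
by move=> [ex <-]; split; rewrite /derivable /derive -?E//.
Qed.

Lemma smooth_scalar_derive f h : smooth_scalar f ->
  exists2 g, smooth_scalar g & forall x, is_derive x h f (g x).
Proof.
elim=> {f} [c|P b a i|f1 f2 _ [g1 s1 d1] _ [g2 s2 d2]|f1 f2 S1 [g1 s1 d1] S2 [g2 s2 d2]].
- by exists (fun=> 0); [exact: SmoothCst|move=> x; exact: is_derive_cst].
- exists (fun x => (b * h ord0 i) * bump ('X^2 * (P - P^`())) (b * x ord0 i + a)).
    by apply: SmoothMul; [exact: (SmoothCst (b * h ord0 i))|exact: SmoothBump].
  move=> x; apply: is_derive_of_line.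
  have -> : (fun s => bump P (b * (x + s *: h) ord0 i + a)) =
      bump P \o (fun s : R => s * (b * h ord0 i) + (b * x ord0 i + a)).
    by apply/funext => s; rewrite /= !mxE; congr bump; ring.
  have D1 : is_derive (0 : R) (1 : R)
      (fun s : R => s * (b * h ord0 i) + (b * x ord0 i + a)) (b * h ord0 i).
    have D := is_deriveD (is_deriveM (is_derive_id (0 : R) (1 : R))
       (is_derive_cst (b * h ord0 i) (0 : R) (1 : R))) (is_derive_cst (b * x ord0 i + a) (0 : R) (1 : R)).
    by apply: (is_derive_eq D); rewrite /GRing.scale/=; ring.
  have E : 0 * (b * h ord0 i) + (b * x ord0 i + a) = b * x ord0 i + a by rewrite mul0r add0r.
  have Db := is_derive_bump P (0 * (b * h ord0 i) + (b * x ord0 i + a)).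
  have D := @is_derive1_comp R (bump P)
    (fun s : R => s * (b * h ord0 i) + (b * x ord0 i + a)) 0 _ _ Db D1.
  by apply: (is_derive_eq D); rewrite E mulrC.
- exists (fun x => g1 x + g2 x); first exact: SmoothAdd.
  by move=> x; have := d1 x; have := d2 x => *; exact: is_deriveD.
- exists (fun x => f1 x * g2 x + f2 x * g1 x).
    by apply: SmoothAdd; exact: SmoothMul.
  by move=> x; have := d1 x; have := d2 x => *; exact: is_deriveM.
Qed.

Lemma smooth_scalar_differentiable f x : smooth_scalar f -> differentiable f x.
Proof.
elim=> {f} [c|P b a i|f1 f2 _ d1 _ d2|f1 f2 _ d1 _ d2].
- exact: differentiable_cst.
- apply: (@differentiable_comp _ _ _ _ (fun x : 'rV[R]_m => b * x ord0 i + a) (bump P)).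
    apply: differentiableD; last exact: differentiable_cst.
    apply: differentiableM; first exact: differentiable_cst.
    exact: differentiable_coord.
  by apply/derivable1_diffP; have [] := is_derive_bump P (b * x ord0 i + a).
- exact: differentiableD.
- exact: differentiableM.
Qed.

Lemma smooth_scalar_continuous f : smooth_scalar f -> continuous f.
Proof.
by move=> sf x; apply: differentiable_continuous; exact: smooth_scalar_differentiable.
Qed.

Lemma smooth_scalar_translate f v : smooth_scalar f ->
  smooth_scalar (fun x => f (x + v)).
Proof.
elim=> {f} [c|P b a i|f1 f2 _ s1 _ s2|f1 f2 _ s1 _ s2].
- exact: SmoothCst.
- have := SmoothBump P b (b * v ord0 i + a) i; congr smooth_scalar.
  by apply/funext => x; rewrite mxE mulrDr addrA.
- exact: SmoothAdd.
- exact: SmoothMul.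
Qed.

Lemma smooth_scalar_prod (I : Type) (s : seq I) (F : I -> 'rV[R]_m -> R) :
  (forall i, smooth_scalar (F i)) -> smooth_scalar (fun x => \prod_(i <- s) F i x).
Proof.
move=> sF; elim: s => [|i s IH].
  have := SmoothCst 1; congr smooth_scalar.
  by apply/funext => x; rewrite big_nil.
have := SmoothMul (sF i) IH; congr smooth_scalar.
by apply/funext => x; rewrite big_cons.
Qed.

Lemma smooth_scalar_exp f k : smooth_scalar f -> smooth_scalar (fun x => f x ^+ k).
Proof.
move=> sf; elim: k => [|k IH].
  exact: (SmoothCst 1).
have := SmoothMul sf IH; congr smooth_scalar.
by apply/funext => x; rewrite exprS.
Qed.

Lemma smooth_scalar_onem f : smooth_scalar f -> smooth_scalar (fun x => 1 - f x).
Proof.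
move=> sf; have := SmoothAdd (SmoothCst 1) (SmoothMul (SmoothCst (-1)) sf).
by congr smooth_scalar; apply/funext => x; rewrite mulN1r.
Qed.

Lemma is_derive_scaler f h v x l : is_derive x h f l ->
  is_derive x h (fun y => f y *: v) (l *: v).
Proof.
move=> [df <-].
have cv : (fun t : R => t^-1 *: ((f \o shift x) (t *: h) - f x)) t @[t --> 0^']
    --> 'D_h f x by [].
have E : (fun t : R => t^-1 *: (((fun y => f y *: v) \o shift x) (t *: h) - f x *: v)) =
    (fun t => (t^-1 *: ((f \o shift x) (t *: h) - f x)) *: v).
  by apply/funext => t /=; rewrite -scalerBl scalerA.
have cvv : (fun t : R => (t^-1 *: ((f \o shift x) (t *: h) - f x)) *: v) t
    @[t --> 0^'] --> 'D_h f x *: v.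
  by apply: cvgZl.
split; first by apply/cvg_ex; exists ('D_h f x *: v); rewrite E.
by rewrite /derive E; apply: cvg_lim.
Qed.

(** Iterated partial derivatives keep the form of a function of the class times the fixed vector
    [v]. *)
Lemma smooth_scalar_field f v : smooth_scalar f -> smooth (fun x => f x *: v).
Proof.
move=> sf.
have H (s : seq 'I_m) : exists2 g, smooth_scalar g &
    foldr partial (fun x => f x *: v) s = fun x => g x *: v.
  elim: s => [|i s [g sg IH]]; first by exists f.
  have [g' sg' dg'] := smooth_scalar_derive (delta_mx ord0 i) sg.
  exists g' => //=; rewrite IH; apply/funext => x.
  by have [_] := is_derive_scaler v (dg' x).
move=> s x; have [g sg ->] := H s.
by apply: differentiableZl; exact: smooth_scalar_differentiable.
Qed.

Lemma divergence_scalar_field f v x l : smooth_scalar f -> is_derive x v f l ->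
  divergence (fun x => f x *: v) x = l.
Proof.
move=> sf [_ <-]; rewrite divergenceE; last exact: (smooth_scalar_field v sf [::]).
have df := smooth_scalar_differentiable x sf.
rewrite deriveE//.
rewrite [in RHS](row_sum_delta v) raddf_sum; apply: eq_bigr => i _.
have Di := derivableP (@diff_derivable _ _ _ f x (delta_mx ord0 i) df).
rewrite /partial; have [_ ->] := is_derive_scaler v Di.
transitivity (v ord0 i * 'D_(delta_mx ord0 i) f x); first by rewrite mxE mulrC.
by rewrite deriveE//; apply/esym; exact: linearZ.
Qed.

End smooth_functions.

Section test_fields.
Context {R : realType} {m : nat}.
Notation mu := (@lebesgue R m).
Implicit Types (C E S : set 'rV[R]_m) (f g : 'rV[R]_m -> R) (h x y : 'rV[R]_m).

Lemma derive_outside_support f g S h : closed S -> (forall x, ~ S x -> f x = 0) ->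
  (forall x, is_derive x h f (g x)) -> forall x, ~ S x -> g x = 0.
Proof.
move=> cS f0 fg x nSx; have [_ <-] := fg x.
rewrite -(@derive_cst _ _ _ (0 : R) x h); apply: near_eq_derive.
have : nbhs x (~` S) by apply: open_nbhs_nbhs; split => //; exact: closed_openC.
by apply: filterS => y ny; exact: f0.
Qed.

(* The test field is [x |-> f (x - s h) h / H]: convexity keeps its support,
   the support of [f] moved along the segment from 0 to [h], inside [C°]. *)
Lemma test_field_bound C E f S h H P g s : convex_set C ->
  measurable (E : set (lebesgue_space m)) -> (mu E < +oo)%E ->
  smooth_scalar f -> (forall x, 0 <= f x <= 1) -> compact S ->
  (forall x, S x -> C° x /\ C° (x + h)) -> (forall x, ~ S x -> f x = 0) ->
  0 < H -> enorm h <= H -> (perimeter C E <= P%:E)%E ->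
  smooth_scalar g -> (forall x, is_derive x h f (g x)) -> 0 < s <= 1 ->
  \int[mu]_(x in E) g (x - s *: h) <= H * P.
Proof.
move=> cC mE Efin sf f01 cS SC f0 H0 hH perP sg dg s01.
have clS : closed S by apply: compact_closed => //; exact: norm_hausdorff.
have g0 := derive_outside_support clS f0 dg.
have [M M0 gM] := compact_support_bounded (smooth_scalar_continuous sg) cS g0.
pose fs x := H^-1 * f (x + - (s *: h)).
have sfs : smooth_scalar fs.
  by apply: SmoothMul; [exact: (SmoothCst H^-1)|exact: smooth_scalar_translate].
pose xi x := fs x *: h.
have sxi : smooth xi by exact: smooth_scalar_field.
have xiS : [set x | xi x != 0] `<=` [set s *: h + x | x in S].
  move=> x xix; exists (x - s *: h); last by rewrite addrC subrK.
  apply: contraPP xix => nS /=; rewrite /xi /fs f0// mulr0 scale0r.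
  by rewrite eqxx.
have cSh : compact [set s *: h + x | x in S].
  apply: continuous_compact => //; apply: continuous_subspaceT => x.
  by apply: (@cvgD R _ _ (nbhs x) _ (fun=> s *: h) id); [exact: cvg_cst|exact: cvg_id].
have clSh : closed [set s *: h + x | x in S].
  by apply: compact_closed => //; exact: norm_hausdorff.
have supS : field_support xi `<=` [set s *: h + x | x in S].
  by have := closure_subset xiS; rewrite -((closure_id _).1 clSh).
have dxi x : divergence xi x = H^-1 * g (x - s *: h).
  apply: divergence_scalar_field => //.
  have D1 : is_derive x h (fun x => f (x + - (s *: h))) (g (x - s *: h)).
    have E1 : (fun t : R => t^-1 *: (((fun x => f (x + - (s *: h))) \o shift x) (t *: h) -
        f (x + - (s *: h)))) =
      (fun t : R => t^-1 *: ((f \o shift (x - s *: h)) (t *: h) - f (x - s *: h))).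
      by apply/funext => t /=; rewrite addrA.
    by have [ex <-] := dg (x - s *: h); split; rewrite /derivable /derive E1.
  have D := is_deriveM (is_derive_cst H^-1 x h) D1.
  by apply: (is_derive_eq D); rewrite /= scaler0 addr0.
have le1 : (\int[mu]_(x in E) (divergence xi x)%:E <= P%:E)%E.
  apply: le_trans perP; apply: ereal_sup_ubound; exists xi => //; split => //.
  - by apply: (subclosed_compact _ cSh) => //; exact: closed_closure.
  - move=> x /supS[y Sy <-]; have [C1 C2] := SC _ Sy.
    have := convex_interior_segment cC C2 (interior_subset C1) s01.
    by rewrite addrAC subrr add0r addrC.
  - move=> x; rewrite /xi /fs enormZ normrM.
    have /andP[p0 p1] := f01 (x + - (s *: h)).
    rewrite (ger0_norm p0) gtr0_norm ?invr_gt0// mulrAC.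
    apply: (@le_trans _ _ (H^-1 * enorm h)).
      by rewrite ler_piMr// mulr_ge0 ?invr_ge0 ?enorm_ge0// ltW.
    by rewrite mulrC ler_pdivrMr ?mul1r.
have sgs : smooth_scalar (fun x => g (x + - (s *: h))) by exact: smooth_scalar_translate.
have ig : mu.-integrable E (EFin \o (fun x => g (x - s *: h))).
  by apply: (@bounded_continuous_integrable _ _ _ _ M) => //; exact: smooth_scalar_continuous.
have -> : \int[mu]_(x in E) g (x - s *: h) = H * \int[mu]_(x in E) divergence xi x.
  under [in RHS]eq_Rintegral do rewrite dxi.
  by rewrite RintegralZl// mulrA divff ?mul1r// gt_eqF.
rewrite ler_pM2l//.
have fin : (\int[mu]_(x in E) (divergence xi x)%:E)%E \is a fin_num.
  apply: integrable_fin_num => //.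
  have := integrableZl mE H^-1 ig; apply: eq_integrable => // x _.
  by rewrite /= dxi EFinM.
by rewrite -lee_fin /Rintegral fineK.
Qed.

(** Formally f(x) - f(x - h) is the integral of g(x - s h) over s in [0, 1], and [test_field_bound]
    applies to each [s]. The integral in [s] is replaced by a telescoping sum of N steps, with total
    error e |E|. *)
Lemma translation_test C E f S h H P : convex_set C ->
  measurable (E : set (lebesgue_space m)) -> (mu E < +oo)%E ->
  smooth_scalar f -> (forall x, 0 <= f x <= 1) -> compact S ->
  (forall x, S x -> C° x /\ C° (x + h)) -> (forall x, ~ S x -> f x = 0) ->
  0 < H -> enorm h <= H -> (perimeter C E <= P%:E)%E ->
  \int[mu]_(x in E) f x - \int[mu]_(x in E) f (x - h) <= H * P.
Proof.
move=> cC mE Efin sf f01 cS SC f0 H0 hH perP.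
have [g sg dg] := smooth_scalar_derive h sf.
have clS : closed S by apply: compact_closed => //; exact: norm_hausdorff.
have g0 := derive_outside_support clS f0 dg.
have [M M0 gM] := compact_support_bounded (smooth_scalar_continuous sg) cS g0.
have int_f v : mu.-integrable E (EFin \o (fun x => f (x - v))).
  apply: (@bounded_continuous_integrable _ _ _ _ 1) => //.
    exact/smooth_scalar_continuous/smooth_scalar_translate.
  by move=> x; have /andP[? ?] := f01 (x - v); rewrite ger0_norm.
have int_g v : mu.-integrable E (EFin \o (fun x => g (x - v))).
  apply: (@bounded_continuous_integrable _ _ _ _ M) => //.
  exact/smooth_scalar_continuous/smooth_scalar_translate.
pose V := fine (mu E).
have V0 : 0 <= V by exact: fine_ge0.
pose F s := \int[mu]_(x in E) f (x - s *: h).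
suff main e : 0 < e -> F 0 - F 1 <= H * P + e * V.
  have -> : \int[mu]_(x in E) f x = F 0.
    by rewrite /F; under [RHS]eq_Rintegral do rewrite scale0r subr0.
  have -> : \int[mu]_(x in E) f (x - h) = F 1.
    by rewrite /F; under [RHS]eq_Rintegral do rewrite scale1r.
  apply/ler_addgt0Pr => e e0.
  have V1 : 0 < V + 1 by rewrite ltr_wpDl.
  apply: (le_trans (main (e / (V + 1)) _)); first by rewrite divr_gt0.
  rewrite lerD2l -mulrA ler_piMr ?(ltW e0)//.
  by rewrite mulrC ler_pdivrMr// mul1r lerDl.
move=> e0.
have [d d0 hd] := uniform_difference_quotient (smooth_scalar_continuous sg) cS g0 dg e0.
pose N := (Num.truncn d^-1).+1; pose t : R := N%:R^-1.
have t0 : 0 < t by rewrite invr_gt0.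
have td : t < d by rewrite -[d]invrK ltf_pV2 ?posrE ?invr_gt0// truncnS_gt.
have step s : 0 < s <= 1 -> F (s - t) - F s <= t * (H * P + e * V).
  move=> s01.
  have sgt := test_field_bound cC mE Efin sf f01 cS SC f0 H0 hH perP sg dg s01.
  have it : mu.-integrable E (EFin \o (fun x => t * g (x - s *: h))).
    by have := integrableZl mE t (int_g (s *: h)).
  have ic : mu.-integrable E (EFin \o (fun=> e * t)).
    by apply: (@bounded_continuous_integrable _ _ (fun=> e * t) _ `|e * t|) => // ?; exact: cst_continuous.
  have i1 : mu.-integrable E (EFin \o (fun x => f (x - s *: h) + t * g (x - s *: h))).
    by have := integrableD mE (int_f (s *: h)) it.
  have i2 : mu.-integrable E (EFin \o (fun x =>
      f (x - s *: h) + t * g (x - s *: h) + e * t)).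
    by have := integrableD mE i1 ic.
  have : F (s - t) <= \int[mu]_(x in E) (f (x - s *: h) + t * g (x - s *: h) + e * t).
    apply: le_Rintegral => // x _.
    have := hd (x - s *: h) t; rewrite t0 td => /(_ isT).
    have -> : x - s *: h + t *: h = x - (s - t) *: h.
      by rewrite scalerBl opprB -addrA [- _ + t *: h]addrC.
    by rewrite ler_norml => /andP[_]; lra.
  rewrite RintegralD// RintegralD// RintegralZl// Rintegral_cst//.
  have := ler_wpM2l (ltW t0) sgt; rewrite -/V /F.
  by lra.
have Nt : N%:R * t = 1 by rewrite divff// pnatr_eq0.
have tele k : (k <= N)%N -> F 0 - F (k%:R * t) <= k%:R * (t * (H * P + e * V)).
  elim: k => [|k IH] kN; first by rewrite !mul0r subrr.
  have s01 : 0 < k.+1%:R * t <= 1.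
    by rewrite mulr_gt0//= ler_pdivrMr// mul1r ler_nat.
  have := lerD (IH (ltnW kN)) (step _ s01).
  have -> : k.+1%:R * t - t = k%:R * t by rewrite -natr1; ring.
  rewrite addrA subrK; move/le_trans; apply.
  by rewrite [k.+1%:R]mulrSr mulrDl mul1r.
by have := tele N (leqnn _); rewrite mulrA Nt mul1r.
Qed.

End test_fields.

(** * Volume moved by a translation *)

Section shifted_volume.
Context {R : realType} {m : nat}.
Notation mu := (@lebesgue R m).
Implicit Types (A C E S : set 'rV[R]_m) (q : 'rV[R]_m -> R) (h x y : 'rV[R]_m).
Implicit Types (ab : 'rV[R]_m * 'rV[R]_m) (o : option ('rV[R]_m * 'rV[R]_m)).

Definition closed_box ab : set 'rV[R]_m :=
  [set y | forall i, ab.1 ord0 i <= y ord0 i <= ab.2 ord0 i].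

Definition open_box o : set 'rV[R]_m :=
  oapp (fun ab => [set y : 'rV[R]_m | forall i, ab.1 ord0 i < y ord0 i < ab.2 ord0 i]) set0 o.

(** Positive exactly on the open box. The arguments are written in the affine form that [SmoothBump]
    expects. *)
Definition box_bump o x : R :=
  oapp (fun ab => \prod_i (bump 1 (1 * x ord0 i + - ab.1 ord0 i) *
                           bump 1 (-1 * x ord0 i + ab.2 ord0 i))) 0 o.

Lemma smooth_box_bump o : smooth_scalar (box_bump o).
Proof.
case: o => [ab|]; last exact: (SmoothCst 0).
apply: (@smooth_scalar_prod _ _ _ _ (fun i x => bump 1 (1 * x ord0 i + - ab.1 ord0 i) *
                           bump 1 (-1 * x ord0 i + ab.2 ord0 i))) => i.
by apply: SmoothMul; exact: SmoothBump.
Qed.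

Lemma box_bump01 o x : 0 <= box_bump o x <= 1.
Proof.
case: o => [ab|] /=; last by rewrite lexx ler01.
have H i : 0 <= bump 1 (1 * x ord0 i + - ab.1 ord0 i) *
                           bump 1 (-1 * x ord0 i + ab.2 ord0 i) <= 1.
  by rewrite mulr_ge0 ?bump_ge0//= mulr_ile1 ?bump_ge0 ?bump_le1.
rewrite prodr_ge0 => [|i _]; last by case/andP: (H i).
by apply: prodr_ile1.
Qed.

Lemma box_bump_gt0 o x : 0 < box_bump o x <-> open_box o x.
Proof.
case: o => [ab|] /=; last by rewrite ltxx.
have F i : (0 < bump 1 (1 * x ord0 i + - ab.1 ord0 i) *
     bump 1 (-1 * x ord0 i + ab.2 ord0 i)) = (ab.1 ord0 i < x ord0 i < ab.2 ord0 i).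
  rewrite lt_def mulf_eq0 negb_or mulr_ge0 ?bump_ge0// andbT.
  have P t : (bump 1 t != 0) = (0 < t).
    by rewrite -(bump_gt0 t) lt_def bump_ge0 andbT.
  by rewrite !P mul1r mulN1r subr_gt0 [- _ + _]addrC subr_gt0.
split => [H i|H]; last by apply: prodr_gt0 => i _; rewrite F; exact: H.
rewrite -F lt_def mulr_ge0 ?bump_ge0// andbT; apply: contraTneq H => H.
by rewrite (bigD1 i)//= H mul0r ltxx.
Qed.

Lemma open_open_box o : open (open_box o).
Proof.
have -> : open_box o = [set x | 0 < box_bump o x].
  by rewrite predeqE => x; split => /box_bump_gt0.
apply: (open_comp _ (@open_gt R 0)) => x _.
exact: smooth_scalar_continuous (smooth_box_bump o) x.
Qed.

Lemma closed_closed_box ab : closed (closed_box ab).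
Proof.
have -> : closed_box ab = \bigcap_(i in [set: 'I_m])
    [set y | ab.1 ord0 i <= y ord0 i <= ab.2 ord0 i].
  by rewrite predeqE => y; split => [H i _|H i]; [exact: H|exact: (H i)].
apply: closed_bigI => i _.
have : closed ((fun y : 'rV[R]_m => y ord0 i) @^-1` `[ab.1 ord0 i, ab.2 ord0 i]).
  apply: closed_comp => [y _|]; first exact: coord_continuous.
  exact: itv_closed.
by congr closed; rewrite predeqE => y; rewrite /= in_itv.
Qed.

Lemma convex_closed_box ab : convex_set (closed_box ab).
Proof.
apply: segment_convex => x y t Ax Ay /andP[t0 t1] i; rewrite !mxE.
have /andP[x1 x2] := Ax i; have /andP[y1 y2] := Ay i.
have T1 : 0 <= 1 - t by rewrite subr_ge0.
have -> : x ord0 i + t * (y ord0 i - x ord0 i) =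
  (1 - t) * x ord0 i + t * y ord0 i by ring.
have E c : c = (1 - t) * c + t * c by ring.
by rewrite [ab.1 _ _]E [ab.2 _ _]E !lerD// ler_wpM2l.
Qed.

Lemma compact_closed_box ab : compact (closed_box ab).
Proof.
apply: (@subclosed_compact _ _ (cube ab.1 `|ab.2 - ab.1|)).
- exact: closed_closed_box.
- exact: compact_cube.
- move=> y H; apply/row_norm_leP => // i; rewrite !mxE.
  have /andP[y1 y2] := H i.
  rewrite ger0_norm ?subr_ge0//.
  apply: le_trans (row_norm_coord (ab.2 - ab.1) i); rewrite !mxE.
  by rewrite ger0_norm ?subr_ge0 ?(le_trans y1)// lerD2r.
Qed.

(** The faces lie in the boundary of the closed box, which is convex and, unless the half-open box
    is empty, has its midpoint as interior point. *)
Lemma box_faces_null o : mu (obox o `\` open_box o) = 0.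
Proof.
case: o => [ab|]; last by rewrite set0D measure0.
apply/eqP; rewrite eq_le measure_ge0 andbT.
have [[x bx]|nb] := pselect (obox (Some ab) !=set0); last first.
  have -> : obox (Some ab) = set0 by apply/seteqP; split => // y yb; case: nb; exists y.
  by rewrite set0D measure0.
have ox : open_box (Some ab) ((2^-1 : R) *: (ab.1 + ab.2)).
  by move=> i; rewrite !mxE; have /andP[] := bx i; lra.
have ocb : open_box (Some ab) `<=` closed_box ab.
  by move=> y H i; have /andP[? ?] := H i; rewrite !ltW.
rewrite -(convex_boundary_null (@closed_closed_box ab) (@convex_closed_box ab)).
  apply: le_lebesgue => y [yb nyo]; split.
    by move=> i; have /andP[? ?] := yb i; rewrite ltW.
  apply: contra_not nyo => /interior_cube[r r0 rb] i.
  have bd s : `|s| <= r -> ab.1 ord0 i <= y ord0 i + s <= ab.2 ord0 i.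
    move=> sr; have := rb (y + const_mx s) _ i; rewrite !mxE; apply.
    rewrite /cube/= addrAC subrr add0r; apply/row_norm_leP; first exact: ltW.
    by move=> j; rewrite mxE.
  have := bd r; rewrite gtr0_norm// => /(_ (lexx _)).
  have := bd (- r); rewrite normrN gtr0_norm// => /(_ (lexx _)).
  by move=> /andP[? _] /andP[_ ?]; apply/andP; split; lra.
exists ((2^-1 : R) *: (ab.1 + ab.2)).
have := @open_open_box (Some ab); rewrite openE => /(_ _ ox).
exact: filterS ocb.
Qed.

Lemma Rintegral_power_limit E q : measurable (E : set (lebesgue_space m)) ->
  (mu E < +oo)%E -> smooth_scalar q -> (forall x, 0 <= q x <= 1) ->
  \int[mu]_(x in E) (1 - q x ^+ k) @[k --> \oo] --> fine (mu (E `&` [set x | q x < 1])).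
Proof.
move=> mE Efin sq q01.
have mQ : measurable ([set x | q x < 1] : set (lebesgue_space m)).
  apply: open_lebesgue_measurable; apply: (open_comp _ (@open_lt R 1)) => x _.
  exact: smooth_scalar_continuous.
have b01 k x : 0 <= 1 - q x ^+ k <= 1.
  have /andP[? ?] := q01 x.
  by rewrite subr_ge0 exprn_ile1//= gerBl exprn_ge0.
have ik k : mu.-integrable E (EFin \o (fun x => 1 - q x ^+ k)).
  apply: (@bounded_continuous_integrable _ _ _ _ 1) => //.
    exact/smooth_scalar_continuous/smooth_scalar_onem/smooth_scalar_exp.
  by move=> x; have /andP[? ?] := b01 k x; rewrite ger0_norm.
have [||||_ _] := @dominated_convergence _ _ _ mu E mE
    (fun k x => (1 - q x ^+ k)%:E) (fun x => (\1_[set x | q x < 1] x)%:E) (cst 1%E)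
    (fun k => measurable_int _ (ik k)).
- by apply/measurable_EFinP; apply: measurable_indic.
- apply: aeW => x Ex; apply/cvg_EFin; first by near=> k.
  rewrite indicE; have [qx|qx] := ltP (q x) 1.
    rewrite mem_set//; have := @cvgB R R nat \oo _ (fun=> 1) (fun k => q x ^+ k) 1 0.
    rewrite subr0; apply; first exact: cvg_cst.
    by apply: cvg_expr; have /andP[? _] := q01 x; rewrite ger0_norm.
  rewrite memNset ?/=; last by move/lt_le_trans/(_ qx); rewrite ltxx.
  rewrite (_ : _ \o _ = cst 0); first exact: cvg_cst.
  apply/funext => k /=; have /andP[_ q1] := q01 x.
  by have -> : q x = 1; [apply/le_anti/andP|rewrite expr1n subrr].
- apply: (@bounded_continuous_integrable _ _ (cst 1) _ 1) => //.
    by move=> ?; exact: cst_continuous.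
  by move=> x; rewrite /= normr1.
- apply: aeW => x k Ex; rewrite /= lee_fin; have /andP[? ?] := b01 k x.
  by rewrite ger0_norm.
rewrite integral_indic// setIC => cv; apply: fine_cvg.
rewrite fineK// ge0_fin_numE//; apply: le_lt_trans Efin.
by apply: le_lebesgue; exact: subIsetl.
Unshelve. all: by end_near. Qed.

Lemma limit_difference_le (u v : nat -> R) (lu lv c : R) :
  u k @[k --> \oo] --> lu -> v k @[k --> \oo] --> lv ->
  (forall k, u k - v k <= c) -> lu - lv <= c.
Proof.
move=> cu cv uvc; have cuv : (fun k => u k - v k) k @[k --> \oo] --> lu - lv by exact: cvgB.
rewrite -(cvg_lim _ cuv)//; apply: limr_le; last by apply: nearW => k; exact: uvc.
by apply/cvg_ex; exists (lu - lv).
Qed.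

(* The test functions are [1 - q ^+ k], which tend to the indicator function of
   the union of open boxes where [q < 1]. *)
Lemma shift_volume C E A h H P : convex_set C ->
  measurable (E : set (lebesgue_space m)) -> (mu E < +oo)%E ->
  0 < H -> enorm h <= H -> (perimeter C E <= P%:E)%E ->
  measurable (A : set (lebesgue_space m)) ->
  (forall x, A x -> [/\ E x, C° x, C° (x + h) & ~ E (x + h)]) ->
  (mu A <= (H * P)%:E)%E.
Proof.
move=> cC mE Efin H0 hH perP mA AE.
(* Supports in this open set are the ones whose whole motion along [h] stays in [C°]. *)
pose U : set 'rV[R]_m := C° `&` [set x | C° (x + h)].
have oU : open U.
  apply: openI; first exact: open_interior.
  apply: (@open_comp _ _ (fun x => x + h)); last exact: open_interior.
  move=> x _; apply: (@cvgD R _ _ (nbhs x) _ id (fun=> h)); [exact: cvg_id|exact: cvg_cst].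
have AU : A `<=` U by move=> x /AE[].
have Afin : (mu A < +oo)%E.
  by apply: le_lt_trans Efin; apply: le_lebesgue => x /AE[].
apply/lee_addgt0Pr => e0 e0_gt0; pose e := e0 / 2.
have e_gt0 : 0 < e by rewrite divr_gt0.
have [D [N [DU AW WA]]] := box_approximation oU mA AU Afin e_gt0.
set W := \bigcup_(k in `I_N) obox (D k) in AW WA.
have mW : measurable (W : set (lebesgue_space m)).
  by apply: fin_bigcup_measurable => // k _; exact: measurable_obox.
pose V : set 'rV[R]_m := \bigcup_(k in `I_N) open_box (D k).
have oV : open V by apply: bigcup_open => k _; exact: open_open_box.
have VW : V `<=` W.
  move=> x [k kN ok]; exists k => //; move: ok; rewrite /obox; case: (D k) => //= ab ox i.
  by have /andP[? ?] := ox i; apply/andP; split => //; exact: ltW.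
pose S : set 'rV[R]_m := \bigcup_(k in `I_N) oapp closed_box set0 (D k).
have cS : compact S.
  rewrite /S bigcup_mkord; apply: bigsetU_compact => k _.
  by case: (D k) => [ab|] /=; [exact: compact_closed_box|exact: compact0].
have SU : S `<=` U.
  by move=> x [k kN]; case Dk: (D k) => [ab|]//= xab; exact: (DU _ _ Dk).
(* Equal to 1 outside the union [V] of open boxes and smaller on it, so that [1 - q ^+ k] tends to
   its indicator. *)
pose q x := \prod_(j < N) (1 - box_bump (D j) x).
have sq : smooth_scalar q.
  by apply: smooth_scalar_prod => j; apply/smooth_scalar_onem/smooth_box_bump.
have f01 j x : 0 <= 1 - box_bump (D j) x <= 1.
  by have /andP[? ?] := box_bump01 (D j) x; rewrite subr_ge0 gerBl; apply/andP.
have q01 x : 0 <= q x <= 1.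
  rewrite /q prodr_ge0 => [|j _]; last by case/andP: (f01 j x).
  by apply: prodr_ile1.
have qV x : q x < 1 <-> V x.
  split => [|[k kN /box_bump_gt0 Dk]].
    apply: contraPP => nV; rewrite /q big1 ?ltxx// => j _.
    apply/eqP; rewrite subr_eq addrC -subr_eq subrr eq_sym.
    have /andP[j0 _] := box_bump01 (D j) x.
    rewrite eq_le j0 andbT leNgt; apply/negP => /box_bump_gt0 ?.
    by apply: nV; exists j => //=; exact: ltn_ord.
  rewrite /q (bigD1 (Ordinal kN))//=; apply: (@le_lt_trans _ _ (1 - box_bump (D k) x)).
    rewrite ler_piMr//; first by case/andP: (f01 k x).
    by apply: prodr_ile1.
  by rewrite gtrBl.
have V1 : [set x | q x < 1] = V by rewrite predeqE => x; exact: qV.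
have test k : \int[mu]_(x in E) (1 - q x ^+ k) - \int[mu]_(x in E) (1 - q (x - h) ^+ k)
    <= H * P.
  apply: (translation_test (S := S) cC mE Efin _ _ cS) => //.
  - exact/smooth_scalar_onem/smooth_scalar_exp.
  - move=> x; have /andP[? ?] := q01 x.
    by rewrite subr_ge0 exprn_ile1//= gerBl exprn_ge0.
  - move=> x nSx; have -> : q x = 1; last by rewrite expr1n subrr.
    have /andP[_ q1] := q01 x; apply/le_anti; rewrite q1/= leNgt; apply/negP => /qV[j jN oj].
    apply: nSx; exists j => //; move: oj; case: (D j) => //= ab ox i.
    by have /andP[? ?] := ox i; rewrite !ltW.
have sqh : smooth_scalar (fun x => q (x - h)) by exact: smooth_scalar_translate.
have lim1 := Rintegral_power_limit mE Efin sq q01.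
have lim2 := Rintegral_power_limit mE Efin sqh (fun x => q01 (x - h)).
pose l1 := fine (mu (E `&` [set x | q x < 1])).
pose l2 := fine (mu (E `&` [set x | q (x - h) < 1])).
have l12 : l1 - l2 <= H * P by exact: (limit_difference_le lim1 lim2 test).
have Ef B : (mu (E `&` B) < +oo)%E.
  by apply: le_lt_trans Efin; apply: le_lebesgue; exact: subIsetl.
(* A point of [E] in the translate of [V] comes, under [h], from a point of [W] outside [A], since
   points of [A] do not land in [E]. *)
have l2e : l2 <= e.
  rewrite -lee_fin fineK ?ge0_fin_numE//; apply: le_trans WA.
  rewrite -(lebesgue_translate h (W `\` A)).
  apply: le_lebesgue => x [Ex /qV Vx].
  exists (x - h); last by rewrite addrC subrK.
  split; first exact: VW.
  by move=> /AE[_ _ _]; rewrite subrK.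
have WV0 : mu (W `\` V) = 0%E.
  apply/eqP; rewrite eq_le measure_ge0 andbT.
  have mf k : measurable (obox (D k) `\` open_box (D k) : set (lebesgue_space m)).
    apply: measurableD; first exact: measurable_obox.
    by apply: open_lebesgue_measurable; exact: open_open_box.
  apply: (@le_trans _ _ (mu (\big[setU/set0]_(k < N) (obox (D k) `\` open_box (D k))))).
    rewrite -(bigcup_mkord N (fun k => obox (D k) `\` open_box (D k))).
    apply: le_lebesgue => x [[k kN xk] nV]; exists k => //; split => //.
    by apply: contra_not nV => ?; exists k.
  have B := le_mu_bigsetU mu (fun k (_ : (k < N)%N) => mf k).
  apply: (le_trans B).
  by rewrite big1// => k _; exact: box_faces_null.
have mV : measurable (V : set (lebesgue_space m)) by exact: open_lebesgue_measurable.
have mEV : measurable (E `&` V : set (lebesgue_space m)) by exact: measurableI.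
have Al1 : (mu A <= (l1 + e)%:E)%E.
  have mAW : measurable (A `\` W : set (lebesgue_space m)) by exact: measurableD.
  have mWV : measurable (W `\` V : set (lebesgue_space m)) by exact: measurableD.
  have mU1 : measurable ((E `&` V) `|` (A `\` W) : set (lebesgue_space m)).
    exact: measurableU.
  apply: (@le_trans _ _ (mu ((E `&` V) `|` (A `\` W) `|` (W `\` V)))).
    apply: le_lebesgue => x Ax; have [Wx|nWx] := pselect (W x); last by left; right.
    have [Vx|nVx] := pselect (V x); last by right.
    by left; left; split => //; have [] := AE _ Ax.
  apply: (le_trans (measureU2 _ mU1 mWV)).
  rewrite [X in (_ + X)%E]WV0 adde0.
  apply: (le_trans (measureU2 _ mEV mAW)).
  by rewrite EFinD leeD// /l1 V1 fineK// ge0_fin_numE.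
apply: (le_trans Al1); rewrite -EFinD lee_fin.
by move: l12 l2e; rewrite /e; lra.
Qed.

End shifted_volume.

(** * The isoperimetric profile *)

(** Double counting by Tonelli: the measure of [Z] is computed from its sections in both
    directions. *)
Lemma double_section_bound (R : realType) d (T : measurableType d)
    (nu : {sigma_finite_measure set T -> \bar R}) (Z : set (T * T)) (Q B : set T)
    (c v : R) :
  measurable Z -> measurable Q -> measurable B -> 0 <= c -> 0 <= v ->
  (forall h, (nu (xsection Z h) <= c%:E * (\1_Q h)%:E)%E) ->
  (forall x, (v%:E * (\1_B x)%:E <= nu (ysection Z x))%E) ->
  (v%:E * nu B <= c%:E * nu Q)%E.
Proof.
move=> mZ mQ mB c0 v0 F_le G_ge; have := indic_fubini_tonelli nu nu mZ.
rewrite indic_fubini_tonelli_FE// indic_fubini_tonelli_GE// => FG.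
have mind D : measurable D -> measurable_fun [set: T] (fun x => (\1_D x)%:E : \bar R).
  by move=> mD; apply/measurable_EFinP; exact: measurable_indic.
have L : (\int[nu]_x (v%:E * (\1_B x)%:E) <= \int[nu]_x (nu \o ysection Z) x)%E.
  apply: ge0_le_integral => //.
  - by move=> x _; rewrite mule_ge0// lee_fin.
  - by apply: measurable_funeM; exact: mind.
  - exact: measurable_fun_ysection.
have U : (\int[nu]_x (nu \o xsection Z) x <= \int[nu]_x (c%:E * (\1_Q x)%:E))%E.
  apply: ge0_le_integral => //.
  - exact: measurable_fun_xsection.
  - by apply: measurable_funeM; exact: mind.
  - by move=> x _; exact: F_le.
rewrite FG in U; have := le_trans L U.
have int D k : measurable D -> 0 <= k ->
    (\int[nu]_x (k%:E * (\1_D x)%:E) = k%:E * nu D)%E.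
  move=> mD k0; rewrite ge0_integralZl//; first by rewrite integral_indic// setIT.
  exact: mind.
by rewrite !int.
Qed.

Section averaging.
Context {R : realType} {m : nat}.
Notation mu := (@lebesgue R m).
Notation space := (@lebesgue_space R m).
Implicit Types (C E W A : set 'rV[R]_m) (h x y : 'rV[R]_m).

Let sum_preimage A : set (space * space) :=
  [set z | A ((z.1 : 'rV[R]_m) + (z.2 : 'rV[R]_m))].

Let measurable_sum_obox o : measurable (sum_preimage (obox o)).
Proof.
case: o => [ab|]; last first.
  by rewrite (_ : sum_preimage _ = set0)//; exact: measurable0.
have mc i : measurable_fun [set: space * space]
    (fun z : space * space => (z.1 : 'rV[R]_m) ord0 i + (z.2 : 'rV[R]_m) ord0 i).
  have mi : measurable_fun [set: space] (fun x : space => (x : 'rV[R]_m) ord0 i).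
    by apply: continuous_lebesgue_measurable; exact: coord_continuous.
  apply: measurable_funD.
    exact: (measurableT_comp mi measurable_fst).
  exact: (measurableT_comp mi measurable_snd).
rewrite (_ : sum_preimage _ = \bigcap_(i in [set: 'I_m])
  ((fun z : space * space => (z.1 : 'rV[R]_m) ord0 i + (z.2 : 'rV[R]_m) ord0 i)
    @^-1` `]ab.1 ord0 i, ab.2 ord0 i])).
  apply: fin_bigcap_measurable => // i _.
  by rewrite -[X in measurable X]setTI; apply: mc.
rewrite predeqE => z; split => [H i _|H i].
  by have := H i; rewrite /= mxE in_itv.
by have := H i I; rewrite /= mxE in_itv.
Qed.

Let measurable_sum_closed C : closed C -> measurable (sum_preimage C).
Proof.
move=> cC; have [B [UB _]] := closed_box_subset_open (closed_openC cC).
rewrite (_ : sum_preimage C = ~` (\bigcup_k sum_preimage (obox (B k)))).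
  by apply: measurableC; apply: bigcupT_measurable => k; exact: measurable_sum_obox.
rewrite predeqE => z; split => [Cz [k _ Bz]|nB].
  by have : (~` C) (z.1 + z.2); [rewrite UB; exists k|].
apply: contrapT => nC; apply: nB.
by have : (~` C) (z.1 + z.2) by []; rewrite UB => -[k _ Bk]; exists k.
Qed.

(* Replacing the set by a finite union [W] of boxes makes the overlaps
   measurable for the product of the Lebesgue sigma-algebras, on which addition
   is not a measurable map. *)
Lemma average_shift C (D : nat -> option ('rV[R]_m * 'rV[R]_m)) (N : nat) (r v c : R) :
  let W := \bigcup_(k in `I_N) obox (D k) in
  closed C -> 0 < r -> 0 <= v ->
  (forall h, `|h| <= r -> (mu [set x | [/\ W x, C (h + x)%R & ~ W (h + x)%R]] <= c%:E)%E) ->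
  (forall x, C x -> (v%:E <= mu ((C `&` cube x r) `\` W))%E) ->
  (v%:E * mu (C `&` W) <= c%:E * mu (cube 0 r))%E.
Proof.
move=> W clC r0 v0 Hc Hv.
have c0 : 0 <= c by rewrite -lee_fin (le_trans _ (Hc 0 _))// normr0 ltW.
have mW : measurable (W : set space).
  by apply: fin_bigcup_measurable => // k _; exact: measurable_obox.
have mC : measurable (C : set space) by exact: closed_lebesgue_measurable.
have mCW : measurable (C `&` W : set space) by exact: measurableI.
have mQ : measurable (cube 0 r : set space) by exact: measurable_cube.
have mSW : measurable (sum_preimage W).
  rewrite (_ : sum_preimage W = \bigcup_(k in `I_N) sum_preimage (obox (D k))).
    by apply: fin_bigcup_measurable => // k _; exact: measurable_sum_obox.
  by rewrite predeqE => z; split => -[k kN zk]; exists k.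
(* Pairs of a translation [h] and a point of [W] that it moves into [C] outside [W]. For fixed [h]
   the section is bounded by [c]; for a fixed point [x] of [C] and [W] it contains a translate of
   the rest of [C] in [cube x r]. *)
pose Z : set (space * space) := ((cube 0 r `*` W) `&` sum_preimage C) `\` sum_preimage W.
have mZ : measurable Z.
  apply: measurableD => //; apply: measurableI; last exact: measurable_sum_closed.
  exact: measurableX.
have F_le h : (mu (xsection Z h) <= (c%:E * (\1_(cube 0 r) h)%:E))%E.
  rewrite indicE; have [hQ|hQ] := pselect (cube 0 r h).
    rewrite mem_set// mule1; apply: le_trans (Hc h _).
      apply: le_lebesgue => x; rewrite /xsection/= inE => -[[[_ ?] ?] ?]; split => //.
    by move: hQ; rewrite /cube/= subr0.
  rewrite memNset// mule0 (_ : xsection Z h = set0) ?measure0//.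
  by apply/seteqP; split => // x; rewrite /xsection/= inE => -[[[]]].
have G_ge x : (v%:E * (\1_(C `&` W) x)%:E <= mu (ysection Z x))%E.
  rewrite indicE; have [[Cx Wx]|nCW] := pselect ((C `&` W) x); last first.
    by rewrite memNset// mule0.
  rewrite mem_set// mule1; apply: (le_trans (Hv x Cx)).
  rewrite -(lebesgue_translate (- x)); apply: le_lebesgue => _ [y [[Cy Qy] nWy] <-].
  rewrite /ysection/= inE; split; last by rewrite /sum_preimage/= addrC addNKr.
  split; last by rewrite /sum_preimage/= addrC addNKr.
  by split => //; rewrite /cube/= subr0 addrC.
exact: (double_section_bound mZ mQ mCW c0 v0 F_le G_ge).
Qed.

(** Averaging yields (v - e)^2 <= (H P + 2 e) c0, where [e] is the error of the approximation by
    boxes. As e <= v/2 and 2 e c0 <= v^2/8, there remains v^2/4 - v^2/8 <= H P c0, whence the 8. [H]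
    bounds the Euclidean norm of translations in the cube of radius [r]. *)
Lemma perimeter_lower_bound C E v r : convex_body C -> 0 < v -> 0 < r ->
  (forall x, C x -> ((2 * v)%:E <= mu (C `&` cube x r))%E) ->
  measurable (E : set space) -> E `<=` C -> mu E = v%:E ->
  ((v ^+ 2 / (8 * (r ^+ m * unit_cube_volume R m) * (m%:R * r + 1)))%:E <= perimeter C E)%E.
Proof.
move=> [clC cC C0] v0 r0 Hv mE EC Ev.
set c0 := r ^+ m * _; set H := m%:R * r + 1.
have [_ u0] := @cube0_volume R m.
have c0_gt0 : 0 < c0 by rewrite mulr_gt0// exprn_gt0.
have H0 : 0 < H by rewrite ltr_wpDl// mulr_ge0// ltW.
have Efin : (mu E < +oo)%E by rewrite Ev ltry.
have H1 : 0 < 8 * c0 * H by rewrite mulr_gt0// mulr_gt0.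
suff main P : (perimeter C E <= P%:E)%E -> v ^+ 2 / (8 * c0 * H) <= P.
  case EP : (perimeter C E) => [P| |]; last first.
  - have := main 0; rewrite EP leNye => /(_ isT).
    by rewrite pmulr_lle0 ?invr_gt0// leNgt exprn_gt0.
  - by rewrite leey.
  - by rewrite lee_fin; apply: main; rewrite EP.
move=> perP.
have mC : measurable (C : set space) by exact: closed_lebesgue_measurable.
have mCi : measurable (C° : set space).
  by apply: open_lebesgue_measurable; exact: open_interior.
pose e := Num.min (v / 2) (v ^+ 2 / (16 * c0)).
have e0 : 0 < e by rewrite lt_min !divr_gt0 ?exprn_gt0// mulr_gt0.
have ev : e <= v / 2 by rewrite ge_min lexx.
have ec : e * (16 * c0) <= v ^+ 2.
  have c16 : 0 < 16 * c0 by rewrite mulr_gt0.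
  by rewrite -(ler_pdivlMr _ _ c16) ge_min lexx orbT.
have [D [N [_ EW WE]]] := box_approximation openT mE (@subsetT _ _) Efin e0.
set W := \bigcup_(k in `I_N) obox (D k) in EW WE.
have mW : measurable (W : set space).
  by apply: fin_bigcup_measurable => // k _; exact: measurable_obox.
have muU A B : (mu (A `|` B) <= mu A + mu B)%E by exact: outer_measureU2.
have muW : (mu W <= (v + e)%:E)%E.
  apply: (@le_trans _ _ (mu (E `|` (W `\` E)))).
    by apply: le_lebesgue => x Wx; have [?|?] := pselect (E x); [left|right].
  by apply: (le_trans (muU _ _)); rewrite Ev EFinD leeD2l.
have muEW : ((v - e)%:E <= mu (C `&` W))%E.
  apply: (@le_trans _ _ (mu (E `&` W))); last first.
    by apply: le_lebesgue; exact: setSI.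
  have : (mu E <= mu (E `&` W) + mu (E `\` W))%E.
    by apply: le_trans (muU _ _); rewrite setUIDK.
  rewrite Ev EFinB leeBlDr// => /le_trans; apply.
  by rewrite leeD2l.
have bnd h : `|h| <= r ->
    (mu [set x | [/\ W x, C (h + x)%R & ~ W (h + x)%R]] <= (H * P + 2 * e)%:E)%E.
  move=> hr.
  pose A : set 'rV[R]_m := [set x | [/\ E x, C° x, C° (x + h) & ~ E (x + h)]].
  have trE B : [set x | B (x + h)] = [set - h + x | x in B].
    rewrite predeqE => x; split => [Bx|[y By <-]]; last by rewrite /= addrC addNKr.
    by exists (x + h) => //; rewrite addrC addrK.
  have mA : measurable (A : set space).
    rewrite (_ : A = (E `&` C°) `&` ([set - h + x | x in C°] `\` [set - h + x | x in E])).
      apply: measurableI; first exact: measurableI.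
      by apply: measurableD; exact: measurable_translate.
    by rewrite -!trE predeqE => x; split => [[]|[[? ?] [? ?]]].
  have muA : (mu A <= (H * P)%:E)%E.
    apply: (@shift_volume R m C E A h H P) => //.
    apply: (le_trans (enorm_le_norm h)); apply: (@le_trans _ _ (m%:R * r)).
      by rewrite ler_wpM2l.
    by rewrite lerDl.
  have N1 : mu (C `\` C°) = 0%E by exact: convex_boundary_null.
  (* Replacing [W] by [E] costs [e] at the point and [e] at its image; replacing [C] by its interior
     costs nothing. *)
  apply: (@le_trans _ _ (mu ((A `|` ((W `\` E) `|` [set - h + x | x in E `\` W])) `|`
     ((C `\` C°) `|` [set - h + x | x in C `\` C°])))).
    apply: le_lebesgue => x [Wx Chx nWhx]; rewrite -!trE.
    have [Ex|nEx] := pselect (E x); last by left; right; left.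
    have [Cix|nCix] := pselect (C° x); last by right; left; split => //; exact: EC.
    have [Cihx|nCihx] := pselect (C° (x + h)); last first.
      by right; right; split => //; rewrite addrC.
    have [Ehx|nEhx] := pselect (E (x + h)); last by left; left.
    by left; right; right; split => //; rewrite addrC.
  apply: (le_trans (muU _ _)).
  have -> : mu ((C `\` C°) `|` [set - h + x | x in C `\` C°]) = 0%E.
    apply/eqP; rewrite eq_le measure_ge0 andbT (le_trans (muU _ _))//.
    by rewrite lebesgue_translate N1 adde0.
  rewrite adde0 (le_trans (muU _ _))// EFinD leeD//.
  by rewrite (le_trans (muU _ _))// lebesgue_translate mulr_natl mulr2n EFinD leeD.
(* The cube carries 2v and [W] has volume at most v + e. *)
have low x : C x -> ((v - e)%:E <= mu ((C `&` cube x r) `\` W))%E.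
  move=> Cx; have := Hv x Cx => H2.
  have : ((2 * v)%:E <= mu ((C `&` cube x r) `\` W) + mu W)%E.
    apply: (le_trans H2); apply: le_trans (muU _ _); apply: le_lebesgue => y Cy.
    by have [?|?] := pselect (W y); [right|left].
  move=> /le_trans/(_ (leeD2l _ muW)).
  by rewrite -leeBlDr// -EFinB; congr (_ <= _)%E; congr EFin; ring.
have ve : 0 <= v - e by move: ev; lra.
have := average_shift clC r0 ve bnd low.
rewrite lebesgue_cube// -/c0 -EFinM => avg.
have : (v - e) * (v - e) <= (H * P + 2 * e) * c0.
  by rewrite -lee_fin; apply: le_trans avg; rewrite EFinM lee_wpmul2l.
rewrite ler_pdivrMr// => key.
have : v / 2 * (v / 2) <= (v - e) * (v - e) by apply: ler_pM; move: ev v0; lra.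
by move: ec key; nra.
Qed.

Lemma unif_profile_gt0 C v : convex_body C -> ~ bounded_set C -> unif C -> 0 < v ->
  (0 < isoperimetric_profile C v)%E.
Proof.
move=> bC ubC uC v0; have [clC cC _] := bC.
have [r r0 Hr] := unif_large cC clC ubC uC (2 * v).
pose K := v ^+ 2 / (8 * (r ^+ m * unit_cube_volume R m) * (m%:R * r + 1)).
have [_ u0] := @cube0_volume R m.
apply: (@lt_le_trans _ _ K%:E).
  by rewrite lte_fin divr_gt0 ?exprn_gt0// !mulr_gt0 ?exprn_gt0// ltr_wpDl// mulr_ge0// ltW.
apply: le_ereal_inf_tmp => _ [E [mE EC Ev] <-].
exact: perimeter_lower_bound.
Qed.

End averaging.

(** * From a positive profile to uniform geometry *)

Section positive_profile.
Context {R : realType} {m : nat}.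
Notation mu := (@lebesgue R m).
Implicit Types (C : set 'rV[R]_m) (x : 'rV[R]_m) (r s t v : R).

(** Comparison of concentric truncations by dilation makes the volume Lipschitz for radii near [s].
    The intermediate value theorem will then produce truncations of prescribed volume. *)
Lemma cube_volume_continuous C x s : convex_set C -> C x -> 0 < s ->
  {for s, continuous (fun r => fine (mu (C `&` cube x r)))}.
Proof.
move=> cC Cx s0; pose f r := fine (mu (C `&` cube x r)).
have f0 r : 0 <= f r by exact: fine_ge0.
have s2 : 0 < s / 2 by rewrite divr_gt0.
have f_le r r' : 0 < r <= r' -> f r <= f r'.
  move=> /andP[r0 rr']; have r'0 := lt_le_trans r0 rr'.
  rewrite fine_le ?ge0_fin_numE ?cube_finite//.
  by apply: le_lebesgue => y [Cy yr]; split => //; exact: le_trans rr'.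
have f_lip r r' : s / 2 <= r -> r <= r' -> r' - r <= s / 2 -> r' <= 2 * s ->
    f r' - f r <= 3 ^+ m * (r' - r) / (s / 2) * f (2 * s).
  move=> sr rr' d r's; have r0 := lt_le_trans s2 sr.
  have u01 : 0 <= (r' - r) / r <= 1.
    rewrite divr_ge0 ?subr_ge0 ?(ltW r0)//= ler_pdivrMr// mul1r.
    exact: le_trans sr.
  have := cube_ratio_fine cC Cx (_ : 0 < r <= r'); rewrite r0 rr' => /(_ isT) H.
  have E : r' / r = 1 + (r' - r) / r by rewrite mulrBl divff ?gt_eqF// addrC subrK.
  have H2 := ler_wpM2r (f0 r) (bernoulli_upper m u01).
  have : f r' - f r <= 3 ^+ m * ((r' - r) / r) * f r.
    rewrite lerBlDr; apply: (le_trans H); rewrite E; apply: (le_trans H2).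
    by rewrite mulrDl mul1r addrC.
  move/le_trans; apply; rewrite -mulrA -[in leRHS]mulrA -!mulrA.
  rewrite ler_wpM2l ?exprn_ge0// ler_wpM2l ?subr_ge0// ler_pM ?invr_ge0 ?(ltW r0)//.
    by rewrite lef_pV2.
  by apply: f_le; rewrite r0 (le_trans rr').
pose L := 3 ^+ m / (s / 2) * f (2 * s) + 1.
have L0 : 0 < L.
  by rewrite ltr_wpDl// mulr_ge0// divr_ge0 ?exprn_ge0// ltW.
have f_lipL r r' : s / 2 <= r -> r <= r' -> r' - r <= s / 2 -> r' <= 2 * s ->
    `|f r' - f r| <= L * (r' - r).
  move=> sr rr' d r's; rewrite ger0_norm ?subr_ge0; last first.
    by apply: f_le; rewrite rr' (lt_le_trans s2).
  apply: (le_trans (f_lip _ _ sr rr' d r's)).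
  rewrite /L [leRHS]mulrDl mul1r ler_wpDr ?subr_ge0// le_eqVlt; apply/orP; left.
  by apply/eqP; ring.
apply/cvgrPdist_lt => e e0; near=> t.
have ts : `|s - t| < s / 2.
  near: t; exists (s / 2) => // t; by [].
have te : `|s - t| < e / L.
  near: t; exists (e / L); first by rewrite /= divr_gt0.
  by [].
apply: (@le_lt_trans _ _ (L * `|s - t|)); last by rewrite mulrC -ltr_pdivlMr.
have [st|st] := leP s t.
  rewrite distrC [`|s - t|]distrC (ger0_norm (_ : 0 <= t - s)) ?subr_ge0//.
  move: ts; rewrite ler0_norm ?subr_le0// opprB => ts.
  by apply: f_lipL => //; move: ts s0; lra.
rewrite (ger0_norm (_ : 0 <= s - t)) ?subr_ge0 ?(ltW st)//.
move: ts; rewrite ger0_norm ?subr_ge0 ?(ltW st)// => ts.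
by apply: f_lipL; rewrite ?(ltW st)//; move: ts s0; lra.
Unshelve. all: by end_near. Qed.

(* Where [C] is thin, the truncation [C `&` cube x r] of volume [v] has a large
   [r], hence a small perimeter. *)
Lemma profile_gt0_unif C v : convex_body C -> ~ bounded_set C -> 0 < v ->
  (0 < isoperimetric_profile C v)%E -> unif C.
Proof.
move=> bC ubC v0 pv; have [clC cC _] := bC; apply: contrapT => nu.
have [k k0 kp] : exists2 k : R, 0 < k & (k%:E <= isoperimetric_profile C v)%E.
  case: (isoperimetric_profile C v) pv => [p| |]//.
    by rewrite lte_fin => p0; exists p.
  by exists 1 => //; rewrite leey.
pose M : R := m%:R * (4 * 3 ^+ m).
have M0 : 0 <= M by rewrite !mulr_ge0// exprn_ge0.
(* Truncations of volume [v] and radius at least [T] have perimeter at most M v / T, which is less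
   than [k] since k T = M v + k. *)
pose T := M * v / k + 1.
have T0 : 0 < T by rewrite ltr_wpDl// divr_ge0 ?(ltW k0)// mulr_ge0// ltW.
have [x Cx xT] := not_unifP nu T0 v0.
have [r1 r10 xr1] := convex_body_large x bC ubC v.
pose f r := fine (mu (C `&` cube x r)).
have fE r : 0 < r -> mu (C `&` cube x r) = (f r)%:E.
  by move=> r0; rewrite fineK// ge0_fin_numE// cube_finite.
rewrite !fE// !lee_fin lte_fin in xT xr1.
have Tr1 : T <= r1.
  rewrite leNgt; apply/negP => r1T; move: (lt_le_trans xT xr1).
  rewrite ltNge -lee_fin -!fE//; apply/negP; rewrite negbK.
  by apply: le_lebesgue => y [Cy yr]; split => //; exact: le_trans (ltW r1T).
have cf : {within `[T, r1], continuous f}.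
  apply: continuous_in_subspaceT => r; rewrite inE/= in_itv/= => /andP[Tr _].
  by apply: cube_volume_continuous => //; exact: lt_le_trans Tr.
have [|r rT fr] := IVT (v := v) Tr1 cf.
  by rewrite ge_min le_max (ltW xT) xr1 orbT.
move: rT; rewrite in_itv/= => /andP[Tr _]; have r0 := lt_le_trans T0 Tr.
have mE : measurable (C `&` cube x r : set (lebesgue_space m)).
  apply: measurableI; first exact: closed_lebesgue_measurable.
  exact: measurable_cube.
have : (k%:E <= (M / r * v)%:E)%E.
  apply: (le_trans kp); apply: (@le_trans _ _ (perimeter C (C `&` cube x r))).
    apply: ereal_inf_lbound; exists (C `&` cube x r) => //; split => //.
    by rewrite fE// fr.
  by have := perimeter_cube clC cC Cx r0; rewrite -/(f r) fr.
rewrite lee_fin leNgt => /negP; apply.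
rewrite mulrAC ltr_pdivrMr//; apply: (@lt_le_trans _ _ (k * T)).
  by rewrite mulrDr mulr1 mulrCA divff ?gt_eqF// mulr1 ltrDl.
by rewrite ler_pM2l.
Qed.

End positive_profile.

Theorem proposition3p13 (R : realType) (n : nat) (n_ge1 : (1 <= n)%N)
    (C : set 'rV[R]_n.+1) (C_body : convex_body C)
    (C_unbounded : ~ bounded_set C) :
  let i := forall r : R, 0 < r -> (0 < inf_ball_volume C r)%E in
  let ii := uniform_geometry C in
  let iii := forall K : set 'rV[R]_n.+1,
    asymptotic_cylinder C K -> convex_body K in
  let iv := forall v : R, 0 < v -> (0 < isoperimetric_profile C v)%E in
  let v := exists2 v0 : R, 0 < v0 & (0 < isoperimetric_profile C v0)%E in
  [<-> i; ii; iii; iv; v] /\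
  (i \/ ii \/ iii \/ iv \/ v ->
   (0 < ereal_inf [set solid_angle (tangent_cone C x) x | x in boundary C])%E).
Proof.
move=> i ii iii iv v; have [clC cC C0] := C_body.
have i_ii : i -> ii by move=> Hi; split => //; exists 1 => //; exact: Hi.
have ii_u : ii -> unif C by move=> [_ _ [r r0]]; exact: inf_ball_volume_unif.
have u_iii : unif C -> iii.
  move=> uC K aK; have [clK cK _ _] := aK.
  by split => //; exact: unif_cylinder_interior aK.
have iii_u : iii -> unif C.
  by move=> HK; apply: cylinder_interior_unif => // K /HK[].
have u_iv : unif C -> iv by move=> uC w w0; exact: unif_profile_gt0.
have iv_v : iv -> v by move=> Hiv; exists 1 => //; exact: Hiv.
have v_u : v -> unif C by move=> [w w0]; exact: profile_gt0_unif.
have u_i : unif C -> i by move=> uC r r0; exact: unif_inf_ball_volume.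
split; first by tfae => //; [move/ii_u/u_iii|move/iii_u/u_iv|move/v_u/u_i].
move=> H; apply: unif_solid_angle => //.
by case: H => [/i_ii/ii_u|[/ii_u|[/iii_u|[/iv_v/v_u|/v_u]]]].
Qed.
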